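(* Let $X=X(Q_0)$ be a rearrangement invariant space whose lower Boyd index satisfies $\alpha_X>0$. Then $GaRo_X=X$.
   Context: $Q_0\subset\mathbb R^n$ is a fixed cube with $|Q_0|=1$; all cubes have sides parallel to the coordinate axes. $P=P(Q_0)$ is the set of all countable (possibly finite) families $\{Q_i\}$ of subcubes of $Q_0$ with pairwise disjoint interiors. Rearrangement invariant (r.i.) space $X$ on $Q_0$: a Banach function space on $(Q_0,dx)$ which is either separable or has the Fatou property ($0\le f_n\uparrow f\in X$ implies $\|f_n\|_X\uparrow\|f\|_X$), such that $g\in X$ and $f^*=g^*$ imply $f\in X$ and $\|f\|_X=\|g\|_X$, where $f^*$ denotes the decreasing rearrangement of $|f|$. One has $L^\infty\subset X\subset L^1$ with continuous embeddings. Convention: $\|g\|_X=\infty$ if $g\notin X$. The representation space $\bar X$ is the unique r.i. space on $(0,1)$ with $\|f\|_X=\|f^*\|_{\bar X}$. For $s>0$ the dilation operator on $\bar X$ is $\sigma_sf(t)=f^*(t/s)$ if $0<t<s$ and $\sigma_sf(t)=0$ if $t\ge s$ ($t\in(0,1)$). The lower Boyd index is $\alpha_X=\lim_{s\to0+}\frac{\ln\|\sigma_s\|_{\bar X\to\bar X}}{\ln s}$. For $f\in L^1(Q_0)$, $\Gamma_f$ is the class of integrable functions $\gamma$ on $Q_0$ such that for all $\{Q_i\}\in P$ $$\sum_i\frac1{|Q_i|}\int_{Q_i}\int_{Q_i}|f(x)-f(y)|\,dx\,dy\le\sum_i\int_{Q_i}\gamma(x)\,dx .$$ $\|f\|_{GaRo_X}=\inf\{\|\gamma\|_X:\gamma\in\Gamma_f\}$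 (equal to $\infty$ if $\Gamma_f=\varnothing$), and $GaRo_X=\{f\in L^1(Q_0):\|f\|_{GaRo_X}<\infty\}$. Note that $\|f-c\|_{GaRo_X}=\|f\|_{GaRo_X}$ for every constant $c$; the equality of spaces is as sets of functions (comparison of norms is modulo constants).
   Formalization: The Fatou property is taken in its standard strong form: 0≤f_n↑f with f_n∈X implies ‖f_n‖→‖f‖, where ‖f‖=∞ if f∉X; with the form that assumes f∈X the claim fails for some closed r.i. ideals of Marcinkiewicz spaces. *)

(* Defs.v *)
From HB Require Import structures.
From mathcomp Require Import all_boot all_order all_algebra.
From mathcomp Require Import all_classical all_reals all_analysis.

Set Implicit Arguments.
Unset Strict Implicit.
Unset Printing Implicit Defensive.

Import Order.TTheory GRing.Theory Num.Theory.
Import numFieldNormedType.Exports.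

Local Open Scope classical_set_scope.
Local Open Scope ring_scope.

(* Lebesgue measure on R^n, with R^n represented by n.-tuple R: the iterated
   product measure, transported along R * R^n ~ R^(n+1). *)
Section lebesgue_measure_tuple.
Variable R : realType.

Local Notation Rn n := (n.-tuple R).

Definition tuple_of_pair n (p : R * Rn n) : Rn n.+1 :=
  [tuple of p.1 :: p.2].

Lemma measurable_tuple_of_pair n :
  measurable_fun [set: R * Rn n] (@tuple_of_pair n).
Proof. exact: measurable_cons. Qed.

Section step.
Variables (n : nat) (m : {sigma_finite_measure set (Rn n) -> \bar R}).

Definition lebesgue_cons : set (Rn n.+1) -> \bar R :=
  pushforward (@lebesgue_measure R \x m)%E (@tuple_of_pair n).

Let lebesgue_cons0 : lebesgue_cons set0 = 0%E.
Proof. by rewrite /lebesgue_cons /pushforward preimage_set0 measure0. Qed.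

Let lebesgue_cons_ge0 A : (0 <= lebesgue_cons A)%E.
Proof. by rewrite /lebesgue_cons /pushforward measure_ge0. Qed.

Let lebesgue_cons_sigma_additive : semi_sigma_additive lebesgue_cons.
Proof.
move=> F mF tF mUF; rewrite /lebesgue_cons /pushforward preimage_bigcup.
have mS A : measurable A -> measurable (@tuple_of_pair n @^-1` A).
  by move=> mA; rewrite -[X in measurable X]setTI; exact: measurable_tuple_of_pair.
apply: measure_semi_sigma_additive.
- by move=> k; exact: mS.
- apply/trivIsetP => /= i j _ _ ij; rewrite -preimage_setI.
  by move/trivIsetP : tF => /(_ _ _ _ _ ij) ->//; rewrite preimage_set0.
- by rewrite -preimage_bigcup; exact: mS.
Qed.

HB.instance Definition _ := isMeasure.Build _ _ _ lebesgue_cons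
  lebesgue_cons0 lebesgue_cons_ge0 lebesgue_cons_sigma_additive.

Lemma lebesgue_consE (A : set R) (B : set (Rn n)) :
  measurable A -> measurable B ->
  lebesgue_cons [set x | A (thead x) /\ B [tuple of behead x]] =
  (lebesgue_measure A * m B)%E.
Proof.
move=> mA mB; rewrite -product_measure1E//; congr (product_measure1 _ _ _).
apply/seteqP; split=> -[x y] /=; rewrite theadE.
  by move=> [Ax]; rewrite (_ : [tuple of _] = y)//; exact/val_inj.
by move=> [Ax By]; rewrite (_ : [tuple of _] = y)//; exact/val_inj.
Qed.

Lemma lebesgue_cons_sigma_finite : sigma_finite setT lebesgue_cons.
Proof.
have /sigma_finiteP[F [TF ndF Foo]] := sigma_finiteT (@lebesgue_measure R).
have /sigma_finiteP[G [TG ndG Goo]] := sigma_finiteT m.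
exists (fun k => [set x | F k (thead x) /\ G k [tuple of behead x]]).
  apply/esym; rewrite -subTset => x _.
  have [i _ Fi] : (\bigcup_k F k) (thead x) by rewrite -TF.
  have [j _ Gj] : (\bigcup_k G k) [tuple of behead x] by rewrite -TG.
  exists (maxn i j) => //; split.
    by move: Fi; exact/subsetPset/ndF/leq_maxl.
  by move: Gj; exact/subsetPset/ndG/leq_maxr.
move=> k; have [mF Fk] := Foo k; have [mG Gk] := Goo k; split.
  apply: measurableI.
    by rewrite -[X in measurable X]setTI; exact: measurable_tnth.
  by rewrite -[X in measurable X]setTI; exact: measurable_behead.
by rewrite lebesgue_consE// lte_mul_pinfty// ge0_fin_numE.
Qed.

HB.instance Definition _ := Measure_isSigmaFinite.Build _ _ _ lebesgue_cons
  lebesgue_cons_sigma_finite.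

End step.

Fixpoint lebesgue_tuple n : {sigma_finite_measure set (Rn n) -> \bar R} :=
  if n is n'.+1 then lebesgue_cons (lebesgue_tuple n')
  else \d_([tuple] : Rn 0).

End lebesgue_measure_tuple.
Arguments lebesgue_tuple {R} n.

Section cubes.
Variables (R : realType) (n : nat).

Record cube := Cube {
  corner : n.-tuple R ;
  side : R ;
  side_gt0 : 0 < side }.

Definition cube_set (Q : cube) : set (n.-tuple R) :=
  [set x | forall i,
    tnth (corner Q) i <= tnth x i <= tnth (corner Q) i + side Q].

Definition cube_interior (Q : cube) : set (n.-tuple R) :=
  [set x | forall i,
    tnth (corner Q) i < tnth x i < tnth (corner Q) i + side Q].

(* The families in P(Q0), countable or finite, are indexed by an arbitrary set
   I of natural numbers; the values of Q outside I are irrelevant. *)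
Definition cube_packing (Q0 : cube) (I : set nat) (Q : nat -> cube) : Prop :=
  (forall i, I i -> cube_set (Q i) `<=` cube_set Q0) /\
  trivIset I (fun i => cube_interior (Q i)).

End cubes.

Lemma measurable_cube_set (R : realType) n (Q : cube R n) :
  measurable (cube_set Q).
Proof.
rewrite (_ : cube_set Q = \bigcap_(i in [set: 'I_n])
    ((@tnth n R ^~ i) @^-1` `[tnth (corner Q) i, tnth (corner Q) i + side Q])).
  apply: fin_bigcap_measurable => // i _.
  rewrite -[X in measurable X]setTI.
  exact: measurable_tnth.
apply/seteqP; split=> [x Qx i _ /=|x Qx i]; first by rewrite in_itv/=.
by have := Qx i I; rewrite /= in_itv.
Qed.

Lemma lebesgue_tuple_cube (R : realType) n (Q : cube R n) :
  lebesgue_tuple n (cube_set Q) = (side Q ^+ n)%:E.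
Proof.
elim: n Q => [|n IH] [a l l_gt0].
  rewrite expr0 /= diracE mem_set// => -[].
  by case.
pose Q' := Cube [tuple of behead a] l_gt0.
rewrite (_ : cube_set _ = [set x : n.+1.-tuple R |
    `[thead a, thead a + l]%classic (thead x) /\
    cube_set Q' [tuple of behead x]]).
  rewrite [LHS]lebesgue_consE//; last exact: measurable_cube_set.
  rewrite lebesgue_measure_itv/= lte_fin ltrDl l_gt0 EFinD addeAC subee//.
  by rewrite add0e IH exprS EFinM.
apply/seteqP; split=> x /=.
  move=> Qx; split; first by rewrite in_itv; exact: Qx.
  by move=> i; rewrite [X in X <= _ <= _]tnth_behead !tnth_behead; exact: Qx.
move=> [x0 Qx] i; have [->|i0] := eqVneq i ord0; first by rewrite in_itv in x0.
case: (unliftP ord0 i) i0 => [j ->|->]; last by rewrite eqxx.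
move=> _; have := Qx j; rewrite !tnth_behead/=.
by rewrite (_ : inord j.+1 = lift ord0 j)//; apply/val_inj; rewrite /= inordK// ltnS.
Qed.

(* A function space is given by its norm N, extended by N f = +oo when f is not
   in the space. Functions on a subset D of T are total functions T -> R of
   which only the values on D matter. *)
Section function_spaces.
Context (d : measure_display) (T : measurableType d) (R : realType).
Variables (mu : {measure set T -> \bar R}) (D : set T).
Implicit Types (N : (T -> R) -> \bar R) (f g : T -> R).

Definition function_space N : set (T -> R) := [set f | (N f < +oo)%E].

Local Open Scope ereal_scope.

Record banach_function_space N : Prop := {
  bfs_measurable : forall f, function_space N f -> measurable_fun D f ;
  bfs_ge0 : forall f, 0 <= N f ;
  bfs_eq0 : forall f, N f = 0 -> {ae mu, forall x, D x -> f x = 0%R} ;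
  bfs_scale : forall (c : R) f, function_space N f ->
    N (fun x => c * f x)%R = `|c|%:E * N f ;
  bfs_triangle : forall f g, function_space N f -> function_space N g ->
    N (f \+ g)%R <= N f + N g ;
  bfs_lattice : forall f g, measurable_fun D f -> function_space N g ->
    {ae mu, forall x, D x -> (`|f x| <= `|g x|)%R} -> N f <= N g ;
  bfs_complete : forall u : nat -> T -> R,
    (forall k, function_space N (u k)) ->
    (forall e : R, (0 < e)%R -> exists K : nat, forall i j : nat,
       (K <= i)%N -> (K <= j)%N -> N (u i \- u j)%R < e%:E) ->
    exists2 f, function_space N f & N (u k \- f)%R @[k --> \oo] --> 0 ;
  (* L^oo `<=` X `<=` L^1, continuously: with bfs_lattice, the constant 1 being
     in X gives the first embedding. *)
  bfs_Linfty : function_space N (cst 1%R) ;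
  bfs_L1 : exists C : R, forall f, function_space N f ->
    \int[mu]_(x in D) `|f x|%:E <= C%:E * N f }.

Definition separable_space N : Prop :=
  exists2 u : nat -> T -> R, (forall k, function_space N (u k)) &
    forall f (e : R), function_space N f -> (0 < e)%R ->
      exists k, N (f \- u k)%R < e%:E.

(* The limit f is not assumed to be in the space: if it is not, N f = +oo and
   the norms of the u k tend to infinity. *)
Definition fatou_property N : Prop :=
  forall (u : nat -> T -> R) f,
    (forall k, function_space N (u k)) -> measurable_fun D f ->
    {ae mu, forall x, D x ->
      (forall k, 0 <= u k x <= u k.+1 x)%R /\ u k x @[k --> \oo] --> f x} ->
    N (u k) @[k --> \oo] --> N f.

(* For mu D < +oo, f measurable and t > 0 the set below is nonempty, so the real
   infimum is the usual one; only t > 0 is ever used. *)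
Definition rearrangement f (t : R) : R :=
  inf [set l : R | (0 <= l)%R /\ mu (D `&` [set x | (l < `|f x|)%R]) <= t%:E].

Record ri_space N : Prop := {
  ri_bfs : banach_function_space N ;
  ri_separable_or_fatou : separable_space N \/ fatou_property N ;
  ri_rearrangement : forall f g, measurable_fun D f -> function_space N g ->
    (forall t : R, (0 < t)%R -> rearrangement f t = rearrangement g t) ->
    N f = N g }.

End function_spaces.

Section boyd_index.
Variable R : realType.
Implicit Types (N : (R -> R) -> \bar R) (f : R -> R).

Definition unit_rearrangement f : R -> R :=
  rearrangement (@lebesgue_measure R) `]0, 1[ f.

Definition dilation (s : R) f : R -> R :=
  fun t => if (0 < t < s) then unit_rearrangement f (t / s) else 0.

Definition dilation_norm N (s : R) : \bar R :=
  ereal_sup [set N (dilation s f) | f in [set f | (N f <= 1)%E]].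

(* On an r.i. space dilation_norm N s lies in ]0, 1] for s < 1, and the limit
   exists. *)
Definition lower_boyd_index N : R :=
  lim ((ln (fine (dilation_norm N s)) / ln s) @[s --> 0^'+]).

End boyd_index.

Section garsia_rodemich.
Variables (R : realType) (n : nat) (Q0 : cube R n).
Implicit Types (N : (n.-tuple R -> R) -> \bar R) (f g : n.-tuple R -> R).

Local Notation mu := (lebesgue_tuple n).

Definition cube_ri_space N : Prop := ri_space mu (cube_set Q0) N.

Definition representation_space N (Nbar : (R -> R) -> \bar R) : Prop :=
  ri_space (@lebesgue_measure R) `]0, 1[ Nbar /\
  forall f, measurable_fun (cube_set Q0) f ->
    N f = Nbar (rearrangement mu (cube_set Q0) f).

Local Open Scope ereal_scope.

Definition mean_oscillation f (Q : cube R n) : \bar R :=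
  (fine (mu (cube_set Q)))^-1%:E *
  \int[mu]_(x in cube_set Q) \int[mu]_(y in cube_set Q) `|f x - f y|%:E.

Definition garo_class f : set (n.-tuple R -> R) :=
  [set g | mu.-integrable (cube_set Q0) (EFin \o g) /\
    forall (I : set nat) (Q : nat -> cube R n), cube_packing Q0 I Q ->
      \sum_(i <oo | i \in I) mean_oscillation f (Q i) <=
      \sum_(i <oo | i \in I) \int[mu]_(x in cube_set (Q i)) (g x)%:E].

Definition garo_norm N f : \bar R := ereal_inf [set N g | g in garo_class f].

Definition garo_space N : set (n.-tuple R -> R) :=
  [set f | mu.-integrable (cube_set Q0) (EFin \o f) /\ garo_norm N f < +oo].

End garsia_rodemich.

(* Main.v *)
Require Import Defs.
From mathcomp Require Import all_boot all_order all_algebra perm.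
From mathcomp Require Import all_classical all_reals all_analysis measurable_realfun.
From mathcomp Require Import lra zify.

Set Implicit Arguments.
Unset Strict Implicit.
Unset Printing Implicit Defensive.

Import Order.TTheory GRing.Theory Num.Theory.
Import numFieldNormedType.Exports.

Local Open Scope classical_set_scope.
Local Open Scope ring_scope.

(** If f is in X then 2|f| belongs to the class Gamma_f, which gives one
    inclusion. Conversely let gamma be in Gamma_f and in X, and write F = f^*,
    G = gamma^*, C = 2^(n+1). Stopping the dyadic subdivision of Q0 at the
    cubes where E = {|f| > lambda} has density above 1/C yields disjoint cubes
    of total volume at most C |E| that almost cover E and in which E still has
    density at most 1/2; comparing f on E and off E in each of them gives
    int (|f| - lambda)_+ <= 2 int_U |gamma| for a set U with |U| <= C |E|.
    Rearranged, this says that the measure -s dF(s) on small intervals (0, t) is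
    dominated by G(s) ds, hence that F - F(tau) is majorized, in the sense of
    Hardy, Littlewood and Polya, by the function
    t |-> int_t^tau G(s) ds / s, up to constants. The latter is bounded by the
    sum over i of the dilations G(2^i t), a convergent series in X because the
    lower Boyd index is positive.

    Majorization is only used for step functions on a uniform grid, where it
    follows from the triangle inequality and rearrangement invariance; this
    bounds the truncations of F uniformly. The Fatou property then gives F in
    X. In the separable case the norm of G restricted to (0, tau) tends to 0,
    which makes the truncations a Cauchy sequence. *)

(** * Majorization *)

(** Two obstacles shape the estimates. The function G may be unbounded near 0, so that no grid value
    accounts for its mass on the first cell. That mass is carried along as a constant sitting on the
    first cell alone, and its norm is controlled because replacing G by its mean over a short
    initial interval does not increase the norm. Next, the stopping procedure must be finite: E is
    approximated in measure by a union of dyadic cubes of one generation J, and the subdivision is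
    given up after J steps. This takes the place of density points and leaves an arbitrarily small
    error, removed once the grid is fixed. Levels with |E| > 1/C are out of reach, hence the
    difference F - F(tau), with tau = 1/q and q at least C; what remains is bounded. The final
    constant depends neither on the grid nor on q and multiplies the norm of G on (0, 1/q):
    uniformity in the grid bounds the truncations, and uniformity in q makes them Cauchy when that
    norm tends to 0. *)

Section majorization.
Variable R : realType.

(* Robin Hood transfers: as long as x is not below y, some surplus of y at an
   index j can be moved to a deficit at k > j by averaging y with its
   transposition (j k), and each such step makes one more entry agree. *)
Lemma weak_majorization_le (M : nat) (nu : ('I_M -> R) -> \bar R) :
  (forall x y : 'I_M -> R, (forall i, 0 <= x i <= y i) -> (nu x <= nu y)%E) ->
  (forall (y : 'I_M -> R) (j k : 'I_M) (l : R), (forall i, 0 <= y i) -> 0 <= l <= 1 ->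
    (nu (fun i => ((1 - l) * y i + l * y (tperm j k i))%R) <= nu y)%E) ->
  forall x y : 'I_M -> R, (forall i, 0 <= x i) -> (forall i, 0 <= y i) ->
  (forall i j : 'I_M, (i <= j)%N -> x j <= x i) ->
  (forall k : nat, \sum_(i < M | (i < k)%N) x i <= \sum_(i < M | (i < k)%N) y i) ->
  (nu x <= nu y)%E.
Proof.
move=> nu_mono nu_transfer x y x0 y0 x_noninc.
have [m] := ubnP #|[pred i | x i != y i]|.
elim: m => // m IH in y y0 * => /ltnSE card_m xy.
have [/forallP xley|] := boolP [forall i, x i <= y i].
  by apply: nu_mono => i; rewrite x0 xley.
rewrite negb_forall => /existsP[k0 Hk0].
(* [k] is the first index where [x] exceeds [y]; below, [j] is the last index before [k] where [y]
   exceeds [x], so the entries in between already agree. *)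
case: (@arg_minnP _ k0 (fun k => ~~ (x k <= y k)) (fun k => k : nat) Hk0).
move=> k; rewrite -ltNge => ykxk kmin {k0 Hk0}.
have xley (i : 'I_M) : (i < k)%N -> x i <= y i.
  by move=> ik; apply: contraTT ik => /kmin; rewrite -leqNgt.
have sumS (z : 'I_M -> R) (j : 'I_M) : \sum_(i < M | (i < j.+1)%N) z i =
    z j + \sum_(i < M | (i < j)%N) z i.
  rewrite (bigD1 j)//=; congr (_ + _); apply: eq_bigl => i.
  by rewrite ltnS [RHS]ltn_neqAle andbC.
have [j0 /andP[j0k xj0]] : exists j : 'I_M, (j < k)%N && (x j < y j).
  apply: contrapT => nox.
  have := xy k.+1; rewrite !sumS leNgt => /negP; apply.
  apply: ltr_leD => //; apply: ler_sum => i ik.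
  by rewrite leNgt; apply/negP => xyi; apply: nox; exists i; rewrite ik.
have Hj0 : (j0 < k)%N && (x j0 < y j0) by rewrite j0k xj0.
case: (@arg_maxnP _ j0 (fun j => (j < k)%N && (x j < y j)) (fun j => j : nat) Hj0).
move=> j /andP[jk xjyj] jmax {j0 j0k xj0 Hj0}.
have eqxy (i : 'I_M) : (j < i < k)%N -> x i = y i.
  move=> /andP[ji ik]; apply/eqP; rewrite eq_le xley//= leNgt; apply/negP => xi.
  by have := jmax i; rewrite ik xi => /(_ isT) /=; rewrite leqNgt ji.
have jNk : j != k by rewrite -val_eqE/= ltn_eqF.
(* Monotonicity of [x] gives [y k < x k <= x j < y j], so averaging the entries [j] and [k] of [y]
   moves mass from [j] to [k]. *)
have xkj : x k <= x j by apply: x_noninc; exact: ltnW.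
have ykyj : 0 < y j - y k by lra.
(* The largest transfer that overshoots neither target: afterwards one of the entries [j], [k]
   agrees with [x]. *)
set d := Num.min (y j - x j) (x k - y k).
have d0 : 0 < d by rewrite lt_min; apply/andP; split; lra.
have dj : d <= y j - x j by rewrite ge_min lexx.
have dk : d <= x k - y k by rewrite ge_min lexx orbT.
pose l := d / (y j - y k).
have l0 : 0 <= l by rewrite divr_ge0// ltW.
have l1 : l <= 1 by rewrite ler_pdivrMr// mul1r; lra.
have ld : l * (y j - y k) = d by rewrite divfK// gt_eqF.
pose y' i := (1 - l) * y i + l * y (tperm j k i).
have y'j : y' j = y j - d by rewrite /y' tpermL -ld; lra.
have y'k : y' k = y k + d by rewrite /y' tpermR -ld; lra.
have y'i i : i != j -> i != k -> y' i = y i.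
  by move=> ij ik; rewrite /y' tpermD 1?eq_sym//; lra.
have y'E i : y' i = y i - d * (i == j)%:R + d * (i == k)%:R.
  have [->|ij] := eqVneq i j; first by rewrite y'j (negbTE jNk)/= mulr1 mulr0 addr0.
  have [->|ik] := eqVneq i k; first by rewrite y'k/= mulr1 mulr0 subr0.
  by rewrite y'i//= !mulr0 subr0 addr0.
have sum_delta (a : 'I_M) (p : nat) :
    \sum_(i < M | (i < p)%N) d * (i == a)%:R = d * (a < p)%N%:R.
  have [ap|ap] := ltnP a p.
    by rewrite (bigD1 a)//= eqxx big1 ?addr0// => i /andP[_ /negbTE ->]; rewrite mulr0.
  by rewrite mulr0 big1// => i ip; rewrite -val_eqE/= ltn_eqF ?mulr0// (leq_trans ip).
apply: le_trans (nu_transfer y j k l y0 _); last by rewrite l0.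
apply: (IH y').
- by move=> i; rewrite /y' addr_ge0// mulr_ge0// subr_ge0.
- apply: leq_trans card_m; apply: proper_card; apply/properP; split.
    apply/fintype.subsetP => i; rewrite !inE; have [->|ij] := eqVneq i j.
      by move=> _; rewrite lt_eqF.
    by have [->|ik] := eqVneq i k; [move=> _; rewrite gt_eqF|rewrite y'i].
  have [le1|le2] := leP (y j - x j) (x k - y k).
    exists j; rewrite !inE; first by rewrite lt_eqF.
    rewrite negbK y'j /d min_l//; apply/eqP; lra.
  exists k; rewrite !inE; first by rewrite gt_eqF.
  rewrite negbK y'k /d min_r ?ltW//; apply/eqP; lra.
- move=> p; rewrite [leRHS](_ : _ = \sum_(i < M | (i < p)%N) y i -
      d * (j < p)%N%:R + d * (k < p)%N%:R); last first.
    rewrite -!sum_delta -sumrB -big_split/=; apply: eq_bigr => i _; exact: y'E.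
  have [kp|pk] := ltnP k p; first by rewrite (ltn_trans jk kp)/= subrK.
  have [jp|pj] := ltnP j p; last by rewrite !mulr0 subr0 addr0.
  (* Only prefixes that contain [j] but not [k] lose [d]. Past [j] the differences vanish, and the
     entry [j] alone supplies [y j - x j >= d]. *)
  rewrite mulr1 mulr0 addr0 -subr_ge0 addrAC -sumrB.
  rewrite (bigID (fun i : 'I_M => (i < j.+1)%N))/= [X in _ + X - _]big1 ?addr0; last first.
    move=> i /andP[ip]; rewrite -leqNgt => ji.
    by rewrite eqxy ?subrr// ji (leq_trans ip).
  rewrite (eq_bigl (fun i : 'I_M => (i < j.+1)%N)); last first.
    by move=> i /=; apply/andP/idP => [[]//|ij]; split=> //; apply: leq_trans jp.
  rewrite sumrB !sumS; have := xy j; lra.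
Qed.

(** Summation by parts, as an induction that keeps the last weight in front of the whole partial sum
    of [q - p]: this partial sum is nonnegative, so passing to the next, smaller weight only lowers
    the left side. *)
Lemma ler_sum_prefix (L : nat) (p q w : nat -> R) :
  (forall k, (k <= L)%N -> \sum_(0 <= m < k) p m <= \sum_(0 <= m < k) q m) ->
  (forall m, 0 <= w m) -> (forall m, w m.+1 <= w m) ->
  \sum_(0 <= m < L) w m * p m <= \sum_(0 <= m < L) w m * q m.
Proof.
move=> pq w0 w_noninc; rewrite -subr_ge0 -sumrB.
suff H k : (k <= L)%N -> w k.-1 * \sum_(0 <= m < k) (q m - p m) <=
    \sum_(0 <= m < k) (w m * q m - w m * p m).
  apply: le_trans (H L (leqnn _)); rewrite mulr_ge0// sumrB subr_ge0; exact: pq.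
elim: k => [|k IH] kL; first by rewrite !big_nil mulr0.
rewrite !big_nat_recr//= mulrDr -mulrBr lerD2r; apply: le_trans (IH (ltnW kL)).
case: k kL {IH} => [|k] kL; first by rewrite big_nil !mulr0.
by rewrite ler_wpM2r// sumrB subr_ge0; apply/pq/ltnW.
Qed.

(** The dyadic block from [2 ^ i * k] to [2 ^ i.+1 * k] has as many terms as its first index, and
    its first term is the largest. This is the discrete bound of the integral of [G(s) / s] by
    dilations of [G]. *)
Lemma sum_div_index_le (c : nat -> R) (k I : nat) : (0 < k)%N ->
  (forall m, 0 <= c m) -> (forall i j, (i <= j)%N -> c j <= c i) ->
  \sum_(k <= m < 2 ^ I * k) c m / m%:R <= \sum_(i < I) c (2 ^ i * k)%N.
Proof.
move=> k0 c0 c_noninc; elim: I => [|I IH].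
  by rewrite mul1n big_ord0 big_geq.
rewrite big_ord_recr/= (@big_cat_nat _ _ _ (2 ^ I * k)%N)//=; last 2 first.
  by rewrite leq_pmull// expn_gt0.
  by rewrite leq_mul// leq_exp2l.
apply: lerD IH _; have Ik0 : (0 < 2 ^ I * k)%N by rewrite muln_gt0 expn_gt0.
apply: (@le_trans _ _ (\sum_(2 ^ I * k <= m < 2 ^ I.+1 * k)
    c (2 ^ I * k)%N / (2 ^ I * k)%:R)).
  apply: ler_sum_nat => m /andP[Im _]; rewrite ler_pM ?invr_ge0//.
    exact: c_noninc.
  by rewrite lef_pV2 ?posrE ?ltr0n ?ler_nat// (leq_trans Ik0).
rewrite sumr_const_nat expnS -mulnA mul2n -addnn addnK.
by rewrite -[leLHS]mulr_natr -mulrA mulVf ?mulr1// pnatr_eq0 -lt0n.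
Qed.

End majorization.

(** * Decreasing rearrangements *)

Lemma cvge_near_lt (R : realType) (u : nat -> \bar R) (l z : \bar R) :
  u k @[k --> \oo] --> l -> (l < z)%E -> \forall k \near \oo, (u k < z)%E.
Proof.
move=> ul lz; apply: (ul [set x | (x < z)%E]).
by apply: open_nbhs_nbhs; split=> //; exact: open_ereal_lt_ereal.
Qed.

Section rearrangement_theory.
Context (d : measure_display) (T : measurableType d) (R : realType).
Variables (mu : {measure set T -> \bar R}) (D : set T).
Hypotheses (mD : measurable D) (muD : mu D = 1%E).
Variable f : T -> R.
Hypothesis mf : measurable_fun D f.

Definition superlevel (l : R) : set T := D `&` [set x | l < `|f x|].

Local Notation F := (rearrangement mu D f).

Lemma measurable_superlevel l : measurable (superlevel l).
Proof.
rewrite /superlevel (_ : [set x | _] = (fun x => `|f x|) @^-1` `]l, +oo[).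
  by apply: (measurableT_comp (@normr_measurable _ _)).
by apply/seteqP; split=> x /=; rewrite in_itv/= andbT.
Qed.

Lemma measurable_superlevel_ge l : measurable (D `&` [set x | l <= `|f x|]).
Proof.
rewrite (_ : [set x | _] = (fun x => `|f x|) @^-1` `[l, +oo[).
  by apply: (measurableT_comp (@normr_measurable _ _)).
by apply/seteqP; split=> x /=; rewrite in_itv/= andbT.
Qed.

Lemma superlevel_subset l l' : l <= l' -> superlevel l' `<=` superlevel l.
Proof. by move=> ll' x [Dx /= lx]; split=> //=; exact: le_lt_trans lx. Qed.

Lemma mu_superlevel_le1 l : (mu (superlevel l) <= 1)%E.
Proof.
by rewrite -muD; apply: le_measure; rewrite ?inE//; [exact: measurable_superlevel|move=> x []].
Qed.

Lemma mu_superlevel_fin l : mu (superlevel l) \is a fin_num.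
Proof.
by rewrite ge0_fin_numE//; exact: le_lt_trans (mu_superlevel_le1 l) (ltry _).
Qed.

Lemma le_mu_superlevel l l' : l <= l' ->
  (mu (superlevel l') <= mu (superlevel l))%E.
Proof.
move=> ll'; apply: le_measure; rewrite ?inE; try exact: measurable_superlevel.
exact: superlevel_subset.
Qed.

(** Continuity from above along integer levels, [f] being finite everywhere. The set whose infimum
    defines the rearrangement is therefore nonempty. *)
Lemma mu_superlevel_small (t : R) : 0 < t ->
  exists2 l : R, 0 <= l & (mu (superlevel l) <= t%:E)%E.
Proof.
move=> t0.
have : mu (superlevel k%:R) @[k --> \oo] --> mu (\bigcap_k superlevel k%:R).
  apply: nonincreasing_cvg_mu.
  - by rewrite -ge0_fin_numE// mu_superlevel_fin.
  - by move=> k; exact: measurable_superlevel.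
  - by apply: bigcap_measurable => // k _; exact: measurable_superlevel.
  - by move=> i j ij; apply/subsetPset/superlevel_subset; rewrite ler_nat.
rewrite (_ : \bigcap_k _ = set0) ?measure0; last first.
  rewrite -subset0 => x Hx; have [_ /=] := Hx (Num.bound `|f x|) Logic.I.
  by rewrite ltNge ltW// archi_boundP.
move=> /(@cvge_near_lt _ _ _ t%:E); rewrite lte_fin => /(_ t0)[k _].
by move=> /(_ k (leqnn _))/= kt; exists k%:R => //; exact: ltW.
Qed.

Let has_lb t : has_lbound [set l | 0 <= l /\ (mu (superlevel l) <= t%:E)%E].
Proof. by exists 0 => l []. Qed.

Lemma rearrangement_le t l : 0 <= l -> (mu (superlevel l) <= t%:E)%E -> F t <= l.
Proof. by move=> l0 lt; apply: ge_inf; [exact: has_lb|split]. Qed.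

Lemma rearrangement_ge0 t : 0 < t -> 0 <= F t.
Proof.
move=> t0; apply: lb_le_inf => [|l []//].
by have [l l0 lt] := mu_superlevel_small t0; exists l.
Qed.

(** The infimum is attained, by continuity from below along levels decreasing to [F t]. *)
Lemma mu_superlevel_rearrangement t : 0 < t ->
  (mu (superlevel (F t)) <= t%:E)%E.
Proof.
move=> t0.
have : mu (superlevel (F t + k.+1%:R^-1)) @[k --> \oo] -->
    mu (\bigcup_k superlevel (F t + k.+1%:R^-1)).
  apply: nondecreasing_cvg_mu.
  - by move=> k; exact: measurable_superlevel.
  - by apply: bigcup_measurable => // k _; exact: measurable_superlevel.
  - move=> i j ij; apply/subsetPset/superlevel_subset.
    by rewrite lerD2l lef_pV2 ?posrE// ler_nat.
rewrite (_ : \bigcup_k _ = superlevel (F t)); last first.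
  apply/seteqP; split => [x [k _]|x [Dx /= Fx]].
    by apply: superlevel_subset; rewrite lerDl.
  have := Fx; rewrite -subr_gt0 => /ltr_add_invr[k]; rewrite add0r => kx.
  by exists k => //; split=> //=; rewrite -ltrBrDl.
move=> /cvge_to_le; apply; apply: nearW => k.
have [||l [l0 lt] lF] := @inf_adherent _
  [set l | 0 <= l /\ (mu (superlevel l) <= t%:E)%E] k.+1%:R^-1.
- by rewrite invr_gt0.
- by split; [have [l l0 lt] := mu_superlevel_small t0; exists l|exact: has_lb].
by apply: le_trans lt; apply: le_mu_superlevel; exact: ltW.
Qed.

(** The adjunction between the rearrangement and the distribution function, from which monotonicity
    and right continuity follow. *)
Lemma rearrangement_gtE t l : 0 < t -> 0 <= l ->
  (l < F t) = (t%:E < mu (superlevel l))%E.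
Proof.
move=> t0 l0; apply/idP/idP; rewrite !ltNge; apply: contra.
  exact: rearrangement_le.
by move=> /le_mu_superlevel /le_trans; apply; exact: mu_superlevel_rearrangement.
Qed.

Lemma rearrangement_noninc s t : 0 < s -> s <= t -> F t <= F s.
Proof.
move=> s0 st; rewrite leNgt rearrangement_gtE ?rearrangement_ge0//; last first.
  exact: lt_le_trans st.
by rewrite -leNgt (le_trans (mu_superlevel_rearrangement s0))// lee_fin.
Qed.

Lemma rearrangement_right_cont t l : 0 < t -> 0 <= l -> l < F t ->
  exists2 e, 0 < e & l < F (t + e).
Proof.
move=> t0 l0; rewrite rearrangement_gtE//.
rewrite -(fineK (mu_superlevel_fin l)) lte_fin => /midf_lt[t1 t2].
exists ((t + fine (mu (superlevel l))) / 2 - t); first by rewrite subr_gt0.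
rewrite addrC subrK rearrangement_gtE//; last exact: lt_trans t1.
by rewrite -(fineK (mu_superlevel_fin l)) lte_fin.
Qed.

Lemma mu_superlevel_ge_rearrangement t : 0 < t -> 0 < F t ->
  (t%:E <= mu (D `&` [set x | F t <= `|f x|]%R))%E.
Proof.
move=> t0 Ft0.
(* The levels approach [F t] by a ratio rather than a difference, so that they stay nonnegative. *)
pose l k := F t * (1 - k.+1%:R^-1).
have : mu (superlevel (l k)) @[k --> \oo] --> mu (\bigcap_k superlevel (l k)).
  apply: nonincreasing_cvg_mu.
  - by rewrite -ge0_fin_numE// mu_superlevel_fin.
  - by move=> k; exact: measurable_superlevel.
  - by apply: bigcap_measurable => // k _; exact: measurable_superlevel.
  - move=> i j ij; apply/subsetPset/superlevel_subset; apply: ler_wpM2l; first exact: ltW.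
    by rewrite lerD2l lerN2 lef_pV2 ?posrE// ler_nat.
rewrite (_ : \bigcap_k _ = D `&` [set x | F t <= `|f x|]); last first.
  apply/seteqP; split => [x Hx|x [Dx /= Fx] k _]; last first.
    split=> //=; apply: lt_le_trans Fx; by rewrite /l gtr_pMr// ltrBlDr ltrDl.
  split=> /=; first by have [] := Hx 0%N Logic.I.
  rewrite leNgt; apply/negP; rewrite -subr_gt0 => fx.
  have /ltr_add_invr[k] : 0 < (F t - `|f x|) / F t by rewrite divr_gt0.
  rewrite add0r ltr_pdivlMr// => Hk; have [_ /=] := Hx k Logic.I.
  by rewrite /l mulrBr mulr1 ltrBlDr -ltrBlDl ltNge mulrC ltW.
move=> /cvge_to_ge; apply; apply: nearW => k.
apply: ltW; rewrite -rearrangement_gtE//.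
  by rewrite /l gtr_pMr// ltrBlDr ltrDl.
by rewrite /l mulr_ge0 ?rearrangement_ge0// subr_ge0 invf_le1// ler1n.
Qed.

End rearrangement_theory.

(** * Integrals of the part of a function above a level *)

Section excess.
Context (d : measure_display) (T : measurableType d) (R : realType).
Variables (mu : {measure set T -> \bar R}) (D : set T).
Hypotheses (mD : measurable D) (muD : mu D = 1%E).
Variable f : T -> R.
Hypothesis fint : mu.-integrable D (EFin \o f).

Definition excess (g : T -> R) (l : R) (x : T) : R := Num.max (`|g x| - l) 0.

Lemma excess_ge0 (g : T -> R) l x : 0 <= excess g l x.
Proof. by rewrite le_max lexx orbT. Qed.

Let mf : measurable_fun D f.
Proof. by apply/measurable_EFinP; case/integrableP : fint. Qed.

Lemma measurable_excess l : measurable_fun D (excess f l).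
Proof.
apply: measurable_maxr => //; apply: measurable_funB => //.
exact: (measurableT_comp (@normr_measurable _ _)).
Qed.

Section subset.
Variable U : set T.
Hypotheses (mU : measurable U) (UD : U `<=` D).

Let mexcess l : measurable_fun U (EFin \o excess f l).
Proof.
apply/measurable_EFinP; apply: measurable_funS mD UD _.
exact: measurable_excess.
Qed.

Let integral_excess_indic l (c : R) (A : set T) : 0 <= c -> measurable A ->
  (\int[mu]_(x in U) (excess f l x + c * \1_A x)%:E =
   \int[mu]_(x in U) (excess f l x)%:E + c%:E * mu (A `&` U))%E.
Proof.
move=> c0 mA.
under eq_integral do rewrite EFinD EFinM.
rewrite ge0_integralD//; last 4 first.
- by move=> x _; rewrite lee_fin excess_ge0.
- exact: mexcess.
- by move=> x _; rewrite -EFinM lee_fin mulr_ge0.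
- by apply/measurable_EFinP; apply: measurable_funM => //; exact: measurable_indic.
by rewrite ge0_integralZl_EFin// ?integral_indic//; apply/measurable_EFinP; exact: measurable_indic.
Qed.

(** Lowering the level from [l] to [l'] raises the excess by exactly [l - l'] where [|f| >= l] and
    by at most [l - l'] where [|f| > l'], with no change elsewhere. Iterated over a grid of levels,
    this bound and the next one are a discrete layer-cake formula. *)
Lemma integral_excess_lower l l' : l' <= l ->
  (\int[mu]_(x in U) (excess f l x)%:E +
     (l - l')%:E * mu (U `&` [set x | l <= `|f x|]%R) <=
   \int[mu]_(x in U) (excess f l' x)%:E)%E.
Proof.
move=> l'l; have mA := measurable_superlevel_ge mD mf l.
have -> : U `&` [set x | l <= `|f x|] = (D `&` [set x | l <= `|f x|]) `&` U.
  by apply/seteqP; split=> [x [Ux /= lx]|x [[Dx /= lx] Ux]]; do ?split=> //; exact: UD.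
rewrite -integral_excess_indic//; last by rewrite subr_ge0.
apply: ge0_le_integral => //.
- by move=> x _; rewrite lee_fin addr_ge0 ?excess_ge0// mulr_ge0// subr_ge0.
- apply/measurable_EFinP; apply: measurable_funD; first exact/measurable_EFinP.
  by apply: measurable_funM => //; exact: measurable_indic.
- exact: mexcess.
move=> x Ux; rewrite lee_fin indicE; have Dx := UD Ux; rewrite /excess.
have [lx|lx] := leP l `|f x|.
  by rewrite mem_set//= mulr1 (max_idPl _) ?(max_idPl _) ?subr_ge0//; lra.
rewrite memNset/= ?mulr0 ?addr0; last by move=> [_ /=]; rewrite leNgt lx.
by rewrite [leLHS](max_idPr _) ?le_max ?lexx ?orbT// subr_le0 ltW.
Qed.

Lemma integral_excess_upper l l' : l' <= l ->
  (\int[mu]_(x in U) (excess f l' x)%:E <=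
   \int[mu]_(x in U) (excess f l x)%:E +
     (l - l')%:E * mu (superlevel D f l' `&` U))%E.
Proof.
move=> l'l; have mA := measurable_superlevel mD mf l'.
rewrite -integral_excess_indic//; last by rewrite subr_ge0.
apply: ge0_le_integral => //.
- by move=> x _; rewrite lee_fin excess_ge0.
- exact: mexcess.
- apply/measurable_EFinP; apply: measurable_funD; first exact/measurable_EFinP.
  by apply: measurable_funM => //; exact: measurable_indic.
move=> x Ux; rewrite lee_fin indicE; have Dx := UD Ux; rewrite /excess.
have [lx|lx] := ltP l' `|f x|.
  rewrite mem_set//= mulr1 [leLHS](max_idPl _) ?subr_ge0 ?(ltW lx)//.
  have : `|f x| - l <= Num.max (`|f x| - l) 0 by rewrite le_max lexx.
  lra.
rewrite memNset/= ?mulr0 ?addr0; last by move=> [_ /=]; rewrite ltNge lx.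
by rewrite [leLHS](max_idPr _) ?le_max ?lexx ?orbT// subr_le0.
Qed.

(** With [l] a value of the rearrangement, this plays the role of the Hardy-Littlewood bound of the
    integral over [U] by the integral of the rearrangement over an initial interval. *)
Lemma integral_le_excess l : 0 <= l ->
  (\int[mu]_(x in U) `|f x|%:E <=
   \int[mu]_(x in U) (excess f l x)%:E + l%:E * mu U)%E.
Proof.
move=> l0; rewrite -[X in mu X]setIid -integral_excess_indic//.
apply: ge0_le_integral => //.
- apply/measurable_EFinP; apply: (measurableT_comp (@normr_measurable _ _)).
  exact: measurable_funS mD UD mf.
- apply/measurable_EFinP; apply: measurable_funD; first exact/measurable_EFinP.
  by apply: measurable_funM => //; exact: measurable_indic.
move=> x Ux; rewrite lee_fin indicE mem_set//= mulr1 /excess.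
by rewrite -lerBlDr le_max lexx.
Qed.

Lemma integral_excess_subset l :
  (\int[mu]_(x in U) (excess f l x)%:E <= \int[mu]_(x in D) (excess f l x)%:E)%E.
Proof.
apply: ge0_subset_integral => //.
  by apply/measurable_EFinP; exact: measurable_excess.
by move=> x _; rewrite lee_fin excess_ge0.
Qed.

End subset.

Lemma integral_excess_fin l : 0 <= l ->
  (\int[mu]_(x in D) (excess f l x)%:E)%E \is a fin_num.
Proof.
move=> l0; rewrite ge0_fin_numE; last first.
  by apply: integral_ge0 => x _; rewrite lee_fin excess_ge0.
case/integrableP : fint => _; apply: le_lt_trans; apply: ge0_le_integral => //.
- by move=> x _; rewrite lee_fin excess_ge0.
- by apply/measurable_EFinP; exact: measurable_excess.
- by apply/measurable_EFinP; exact: (measurableT_comp (@normr_measurable _ _)).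
by move=> x _ /=; rewrite lee_fin /excess ge_max normr_ge0 andbT gerBl.
Qed.

(** The points above all the levels form a null set, since the superlevel set at [F (s / k.+1)] has
    measure at most [s / k.+1]. Elsewhere the excess is eventually 0, and [|f|] dominates. *)
Lemma integral_excess_cvg0 (s : R) : 0 < s ->
  (\int[mu]_(x in D) (excess f (rearrangement mu D f (s / k.+1%:R)) x)%:E)%E
    @[k --> \oo] --> 0%E.
Proof.
move=> s0; set F := rearrangement mu D f.
have sk k : 0 < s / k.+1%:R by rewrite divr_gt0.
pose N := \bigcap_k superlevel D f (F (s / k.+1%:R)).
have mN : measurable N.
  by apply: bigcap_measurable => // k _; exact: measurable_superlevel.
have N0 : mu N = 0%E.
  apply/eqP; rewrite eq_le measure_ge0 andbT; apply/lee_addgt0Pr => e e0.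
  rewrite add0e.
  have [k ke] : exists k : nat, s / k.+1%:R < e.
    have /ltr_add_invr[k] : 0 < e / s by rewrite divr_gt0.
    by rewrite add0r ltr_pdivlMr// => ke; exists k; rewrite mulrC.
  apply: (@le_trans _ _ (mu (superlevel D f (F (s / k.+1%:R))))).
    apply: le_measure; rewrite ?inE//; first exact: measurable_superlevel.
    by move=> x; exact.
  apply: le_trans (mu_superlevel_rearrangement mD muD mf (sk k)) _.
  by rewrite lee_fin ltW.
have mDN : measurable (D `\` N) by exact: measurableD.
rewrite (_ : (fun _ => _) = (fun k => \int[mu]_(x in D `\` N)
    (excess f (F (s / k.+1%:R)) x)%:E)%E); last first.
  apply/funext => k; apply: ge0_negligible_integral => //.
    by apply/measurable_EFinP; exact: measurable_excess.
  by move=> x _; rewrite lee_fin excess_ge0.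
rewrite -(@integral0 _ _ _ mu (D `\` N)).
apply: (@dominated_cvg _ _ _ mu _ mDN
  (fun k x => (excess f (F (s / k.+1%:R)) x)%:E) (cst 0%E) (fun x => `|f x|%:E)) => //.
- move=> k; apply/measurable_EFinP; apply: measurable_funS mD _ _ => //.
  exact: measurable_excess.
- move=> x [Dx Nx]; apply: cvg_near_cst.
  have [k Hk] : exists k, `|f x| <= F (s / k.+1%:R).
    apply: contrapT => nok; apply: Nx => k _; split=> //=.
    by rewrite ltNge; apply/negP => ?; apply: nok; exists k.
  exists k => // j /= kj; congr EFin; apply/max_idPr; rewrite subr_le0.
  apply: le_trans Hk _; apply: (rearrangement_noninc mD muD mf) => //.
  by rewrite ler_pM2l// lef_pV2 ?posrE// ler_nat.
- apply: (integrableS mD) => //; exact: integrable_abse fint.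
- move=> k x _; rewrite /= ger0_norm ?excess_ge0// lee_fin /excess ge_max.
  by rewrite normr_ge0 andbT gerBl; exact: (rearrangement_ge0 mD muD mf).
Qed.

End excess.

(** * Rearrangement invariant spaces on (0, 1) *)

(** The superlevel sets are intervals. Besides nonincreasing functions this covers their translates,
    which vanish on the left. *)
Lemma measurable_quasiconcave (R : realType) (I : set R) (h : R -> R) :
  is_interval I ->
  (forall x y z, I x -> I z -> x < y -> y < z -> Num.min (h x) (h z) <= h y) ->
  measurable_fun I h.
Proof.
move=> itvI qc; apply: (measurability _ (RGenOInfty.measurableE R)).
move=> _ [_ [l ->] <-]; apply: is_interval_measurable.
move=> x z [Ix /= hx] [Iz /= hz] y /andP[xy yz].
move: xy yz; rewrite le_eqVlt => /predU1P[<-//|xy].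
rewrite le_eqVlt => /predU1P[->//|yz].
split; first by apply: (itvI x z) => //; rewrite !ltW.
move: hx hz; rewrite /= !in_itv/= !andbT => hx hz.
by apply: lt_le_trans (qc x y z Ix Iz xy yz); rewrite lt_min hx hz.
Qed.

Section unit_ri_space.
Variables (R : realType) (N : (R -> R) -> \bar R).
Local Notation lam := (@lebesgue_measure R).
Local Notation I01 := (`]0, 1[%classic : set R).
Hypothesis riN : ri_space lam I01 N.

Let bfsN : banach_function_space lam I01 N := ri_bfs riN.

Lemma rin_mono (f g : R -> R) : measurable_fun I01 f -> (N g < +oo)%E ->
  (forall x, 0 < x < 1 -> `|f x| <= `|g x|) -> (N f <= N g)%E.
Proof.
move=> mf Ng fg; apply: (bfs_lattice bfsN) => //.
by apply: aeW => x /=; rewrite in_itv/=; exact: fg.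
Qed.

Lemma rin_sum (J : Type) (s : seq J) (h : J -> R -> R) :
  (forall i, (N (h i) < +oo)%E) ->
  (N (fun x => \sum_(i <- s) h i x)%R <= \sum_(i <- s) N (h i))%E.
Proof.
move=> Nh; elim: s => [|i s IH].
  rewrite big_nil (_ : (fun _ => _) = fun x => 0 * cst 1 x :> R); last first.
    by apply/funext => x; rewrite big_nil mul0r.
  by rewrite (bfs_scale bfsN)//; [rewrite normr0 mul0e|exact: bfs_Linfty bfsN].
rewrite big_cons (_ : (fun _ => _) = h i \+ (fun x => \sum_(j <- s) h j x)); last first.
  by apply/funext => x; rewrite big_cons.
have Ns : (N (fun x => \sum_(j <- s) h j x)%R < +oo)%E.
  by apply: le_lt_trans IH _; apply: lte_sum_pinfty.
by apply: le_trans (bfs_triangle bfsN (Nh i) Ns) _; exact: leeD2l.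
Qed.

Lemma rin_scale (c : R) (f : R -> R) : 0 <= c -> (N f < +oo)%E ->
  N (fun x => c * f x) = (c%:E * N f)%E.
Proof. by move=> c0 Nf; rewrite (bfs_scale bfsN)// ger0_norm. Qed.

Lemma rin_scale_lty (c : R) (f : R -> R) : 0 <= c -> (N f < +oo)%E ->
  (N (fun x => c * f x)%R < +oo)%E.
Proof.
move=> c0 Nf; rewrite rin_scale// lte_mul_pinfty//.
Qed.

Lemma rin_bounded (f : R -> R) (c : R) : measurable_fun I01 f ->
  (forall x, 0 < x < 1 -> `|f x| <= c) -> (N f < +oo)%E.
Proof.
move=> mf fc.
have c0 : 0 <= c by apply: le_trans (fc (2^-1) _); [exact: normr_ge0|lra].
apply: le_lt_trans (rin_scale_lty c0 (bfs_Linfty bfsN)).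
apply: rin_mono => //; first exact: (rin_scale_lty c0 (bfs_Linfty bfsN)).
by move=> x x01; rewrite /= mulr1 (ger0_norm c0) fc.
Qed.

Lemma rin_equimeasurable (f g : R -> R) : measurable_fun I01 f -> (N g < +oo)%E ->
  (forall l, 0 <= l -> lam (superlevel I01 f l) = lam (superlevel I01 g l)) ->
  N f = N g.
Proof.
move=> mf Ng fg; apply: (ri_rearrangement riN) => // t t0.
rewrite /rearrangement; congr inf; apply/seteqP.
by split=> l [l0 /=]; rewrite -/(superlevel _ _ _) => fl; split=> //;
  move: fl; rewrite -/(superlevel _ _ _) fg.
Qed.

Section step_functions.
Variable M : nat.
Hypothesis M0 : (0 < M)%N.

Let M0' : 0 < M%:R :> R.
Proof. by rewrite ltr0n. Qed.

Definition cell (k : nat) : set R := `[k%:R / M%:R, k.+1%:R / M%:R[.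

Definition step (x : 'I_M -> R) (s : R) : R := \sum_(k < M) x k * \1_(cell k) s.

Lemma cell_cover s : 0 < s < 1 -> exists k : 'I_M, cell k s.
Proof.
move=> /andP[s0 s1].
have sM : 0 <= s * M%:R by rewrite mulr_ge0 ?ltW.
have kM : (Num.truncn (s * M%:R) < M)%N by rewrite truncn_lt_nat// gtr_pMl.
exists (Ordinal kM); rewrite /cell/= in_itv/= ler_pdivrMr// ltr_pdivlMr//.
exact: truncn_itv.
Qed.

Lemma cell_inj s (j k : nat) : cell j s -> cell k s -> j = k.
Proof.
rewrite /cell/= !in_itv/= !ler_pdivrMr// !ltr_pdivlMr// => sj sk.
by rewrite -(truncn_def sj) -(truncn_def sk).
Qed.

Lemma step_cell x s (k : 'I_M) : cell k s -> step x s = x k.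
Proof.
move=> sk; rewrite /step (bigD1 k)//= indicE mem_set// mulr1 big1 ?addr0// => j jk.
rewrite indicE memNset ?mulr0// => sj.
by move/eqP: jk; apply; apply/val_inj; exact: cell_inj sj sk.
Qed.

Lemma measurable_step D x : measurable_fun D (step x).
Proof.
apply: measurable_sum => k; apply: measurable_funM => //.
apply: measurable_indic; exact: measurable_itv.
Qed.

Let lam_cell (k : 'I_M) : lam (I01 `&` cell k) = (M%:R^-1)%:E.
Proof.
have kM1 : k.+1%:R / M%:R <= 1 :> R by rewrite ler_pdivrMr// mul1r ler_nat.
have kk : k%:R / M%:R < k.+1%:R / M%:R :> R by rewrite ltr_pM2r ?invr_gt0// ltr_nat.
(* The open interval []0, 1[] removes the left endpoint 0 of the first cell and of no other. *)
pose b := if val k == 0%N then false else true.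
rewrite (_ : _ `&` _ = [set` Interval (BSide b (k%:R / M%:R)) (BLeft (k.+1%:R / M%:R))]).
  rewrite lebesgue_measure_itv/= lte_fin kk -EFinB -mulrBl -natrB// subSnn.
  by rewrite mul1r.
apply/seteqP; split=> s; rewrite /cell /= !in_itv/= /b.
  move=> [/andP[s0 s1] /andP[ks sk]]; case: eqP => [k0|_] /=; last by rewrite ks.
  by rewrite sk andbT [X in X%:R](k0 : k = 0%N :> nat) mul0r.
case: eqP => [k0|/eqP k0] /= /andP[ks sk].
  have s0 : 0 < s by move: ks; rewrite [X in X%:R](k0 : k = 0%N :> nat) mul0r.
  by rewrite s0 (lt_le_trans sk kM1)/= (ltW ks) sk.
rewrite ks sk (lt_le_trans sk)// andbT; split=> //; apply: lt_le_trans ks.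
by rewrite divr_gt0// ltr0n lt0n.
Qed.

Lemma lam_superlevel_step x l : 0 <= l ->
  lam (superlevel I01 (step x) l) = \sum_(k < M | l < `|x k|) (M%:R^-1)%:E.
Proof.
move=> l0.
rewrite (_ : superlevel _ _ _ =
    \bigcup_(k in [set` [pred k : 'I_M | l < `|x k|]]) (I01 `&` cell k)).
  rewrite bigcup_pred measure_bigsetU_ord//=; first by apply: eq_bigr => k _; exact: lam_cell.
  - by move=> k; apply: measurableI => //; exact: measurable_itv.
  - by apply/trivIsetP => j k _ _ jk; rewrite -subset0 => s [[_ sj] [_ sk]];
      move/eqP: jk; apply; apply/val_inj; exact: cell_inj sj sk.
apply/seteqP; split=> [s [Is /= ls]|s [k /= lk [Is sk]]].
  have [|k sk] := @cell_cover s; first by move: Is; rewrite /= in_itv.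
  by exists k => //=; rewrite inE -(step_cell _ sk).
by split=> //=; rewrite (step_cell _ sk).
Qed.

Lemma rin_step_lty x : (N (step x) < +oo)%E.
Proof.
apply: (@rin_bounded _ (\sum_k `|x k|)); first exact: measurable_step.
move=> s s01; have [k sk] := cell_cover s01; rewrite (step_cell _ sk).
by rewrite (bigD1 k)//= lerDl sumr_ge0.
Qed.

Lemma rin_step_tperm x (j k : 'I_M) :
  N (step (fun i => x (tperm j k i))) = N (step x).
Proof.
apply: rin_equimeasurable; [exact: measurable_step|exact: rin_step_lty|].
move=> l l0; rewrite !lam_superlevel_step//.
by rewrite [RHS](reindex_inj (@perm_inj _ (tperm j k))).
Qed.

(** The norm of a step function is monotone in nonnegative heights, convex, and invariant under
    exchanging two cells because these have equal length: exactly what Robin Hood transfers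
    require. *)
Lemma rin_step_majorization (x y : 'I_M -> R) :
  (forall i, 0 <= x i) -> (forall i, 0 <= y i) ->
  (forall i j : 'I_M, (i <= j)%N -> x j <= x i) ->
  (forall k : nat, \sum_(i < M | (i < k)%N) x i <= \sum_(i < M | (i < k)%N) y i) ->
  (N (step x) <= N (step y))%E.
Proof.
apply: (@weak_majorization_le _ _ (fun z => N (step z))) => {x y}.
  move=> x y xy; apply: rin_mono; [exact: measurable_step|exact: rin_step_lty|].
  move=> s s01; rewrite /step !ger0_norm; first last.
  - by apply: sumr_ge0 => i _; rewrite mulr_ge0//; case/andP : (xy i).
  - by apply: sumr_ge0 => i _; rewrite mulr_ge0//; case/andP : (xy i) => /le_trans; apply.
  by apply: ler_sum => i _; rewrite ler_wpM2r//; case/andP : (xy i).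
move=> y j k l y0 /andP[l0 l1].
rewrite (_ : step _ = (fun s => (1 - l) * step y s) \+
    (fun s => l * step (fun i => y (tperm j k i)) s)); last first.
  apply/funext => s; rewrite /step/= !mulr_sumr -big_split/=.
  by apply: eq_bigr => i _; rewrite mulrDl !mulrA.
have l10 : 0 <= 1 - l by rewrite subr_ge0.
apply: le_trans (bfs_triangle bfsN _ _) _;
  try by apply: rin_scale_lty => //; exact: rin_step_lty.
rewrite !rin_scale//; try exact: rin_step_lty.
rewrite rin_step_tperm -ge0_muleDl ?lee_fin//.
by rewrite -EFinD subrK mul1e.
Qed.

End step_functions.

End unit_ri_space.

(** * Right-continuous nonincreasing functions *)

Section right_continuous_nonincreasing.
Variable R : realType.
Local Notation I01 := (`]0, 1[%classic : set R).

(** For a nonincreasing function, right continuity amounts to the persistence of each strict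
    inequality [l < h t] slightly to the right of [t]. Values at [t <= 0] are left free, as for
    rearrangements. *)
Record rc_noninc (h : R -> R) : Prop := {
  rcn_ge0 : forall t, 0 < t -> 0 <= h t ;
  rcn_noninc : forall s t, 0 < s -> s <= t -> h t <= h s ;
  rcn_right_cont : forall t l, 0 < t -> 0 <= l -> l < h t ->
    exists2 e, 0 < e & l < h (t + e) }.

Definition cutoff (tau : R) (h : R -> R) (t : R) : R := if 0 < t < tau then h t else 0.

Lemma rc_noninc_cutoff tau h : rc_noninc h -> rc_noninc (cutoff tau h).
Proof.
move=> [h0 hn hrc]; split.
- by move=> t t0; rewrite /cutoff t0/=; case: ifP => // _; exact: h0.
- move=> s t s0 st; have t0 := lt_le_trans s0 st; rewrite /cutoff s0 t0/=.
  case: ifPn => [ttau|_]; first by rewrite (le_lt_trans st ttau) hn.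
  by case: ifP => // _; exact: h0.
- move=> t l t0 l0; rewrite {1}/cutoff t0/=; case: ifPn => [ttau lh|_]; last first.
    by rewrite ltNge l0.
  have [e e0 le] := hrc t l t0 l0 lh.
  exists (Num.min e ((tau - t) / 2)); first by rewrite lt_min e0; lra.
  have me : Num.min e ((tau - t) / 2) <= e by rewrite ge_min lexx.
  have mt : Num.min e ((tau - t) / 2) <= (tau - t) / 2 by rewrite ge_min lexx orbT.
  have m0 : 0 < Num.min e ((tau - t) / 2) by rewrite lt_min e0; lra.
  rewrite /cutoff ifT; last by lra.
  by apply: lt_le_trans le _; apply: hn; lra.
Qed.

Lemma rc_noninc_cst (c : R) : 0 <= c -> rc_noninc (cst c : R -> R).
Proof. by move=> c0; split=> // t l t0 l0 lc; exists 1. Qed.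

Lemma rc_noninc_scale (c : R) h : 0 < c -> rc_noninc h -> rc_noninc (fun t => c * h t).
Proof.
move=> c0 [h0 hn hrc]; split.
- by move=> t t0; rewrite mulr_ge0 ?h0// ltW.
- by move=> s t s0 st; rewrite ler_pM2l// hn.
- move=> t l t0 l0; rewrite mulrC -ltr_pdivrMr// => lh.
  have [|e e0 le] := hrc t (l / c) t0 _ lh; first by rewrite divr_ge0// ltW.
  by exists e => //; rewrite mulrC -ltr_pdivrMr.
Qed.

Lemma measurable_noninc_dilate h (c : R) : 0 < c -> rc_noninc h ->
  measurable_fun I01 (fun t => h (c * t)).
Proof.
move=> c0 [_ hn _]; apply: measurable_quasiconcave; first exact: interval_is_interval.
move=> x y z /=; rewrite !in_itv/= => /andP[x0 x1] /andP[z0 z1] xy yz.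
rewrite ge_min; apply/orP; right; apply: hn; last by rewrite ler_pM2l// ltW.
by rewrite mulr_gt0// (lt_trans x0).
Qed.

Lemma measurable_noninc h : rc_noninc h -> measurable_fun I01 h.
Proof.
move=> hrc; rewrite (_ : h = fun t => h (1 * t)); first exact: measurable_noninc_dilate.
by apply/funext => t; rewrite mul1r.
Qed.

(* One half of the fact that such an h is its own rearrangement. *)
Lemma noninc_le_dilation h (s t : R) : rc_noninc h -> (forall t, 1 <= t -> h t = 0) ->
  0 < s -> 0 < t -> h (t / s) <= dilation s h t.
Proof.
move=> [h0 hn hrc] h1 s0 t0; rewrite /dilation t0/=.
have ts0 : 0 < t / s by rewrite divr_gt0.
case: ltP => [ts|st]; last by rewrite h1// ler_pdivlMr// mul1r.
have hlt1 u : 0 < h u -> u < 1.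
  by move=> hu; rewrite ltNge; apply/negP => /h1 hu0; rewrite hu0 ltxx in hu.
apply: lb_le_inf => [|l [l0 /=] lam_l].
  exists (h (t / s)); split; first exact: h0.
  apply: (@le_trans _ _ (lebesgue_measure `]0, (t / s)[)); last first.
    by rewrite lebesgue_measure_itv/= lte_fin ts0 oppr0 adde0.
  apply: le_measure; rewrite ?inE.
  - apply: (measurable_superlevel _ (measurable_noninc _)); last by split.
    exact: measurable_itv.
  - exact: measurable_itv.
  - move=> u [/=]; rewrite !in_itv/= => /andP[u0 u1]; rewrite ger0_norm ?h0// => hu.
    rewrite u0/= ltNge; apply/negP => tu; move: hu; rewrite ltNge => /negP; apply.
    exact: hn.
rewrite leNgt; apply/negP => lh.
(* By right continuity [h] exceeds [l] on all of []0, t / s + e[], an interval too long for [l] to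
   be admissible in the infimum. *)
have [e e0 le] := hrc _ _ ts0 l0 lh.
move: lam_l; rewrite leNgt => /negP; apply.
apply: (@lt_le_trans _ _ (lebesgue_measure `]0, (t / s + e)[)).
  by rewrite lebesgue_measure_itv/= lte_fin addr_gt0// oppr0 adde0 lte_fin ltrDl.
apply: le_measure; rewrite ?inE.
- exact: measurable_itv.
- apply: (measurable_superlevel _ (measurable_noninc _)); last by split.
  exact: measurable_itv.
- move=> u /=; rewrite !in_itv/= => /andP[u0 ue].
  have lu : l < h u by apply: lt_le_trans le _; apply: hn => //; exact: ltW.
  rewrite u0 ger0_norm ?h0//; split=> //; apply: hlt1; exact: le_lt_trans lu.
Qed.

End right_continuous_nonincreasing.

Lemma rc_noninc_rearrangement (d : measure_display) (T : measurableType d)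
    (R : realType) (mu : {measure set T -> \bar R}) (D : set T) (f : T -> R) :
  measurable D -> mu D = 1%E -> measurable_fun D f ->
  rc_noninc (rearrangement mu D f).
Proof.
move=> mD muD mf; split.
- exact: rearrangement_ge0.
- exact: rearrangement_noninc.
- exact: rearrangement_right_cont.
Qed.

(** * Dilations and the lower Boyd index *)

Section boyd.
Variables (R : realType) (N : (R -> R) -> \bar R).
Local Notation lam := (@lebesgue_measure R).
Local Notation I01 := (`]0, 1[%classic : set R).
Hypotheses (riN : ri_space lam I01 N) (alpha_gt0 : 0 < lower_boyd_index N).

Let bfsN : banach_function_space lam I01 N := ri_bfs riN.

(* In case of divergence [lim] is the junk value 0, which alpha_gt0 excludes;
   likewise [ln] is 0 at the junk value 0 of [fine]. *)
Lemma dilation_norm_le_power : exists2 a : R, 0 < a &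
  exists2 s0 : R, 0 < s0 & forall s, 0 < s < s0 ->
    (dilation_norm N s <= (expR (a * ln s))%:E)%E.
Proof.
set phi := fun s => ln (fine (dilation_norm N s)) / ln s.
have phicvg : cvg (phi s @[s --> 0^'+]).
  apply: contrapT => /dvgP philim; move: alpha_gt0.
  by rewrite /lower_boyd_index -/phi philim ltxx.
(* Half the index, so that the quotient of logarithms eventually exceeds [a]; for [s < 1] the
   denominator [ln s] is negative, which turns this into an upper bound of the norm. *)
set a := lower_boyd_index N / 2.
have a0 : 0 < a by rewrite divr_gt0.
exists a => //.
have : \forall s \near 0^'+, a < phi s.
  apply: (cvgr_gt _ phicvg); change (lower_boyd_index N / 2 < lower_boyd_index N).
  by move: alpha_gt0; lra.
move=> [e /= e0 He]; exists (Num.min e 1); first by rewrite lt_min e0 ltr01.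
move=> s /andP[s0]; rewrite lt_min => /andP[se s1].
have := He s; rewrite /= sub0r normrN gtr0_norm// => /(_ se s0).
rewrite /phi; set K := dilation_norm N s.
have ls0 : ln s < 0 by rewrite ln_lt0// s0.
have [fK|fK] := leP (fine K) 0.
  by rewrite ln0// mul0r => a0'; move: a0; rewrite ltNge (ltW a0').
have Kfin : K \is a fin_num by move: fK; case: K => [r||]//=; rewrite ltxx.
rewrite ltr_ndivlMr// => lK; rewrite -(fineK Kfin) lee_fin.
by rewrite -[leLHS](lnK fK) ler_expR ltW.
Qed.

(** Homogeneity reduces to the unit ball over which [dilation_norm] is a supremum, and there
    [noninc_le_dilation] compares pointwise. *)
Lemma rin_dilate_le (h : R -> R) (s K : R) : rc_noninc h ->
  (forall t, 1 <= t -> h t = 0) -> (N h < +oo)%E -> 0 < s < 1 -> 0 <= K ->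
  (dilation_norm N s <= K%:E)%E ->
  (N (fun t => h (s^-1 * t)%R) <= K%:E * N h)%E.
Proof.
move=> hrc h1 Nh /andP[s0 s1] K0 NK.
have si0 : 0 < s^-1 by rewrite invr_gt0.
have Nh0 := bfs_ge0 bfsN h.
have mh := measurable_noninc_dilate si0 hrc.
(* No normalisation is possible when the norm is 0; there [h (s^-1 * t) <= h t] suffices, as
   [s < 1]. *)
have [Nh_eq0|Nh_neq0] := eqVneq (N h) 0%E.
  rewrite Nh_eq0 mule0 -Nh_eq0; apply: (rin_mono riN) => //.
  move=> t /andP[t0 _]; have st0 : 0 < s^-1 * t by rewrite mulr_gt0.
  rewrite !ger0_norm ?(rcn_ge0 hrc)//; apply: (rcn_noninc hrc) => //.
  by rewrite ler_peMl ?(ltW t0)// invf_ge1// ltW.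
have Nhfin : N h \is a fin_num by rewrite ge0_fin_numE.
have nh0 : 0 < fine (N h) by rewrite fine_gt0// Nh andbT lt0e Nh_neq0.
pose g t := (fine (N h))^-1 * h t.
have grc : rc_noninc g by apply: rc_noninc_scale => //; rewrite invr_gt0.
have Ng1 : (N g <= 1)%E.
  rewrite (rin_scale riN) ?invr_ge0 ?(ltW nh0)// -[X in (_ * X)%E](fineK Nhfin).
  by rewrite -EFinM mulVf// gt_eqF.
have Ndg : (N (dilation s g) <= K%:E)%E.
  by apply: le_trans NK; apply: ereal_sup_ubound; exists g.
have Ngs : (N (fun t => g (s^-1 * t)%R) <= K%:E)%E.
  apply: (le_trans _ Ndg); apply: (rin_mono riN).
  - exact: measurable_noninc_dilate.
  - exact: le_lt_trans Ndg (ltry _).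
  move=> t /andP[t0 t1]; have st0 : 0 < s^-1 * t by rewrite mulr_gt0.
  rewrite ger0_norm ?(rcn_ge0 grc)//; apply: le_trans (ler_norm _).
  rewrite mulrC; apply: noninc_le_dilation => // u u1.
  by rewrite /g h1// mulr0.
rewrite (_ : (fun t => h (s^-1 * t)) = fun t => fine (N h) * g (s^-1 * t)); last first.
  by apply/funext => t; rewrite /g mulrA divff ?mul1r// gt_eqF.
rewrite (rin_scale riN) ?(ltW nh0)//; last exact: le_lt_trans Ngs (ltry _).
by rewrite fineK// muleC; apply: lee_wpmul2r.
Qed.

(** With [r = 2^-a] the power bound at [s = 2^-i] is [r ^ i], a geometric series. The first [i0.+1]
    terms, for which that bound may not be available, cost at most [N h] each. The constant depends
    neither on [h] nor on [J]. *)
Lemma rin_dyadic_sum_le : exists2 K : R, 0 <= K &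
  forall h : R -> R, rc_noninc h -> (forall t, 1 <= t -> h t = 0) ->
  (N h < +oo)%E -> forall J : nat,
  (\sum_(i < J) N (fun t => h ((2 ^ i)%:R * t)%R) <= K%:E * N h)%E.
Proof.
have [a a0 [s0 s00 Hs]] := dilation_norm_le_power.
have [i0 Hi0] : exists i0 : nat, (2 ^ i0)%:R^-1 < s0.
  have /ltr_add_invr[k] := s00; rewrite add0r => ks; exists k.
  apply: le_lt_trans ks; rewrite lef_pV2 ?posrE ?ltr0n ?expn_gt0//.
  by rewrite ler_nat ltn_expl.
pose r := expR (- (a * ln 2)).
have r0 : 0 < r by exact: expR_gt0.
have r1 : r < 1.
  by rewrite /r -[ltRHS]expR0 ltr_expR oppr_lt0 mulr_gt0// ln_gt0// ltr1n.
have geo J : \sum_(i < J) r ^+ i <= (1 - r)^-1.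
  elim: J => [|J IH]; first by rewrite big_ord0 invr_ge0; lra.
  rewrite big_ord_recl expr0 (_ : \sum_(i < J) _ = r * \sum_(i < J) r ^+ i); last first.
    by rewrite mulr_sumr; apply: eq_bigr => i _; rewrite exprS.
  apply: (@le_trans _ _ (1 + r * (1 - r)^-1)); first by rewrite lerD2l ler_pM2l.
  have r1' : 1 - r != 0 by rewrite gt_eqF// subr_gt0.
  rewrite le_eqVlt; apply/orP; left; apply/eqP; apply: (mulIf r1').
  by rewrite mulrDl -mulrA mulVf// mulr1 mul1r subrK.
have ir0 : 0 <= (1 - r)^-1 by rewrite invr_ge0; lra.
exists (i0.+1%:R + (1 - r)^-1); first by rewrite addr_ge0.
move=> h hrc h1 Nh J.
have Nh0 := bfs_ge0 bfsN h.
apply: (@le_trans _ _ (\sum_(i < J) ((i < i0.+1)%N%:R + r ^+ i)%:E * N h)%E); last first.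
  rewrite -ge0_sume_distrl; last first.
    by move=> i _; rewrite lee_fin addr_ge0// exprn_ge0// ltW.
  apply: lee_wpmul2r => //; rewrite sumEFin lee_fin big_split/=; apply: lerD (geo J).
  rewrite -natr_sum ler_nat.
  elim: J => [|J IH]; first by rewrite big_ord0.
  rewrite big_ord_recr/=; case: ltnP => Ji; last by rewrite addn0.
  rewrite addn1 (leq_ltn_trans _ Ji)//.
  apply: (@leq_trans (\sum_(i < J) 1)%N); last by rewrite sum1_card card_ord.
  by apply: leq_sum => i _; exact: leq_b1.
apply: lee_sum => i _; case: ltnP => [ii0|ii0].
  apply: (@le_trans _ _ (1%:E * N h)%E); last first.
    by apply: lee_wpmul2r => //; rewrite lee_fin lerDl exprn_ge0// ltW.
  rewrite mul1e; apply: (rin_mono riN) => //.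
    by apply: measurable_noninc_dilate => //; rewrite ltr0n expn_gt0.
  move=> t /andP[t0 _]; have i2 : 1 <= (2 ^ i)%:R :> R by rewrite ler1n expn_gt0.
  have it0 : 0 < (2 ^ i)%:R * t by rewrite mulr_gt0//; lra.
  rewrite !ger0_norm ?(rcn_ge0 hrc)//; apply: (rcn_noninc hrc) => //.
  by rewrite ler_peMl// ltW.
rewrite add0r -[(2 ^ i)%:R]invrK; apply: rin_dilate_le => //.
- rewrite invr_gt0 ltr0n expn_gt0/= invf_lt1 ?ltr0n ?expn_gt0// ltr1n.
  by rewrite -{1}(expn0 2) ltn_exp2l// (leq_trans _ ii0).
- by rewrite exprn_ge0// ltW.
have -> : r ^+ i = expR (a * ln (2 ^ i)%:R^-1).
  rewrite lnV ?posrE ?ltr0n ?expn_gt0// natrX lnXn// /r -expRM_natl; congr expR.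
  by rewrite -mulr_natl; lra.
apply: Hs; rewrite invr_gt0 ltr0n expn_gt0/=; apply: le_lt_trans Hi0.
by rewrite lef_pV2 ?posrE ?ltr0n ?expn_gt0// ler_nat leq_exp2l// ltnW.
Qed.

(** The indicator of []0, t[] is the dilation by [t] of the indicator of []0, 1[], so its norm is at
    most a multiple of [t^a]. *)
Lemma rin_cutoff1_small (e : R) : 0 < e -> exists2 t0 : R, 0 < t0 <= 1 &
  forall t, 0 < t <= t0 -> (N (cutoff t (cst 1%R)) < e%:E)%E.
Proof.
move=> e0; have [a a0 [s0 s00 Hs]] := dilation_norm_le_power.
have h1rc : rc_noninc (cutoff 1 (cst 1 : R -> R)).
  by apply: rc_noninc_cutoff; exact: rc_noninc_cst.
have h1_1 (t : R) : 1 <= t -> cutoff 1 (cst 1%R) t = 0.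
  by rewrite /cutoff => t1; case: ifP => // /andP[_]; rewrite ltNge t1.
have Nh1 : (N (cutoff 1 (cst 1%R)) < +oo)%E.
  apply: (@rin_bounded _ _ riN _ 1); first exact: measurable_noninc.
  by move=> x _; rewrite /cutoff; case: ifP; rewrite ?normr1 ?normr0.
have Nh10 := bfs_ge0 bfsN (cutoff 1 (cst 1%R)).
have Nfin : N (cutoff 1 (cst 1%R)) \is a fin_num by rewrite ge0_fin_numE.
set c := fine (N (cutoff 1 (cst 1%R))) + 1.
have c0 : 0 < c by rewrite ltr_wpDl// fine_ge0.
(* The three bounds give [t < 1], the range of the power bound, and [t^a <= e / c]. *)
pose t0 := Num.min (2^-1) (Num.min (s0 / 2) (expR (a^-1 * ln (e / c)))).
have t00 : 0 < t0.
  by rewrite /t0 !lt_min expR_gt0 !andbT divr_gt0// andbT; lra.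
exists t0; first by rewrite t00/= /t0 ge_min; apply/orP; left; lra.
move=> t /andP[tgt0 tt0].
have [t2 ts te] : [/\ t <= 2^-1, t <= s0 / 2 & t <= expR (a^-1 * ln (e / c))].
  by move: tt0; rewrite /t0 !le_min => /and3P[].
have cutE : cutoff t (cst 1) = fun u => cutoff 1 (cst 1%R : R -> R) (t^-1 * u).
  apply/funext => u; rewrite /cutoff mulrC ltr_pdivrMr// mul1r.
  by rewrite pmulr_lgt0 ?invr_gt0.
rewrite cutE; set K := expR (a * ln t).
have K0 : 0 <= K by exact: expR_ge0.
apply: (@le_lt_trans _ _ (K%:E * N (cutoff 1 (cst 1%R)))%E).
  apply: rin_dilate_le => //; first by rewrite tgt0; lra.
  by apply: Hs; rewrite tgt0; lra.
rewrite -(fineK Nfin) -EFinM lte_fin.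
have Ke : K <= e / c.
  have ec0 : 0 < e / c by rewrite divr_gt0.
  rewrite /K -[leRHS](lnK ec0) ler_expR mulrC -ler_pdivlMr// mulrC.
  by rewrite -[leRHS]expRK ler_ln// posrE expR_gt0.
apply: (@le_lt_trans _ _ (e / c * fine (N (cutoff 1 (cst 1%R))))).
  by rewrite ler_wpM2r// fine_ge0.
by rewrite -mulrA gtr_pMr// mulrC ltr_pdivrMr// mul1r ltrDl.
Qed.

End boyd.

(** * Comparison with dilations on a uniform grid *)

Lemma sum_ord_ltn_minn (R : realType) (M k p : nat) :
  \sum_(i < M | (i < k)%N) (i < p)%N%:R = (minn (minn k M) p)%:R :> R.
Proof.
rewrite big_mkcond/=; elim: M => [|M IH]; first by rewrite big_ord0 minn0 min0n.
rewrite big_ord_recr/= IH.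
have -> : (if (M < k)%N then (M < p)%N%:R else 0) = ((M < k) && (M < p))%N%:R :> R.
  by case: ifP.
rewrite -natrD; congr (_%:R); case: (ltnP M k) (ltnP M p) => /= ? [] ?; lia.
Qed.

Section trajectory_estimate.
Variables (R : realType) (N : (R -> R) -> \bar R).
Local Notation lam := (@lebesgue_measure R).
Local Notation I01 := (`]0, 1[%classic : set R).
Hypothesis riN : ri_space lam I01 N.
Variables (F G : R -> R) (q L : nat) (C K : R).
Hypotheses (rcF : rc_noninc F) (rcG : rc_noninc G).
Hypotheses (NG : (N G < +oo)%E).
Hypotheses (q0 : (0 < q)%N) (L0 : (0 < L)%N) (C0 : 0 <= C) (K0 : 0 <= K).

Let M := (q * L)%N.
Let a (m : nat) : R := F (m%:R / M%:R).
Let c (m : nat) : R := G (m%:R / M%:R).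

(** The grid form, on initial intervals, of the domination of [-s dF(s)] by [C G(s) ds]; [K]
    accounts for the first cell, where [G] may be unbounded. *)
Hypothesis prefix_le : forall k, (k < L)%N ->
  \sum_(0 <= j < k) j.+1%:R * (a j.+1 - a j.+2) <=
  K + C * \sum_(0 <= j < k) c j.+1.

Let M0 : (0 < M)%N. Proof. by rewrite muln_gt0 q0. Qed.
Let M0' : 0 < M%:R :> R. Proof. by rewrite ltr0n. Qed.
Let frac_gt0 j : 0 < j.+1%:R / M%:R :> R. Proof. by rewrite divr_gt0. Qed.
Let frac_le (i j : nat) : (i <= j)%N -> i%:R / M%:R <= j%:R / M%:R :> R.
Proof. by move=> ij; rewrite ler_pM2r ?invr_gt0// ler_nat. Qed.
Let LM : L%:R / M%:R = q%:R^-1 :> R.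
Proof.
by rewrite /M natrM invfM mulrCA divff ?mulr1// pnatr_eq0 -lt0n.
Qed.

(** The sum [z] telescopes to [a (maxn i 1) - a L] for [i <= L], while [y] discretises the integral
    of [G(s) / s] from the cell up to [1/q], with [K] added on the first cell. The factor 2 is
    needed because [a j.+1 - a j.+2] occupies [j + 2] cells, but [c j.+1 / j.+1] only [j + 1]. *)
Let z (i : nat) : R := \sum_(0 <= j < L.-1) (a j.+1 - a j.+2) * (i < j.+2)%N%:R.
Let y (i : nat) : R :=
  2 * (C * (\sum_(0 <= j < L.-1) c j.+1 / j.+1%:R * (i < j.+1)%N%:R) + K * (i == 0%N)%:R).

Let d_ge0 j : 0 <= a j.+1 - a j.+2.
Proof. by rewrite subr_ge0; apply: (rcn_noninc rcF) => //; exact: frac_le. Qed.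
Let c_ge0 j : 0 <= c j.+1. Proof. exact: (rcn_ge0 rcG). Qed.

Let z_ge0 i : 0 <= z i.
Proof. by apply: sumr_ge0 => j _; rewrite mulr_ge0. Qed.

Let y_ge0 i : 0 <= y i.
Proof.
rewrite mulr_ge0// addr_ge0// mulr_ge0//; apply: sumr_ge0 => j _.
by rewrite mulr_ge0// divr_ge0.
Qed.

Let z_noninc (i j : nat) : (i <= j)%N -> z j <= z i.
Proof.
move=> ij; apply: ler_sum => m _; rewrite ler_wpM2l// ler_nat.
by case: (ltnP j m.+2) => // jm; rewrite (leq_ltn_trans ij jm).
Qed.

(** Exchanging the sums, both prefix sums become sums over [j] that carry, up to the factor 2, the
    weight [minn k' j.+1 / j.+1]. It is nonincreasing in [j], so summation by parts transports
    [prefix_le]. *)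
Let zy_prefix (k : nat) :
  \sum_(i < M | (i < k)%N) z i <= \sum_(i < M | (i < k)%N) y i.
Proof.
set k' := minn k M.
have -> : \sum_(i < M | (i < k)%N) z i =
    \sum_(0 <= j < L.-1) (a j.+1 - a j.+2) * (minn k' j.+2)%:R.
  rewrite /z exchange_big/=; apply: eq_bigr => j _.
  by rewrite -mulr_sumr sum_ord_ltn_minn.
have -> : \sum_(i < M | (i < k)%N) y i = 2 * (C * (\sum_(0 <= j < L.-1)
    c j.+1 / j.+1%:R * (minn k' j.+1)%:R) + K * (minn k' 1)%:R).
  rewrite /y -mulr_sumr big_split/= -!mulr_sumr exchange_big/=.
  congr (_ * (_ * _ + _ * _)).
    by apply: eq_bigr => j _; rewrite -mulr_sumr sum_ord_ltn_minn.
  by rewrite -sum_ord_ltn_minn; apply: eq_bigr => i _; rewrite ltnS leqn0.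
pose w j : R := (minn k' j.+1)%:R / j.+1%:R.
pose p j : R := j.+1%:R * (a j.+1 - a j.+2).
pose r j : R := C * c j.+1 + K * (j == 0%N)%:R.
apply: (@le_trans _ _ (2 * \sum_(0 <= j < L.-1) w j * p j)).
  rewrite mulr_sumr; apply: ler_sum => j _.
  have -> : 2 * (w j * p j) = (a j.+1 - a j.+2) * (2 * (minn k' j.+1)%:R).
    rewrite /w /p mulrA -[in LHS]mulrA.
    rewrite [_ / _ * _](_ : _ = (minn k' j.+1)%:R * (a j.+1 - a j.+2)); last first.
      by rewrite mulrA divfK// pnatr_eq0.
    by rewrite mulrA mulrC.
  by apply: ler_wpM2l => //; rewrite -natrM ler_nat; lia.
rewrite ler_pM2l//; apply: (@le_trans _ _ (\sum_(0 <= j < L.-1) w j * r j)).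
  apply: ler_sum_prefix.
  - move=> i iL; have iL' : (i < L)%N by lia.
    case: i => [|i] in iL iL' *; first by rewrite !big_nil.
    apply: le_trans (prefix_le iL') _; rewrite /r big_split/= -!mulr_sumr.
    have -> : \sum_(0 <= j < i.+1) (j == 0%N)%:R = 1 :> R.
      by rewrite big_nat_recl//= big1 ?addr0.
    by rewrite mulr1 addrC.
  - by move=> j; rewrite divr_ge0.
  - move=> j; rewrite ler_pdivrMr// mulrAC ler_pdivlMr// -!natrM ler_nat.
    by nia.
have -> : \sum_(0 <= j < L.-1) w j * r j =
    C * (\sum_(0 <= j < L.-1) c j.+1 / j.+1%:R * (minn k' j.+1)%:R) +
    K * \sum_(0 <= j < L.-1) w j * (j == 0%N)%:R.
  rewrite !mulr_sumr -big_split/=; apply: eq_bigr => j _; rewrite /r mulrDr.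
  congr (_ + _); last by rewrite mulrCA.
  rewrite mulrCA /w; congr (_ * _).
  by rewrite mulrAC [X in X / _]mulrC [RHS]mulrAC.
rewrite lerD2l; apply: ler_wpM2l => //; case: (L.-1) => [|L'].
  by rewrite big_nil.
by rewrite big_nat_recl//= big1 ?addr0 ?mulr1 ?/w ?divr1// => j _; rewrite mulr0.
Qed.


Let z_tail (i : nat) : (0 < i <= L)%N -> a i - a L <= z i.
Proof.
move=> /andP[i0 iL]; rewrite /z (@big_cat_nat _ _ _ i.-1)//=; last 1 first.
  by rewrite -!subn1 leq_sub2r.
apply: (@le_trans _ _ (\sum_(i.-1 <= j < L.-1) (a j.+1 - a j.+2) * (i < j.+2)%N%:R)).
  rewrite (eq_big_nat _ _ (F2 := fun j => - (a j.+2 - a j.+1))); last first.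
    by move=> j /andP[ij jL]; rewrite (_ : (i < j.+2)%N) ?mulr1 ?opprB//; lia.
  rewrite sumrN (telescope_sumr (fun j => a j.+1)); last by rewrite -!subn1 leq_sub2r.
  by rewrite !prednK// opprB.
by rewrite lerDr; apply: sumr_ge0 => j _; rewrite mulr_ge0.
Qed.

Let capped_le_step (s : R) : 0 < s < 1 ->
  Num.max 0 (Num.min (F s) (F M%:R^-1) - F q%:R^-1) <= step (fun i : 'I_M => z i) s.
Proof.
move=> s01; have [i si] := cell_cover M0 s01; rewrite (step_cell M0 _ si).
move: si; rewrite /cell/= in_itv/= => /andP[is_ si]; have /andP[s0 _] := s01.
rewrite ge_max z_ge0/= -LM -/(a L).
have [iL|Li] := ltnP i L; last first.
  apply: le_trans (z_ge0 i); rewrite subr_le0 ge_min; apply/orP; left.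
  apply: (rcn_noninc rcF); first by rewrite divr_gt0// ltr0n.
  by apply: le_trans is_; exact: frac_le.
(* The left endpoint of the first cell is 0, where [F] gives no bound; the cap at [F (1 / M) = a 1]
   replaces it. *)
have [i0|i0] := posnP i.
  have zi : z 1 <= z i by apply: z_noninc; rewrite i0.
  apply: le_trans zi; apply: (le_trans _ (z_tail _)); last by rewrite L0.
  by rewrite lerD2r ge_min /a mul1r lexx orbT.
apply: (le_trans _ (z_tail _)); last by rewrite i0 ltnW.
rewrite lerD2r ge_min; apply/orP; left; apply: (rcn_noninc rcF) => //.
by rewrite divr_gt0// ltr0n.
Qed.

(** On cell [i] one has [s < i.+1 / M], so the dyadic blocks that start at [i.+1] are bounded by [G]
    at the points [2 ^ l * s]. *)
Let step_y_le (J : nat) (s : R) : (L <= 2 ^ J)%N -> 0 < s < 1 ->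
  step (fun i : 'I_M => y i) s <=
  (2 * C) * (\sum_(l < J) cutoff q%:R^-1 G ((2 ^ l)%:R * s)) +
  (2 * K) * cutoff M%:R^-1 (cst 1) s.
Proof.
move=> LJ s01; have [i si] := cell_cover M0 s01; rewrite (step_cell M0 _ si).
move: si; rewrite /cell/= in_itv/= => /andP[is_ si]; have /andP[s0 _] := s01.
have rcc := rc_noninc_cutoff q%:R^-1 rcG.
rewrite /y mulrDr !mulrA; apply: lerD; last first.
  apply: ler_wpM2l; first by rewrite mulr_ge0.
  case: eqP => i0; rewrite /cutoff s0/=; last by case: ifP.
  by rewrite (_ : s < M%:R^-1)//; move: si; rewrite i0 mul1r.
apply: ler_wpM2l; first by rewrite mulr_ge0.
(* At index 0 the cutoff would vanish and break monotonicity, hence [maxn m 1]. *)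
pose c' m := cutoff q%:R^-1 G ((maxn m 1)%:R / M%:R).
have c'0 m : 0 <= c' m.
  by apply: (rcn_ge0 rcc); rewrite divr_gt0// ltr0n leq_max orbT.
apply: (@le_trans _ _ (\sum_(i.+1 <= m < 2 ^ J * i.+1) c' m / m%:R)); last first.
  apply: le_trans (@sum_div_index_le _ c' i.+1 J _ c'0 _) _ => //.
    move=> k m km; apply: (rcn_noninc rcc); last by apply: frac_le; lia.
    by rewrite divr_gt0// ltr0n leq_max orbT.
  apply: ler_sum => l _; apply: (rcn_noninc rcc).
    by rewrite mulr_gt0// ltr0n expn_gt0.
  rewrite (maxn_idPl _) ?muln_gt0 ?expn_gt0// natrM -mulrA ler_pM2l ?ltr0n ?expn_gt0//.
  exact: ltW.
have [iL|Li] := leqP L.-1 i.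
  rewrite big_nat_cond big1 ?sumr_ge0//.
    by move=> m _; rewrite divr_ge0.
  by move=> j /andP[/andP[_ jL] _]; rewrite (_ : (i < j.+1)%N = false) ?mulr0//; lia.
rewrite (@big_cat_nat _ _ _ i)//=; last exact: ltnW.
rewrite big_nat_cond big1 ?add0r; last first.
  by move=> j /andP[/andP[_ jL] _]; rewrite (_ : (i < j.+1)%N = false) ?mulr0//; lia.
rewrite [leRHS](@big_cat_nat _ _ _ L)//=; last 2 first.
  by lia.
  by apply: leq_trans LJ _; rewrite leq_pmulr.
apply: (@le_trans _ _ (\sum_(i.+1 <= m < L) c' m / m%:R)); last first.
  by rewrite lerDl sumr_ge0// => m _; rewrite divr_ge0.
rewrite -[X in \sum_(_ <= _ < X) c' _ / _](prednK L0) big_add1/=.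
apply: ler_sum_nat => j /andP[ij jL]; rewrite ltnS ij mulr1 ler_wpM2r ?invr_ge0//.
rewrite /c' (maxn_idPl _)// /cutoff frac_gt0/= ifT// -LM ltr_pM2r ?invr_gt0// ltr_nat.
by lia.
Qed.

Lemma rin_capped_le (K1 : R) :
  (forall J : nat, (\sum_(i < J) N (fun t => cutoff q%:R^-1 G ((2 ^ i)%:R * t))%R
     <= K1%:E * N (cutoff q%:R^-1 G)%R)%E) ->
  (N (fun t => Num.max 0 (Num.min (F t) (F M%:R^-1) - F q%:R^-1))%R <=
   (2 * C * K1)%:E * N (cutoff q%:R^-1 G)%R +
   (2 * K)%:E * N (cutoff M%:R^-1 (cst 1))%R)%E.
Proof.
move=> HK1.
have rcc := rc_noninc_cutoff q%:R^-1 rcG.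
have Ncut : (N (cutoff q%:R^-1 G)%R < +oo)%E.
  apply: le_lt_trans NG; apply: (rin_mono riN) => //; first exact: measurable_noninc.
  move=> x /andP[x0 _]; rewrite !ger0_norm ?(rcn_ge0 rcc)// ?(rcn_ge0 rcG)//.
  by rewrite /cutoff; case: ifP => // _; exact: (rcn_ge0 rcG).
have rc1 : rc_noninc (cutoff M%:R^-1 (cst 1%R : R -> R)).
  by apply: rc_noninc_cutoff; exact: rc_noninc_cst.
have N1 : (N (cutoff M%:R^-1 (cst 1))%R < +oo)%E.
  apply: (@rin_bounded _ _ riN _ 1); first exact: measurable_noninc.
  by move=> x _; rewrite /cutoff; case: ifP; rewrite ?normr1 ?normr0.
have Nl l : (N (fun t => cutoff q%:R^-1 G ((2 ^ l)%:R * t))%R < +oo)%E.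
  apply: (le_lt_trans _ Ncut); apply: (rin_mono riN) => //.
    by apply: measurable_noninc_dilate => //; rewrite ltr0n expn_gt0.
  move=> t /andP[t0 _]; have i2 : 1 <= (2 ^ l)%:R :> R by rewrite ler1n expn_gt0.
  have it0 : 0 < (2 ^ l)%:R * t by rewrite mulr_gt0//; lra.
  rewrite !ger0_norm ?(rcn_ge0 rcc)//; apply: (rcn_noninc rcc) => //.
  by rewrite ler_peMl// ltW.
set J := L.
have LJ : (L <= 2 ^ J)%N by rewrite ltnW// ltn_expl.
pose S s := \sum_(l < J) cutoff q%:R^-1 G ((2 ^ l)%:R * s).
have NS : (N S <= K1%:E * N (cutoff q%:R^-1 G)%R)%E.
  apply: le_trans (HK1 J).
  exact: (rin_sum riN (index_enum 'I_J) (fun l => Nl (val l))).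
have NSoo : (N S < +oo)%E.
  apply: le_lt_trans (rin_sum riN (index_enum 'I_J) (fun l => Nl (val l))) _.
  by apply: lte_sum_pinfty => l _; exact: Nl.
have C20 : 0 <= 2 * C by rewrite mulr_ge0.
have K20 : 0 <= 2 * K by rewrite mulr_ge0.
have Nsum : (N ((fun s => 2 * C * S s)%R \+ (fun s => 2 * K * cutoff M%:R^-1 (cst 1) s))%R
    <= (2 * C * K1)%:E * N (cutoff q%:R^-1 G)%R +
       (2 * K)%:E * N (cutoff M%:R^-1 (cst 1))%R)%E.
  apply: le_trans (bfs_triangle (ri_bfs riN) _ _) _;
    try exact: (rin_scale_lty riN).
  rewrite !(rin_scale riN)//; apply: leeD => //.
  by rewrite [leRHS](_ : _ = (2 * C)%:E * (K1%:E * N (cutoff q%:R^-1 G)%R))%E;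
    [apply: lee_wpmul2l|rewrite muleA -EFinM].
have Nsum_lty : (N ((fun s => 2 * C * S s)%R \+
    (fun s => 2 * K * cutoff M%:R^-1 (cst 1) s))%R < +oo)%E.
  apply: le_lt_trans (bfs_triangle (ri_bfs riN) _ _) _;
    try exact: (rin_scale_lty riN).
  by apply: lte_add_pinfty; exact: (rin_scale_lty riN).
apply: le_trans Nsum; apply: (@le_trans _ _ (N (step (fun i : 'I_M => y i)))); last first.
  apply: (rin_mono riN) => //; first exact: measurable_step.
  move=> s s01; rewrite [leLHS]ger0_norm; last first.
    by apply: sumr_ge0 => i _; rewrite mulr_ge0.
  by apply: le_trans (ler_norm _); exact: step_y_le.
apply: (@le_trans _ _ (N (step (fun i : 'I_M => z i)))); last first.
  by apply: (rin_step_majorization riN M0) => // i j; exact: z_noninc.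
apply: (rin_mono riN).
- apply: measurable_maxr => //; apply: measurable_funB => //.
  by apply: measurable_minr => //; exact: measurable_noninc.
- exact: (rin_step_lty riN M0).
- move=> s s01; rewrite [leLHS]ger0_norm ?le_max ?lexx//.
  by apply: le_trans (ler_norm _); exact: capped_le_step.
Qed.

End trajectory_estimate.

(** * Averages over a short initial interval *)

Lemma sum_noninc_average_le (R : realType) (c : nat -> R) (m p : nat) :
  (m <= p)%N -> (forall i j, (i <= j)%N -> c j <= c i) ->
  m%:R * \sum_(0 <= i < p) c i <= p%:R * \sum_(0 <= i < m) c i.
Proof.
move=> mp cn; rewrite (@big_cat_nat _ _ _ m)//= mulrDr.
have -> : p%:R = m%:R + (p - m)%:R :> R by rewrite -natrD subnKC.
rewrite mulrDl lerD2l; apply: (@le_trans _ _ (m%:R * ((p - m)%:R * c m))).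
  apply: ler_wpM2l => //; rewrite mulr_natl -sumr_const_nat.
  by apply: ler_sum_nat => i /andP[mi _]; exact: cn.
rewrite mulrCA; apply: ler_wpM2l => //; rewrite mulr_natl -[X in _ *+ X]subn0.
rewrite -sumr_const_nat; apply: ler_sum_nat => i /andP[_ im]; apply: cn; exact: ltnW.
Qed.

Section grid.
Context (d : measure_display) (T : measurableType d) (R : realType).
Variables (mu : {measure set T -> \bar R}) (D : set T).
Hypotheses (mD : measurable D) (muD : mu D = 1%E).
Variable f : T -> R.
Hypothesis fint : mu.-integrable D (EFin \o f).

Local Notation F := (rearrangement mu D f).

Let mf : measurable_fun D f.
Proof. by apply/measurable_EFinP; case/integrableP : fint. Qed.

Let rcF : rc_noninc F := rc_noninc_rearrangement mD muD mf.

Definition excess_mass (l : R) : R := fine (\int[mu]_(x in D) (excess f l x)%:E)%E.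

Lemma excess_massE l : 0 <= l ->
  (excess_mass l)%:E = (\int[mu]_(x in D) (excess f l x)%:E)%E.
Proof. by move=> l0; rewrite fineK// integral_excess_fin. Qed.

Lemma excess_mass_ge0 l : 0 <= excess_mass l.
Proof.
by apply: fine_ge0; apply: integral_ge0 => x _; rewrite lee_fin excess_ge0.
Qed.

Lemma excess_mass_le (l l' t : R) : 0 <= l' <= l ->
  (mu (superlevel D f l') <= t%:E)%E ->
  excess_mass l' <= excess_mass l + (l - l') * t.
Proof.
move=> /andP[l'0 l'l] mut; have l0 := le_trans l'0 l'l.
rewrite -lee_fin EFinD excess_massE// excess_massE//.
apply: le_trans (integral_excess_upper mD fint mD (@subset_refl _ _) l'l) _.
apply: leeD => //; rewrite EFinM; apply: lee_wpmul2l; first by rewrite lee_fin subr_ge0.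
by rewrite setIidl// => x [].
Qed.

(** A Riemann sum for the integral of [F - F t] over []0, t[], [t = k.+1 * h]. Between the levels
    [F (j * h)] and [F (j.+1 * h)] the superlevel sets have measure at most [j.+1 * h] instead of
    [j * h], which produces the additional term [F h]. *)
Lemma excess_mass_grid (h : R) (k : nat) : 0 < h ->
  excess_mass (F (k.+1%:R * h)) <= excess_mass (F h) +
    h * (F h + \sum_(0 <= j < k) F (j.+1%:R * h) - k.+1%:R * F (k.+1%:R * h)).
Proof.
have aux (A B S v w : R) :
    h * (A + S - w * B) + (B - v) * ((w + 1) * h) = h * (A + (S + B) - (w + 1) * v).
  by lra.
move=> h0; have kh j : 0 < j.+1%:R * h by rewrite mulr_gt0.
elim: k => [|k IH]; first by rewrite big_nil !mul1r addr0 subrr mulr0 addr0.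
apply: (@le_trans _ _ (excess_mass (F (k.+1%:R * h)) +
    (F (k.+1%:R * h) - F (k.+2%:R * h)) * (k.+2%:R * h))); last first.
  apply: le_trans (lerD IH (lexx _)) _; rewrite big_nat_recr//=.
  by rewrite -addrA lerD2l -(natr1 k.+1) aux.
have Fk : F (k.+2%:R * h) <= F (k.+1%:R * h).
  by apply: (rcn_noninc rcF) => //; rewrite ler_pM2r// ler_nat.
apply: excess_mass_le; first by rewrite Fk andbT; exact: (rcn_ge0 rcF).
exact: (mu_superlevel_rearrangement mD muD mf).
Qed.

Section averaging.
Variable N : (R -> R) -> \bar R.
Local Notation lam := (@lebesgue_measure R).
Local Notation I01 := (`]0, 1[%classic : set R).
Hypotheses (riN : ri_space lam I01 N) (NF : (N F < +oo)%E).
Variable M : nat.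
Hypothesis M0 : (0 < M)%N.

Let M0' : 0 < M%:R :> R. Proof. by rewrite ltr0n. Qed.

Let rcc : rc_noninc (cutoff M%:R^-1 F) := rc_noninc_cutoff M%:R^-1 rcF.

Lemma rin_cutoff_lty (tau : R) : (N (cutoff tau F) < +oo)%E.
Proof.
have rct := rc_noninc_cutoff tau rcF.
apply: le_lt_trans NF; apply: (rin_mono riN) => //; first exact: measurable_noninc.
move=> x /andP[x0 _]; rewrite !ger0_norm ?(rcn_ge0 rct)// ?(rcn_ge0 rcF)//.
by rewrite /cutoff; case: ifP => // _; exact: (rcn_ge0 rcF).
Qed.

Lemma rin_cutoff1_lty (tau : R) : (N (cutoff tau (cst 1))%R < +oo)%E.
Proof.
have rc1 : rc_noninc (cutoff tau (cst 1%R : R -> R)).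
  by apply: rc_noninc_cutoff; exact: rc_noninc_cst.
apply: (@rin_bounded _ _ riN _ 1); first exact: measurable_noninc.
by move=> x _; rewrite /cutoff; case: ifP; rewrite ?normr1 ?normr0.
Qed.

Let avg (p : nat) : R := p%:R^-1 * \sum_(0 <= j < p) F (j.+1%:R / (M * p)%:R).

(** Averaging does not increase the norm: on the grid of [M * p] cells, the constant equal to the
    mean of the first [p] heights is majorized by these nonincreasing heights, and the latter lie
    below [F] because they are taken at right endpoints. *)
Let rin_avg_le (p : nat) : (0 < p)%N ->
  ((avg p)%:E * N (cutoff M%:R^-1 (cst 1))%R <= N (cutoff M%:R^-1 F)%R)%E.
Proof.
move=> p0; pose M' := (M * p)%N.
have M'0 : (0 < M')%N by rewrite muln_gt0 M0.
have M'0' : 0 < M'%:R :> R by rewrite ltr0n.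
have p0' : 0 < p%:R :> R by rewrite ltr0n.
have pM : p%:R / M'%:R = M%:R^-1 :> R.
  by rewrite natrM invfM mulrCA divff ?mulr1// gt_eqF.
have cge0 j : 0 <= F (j.+1%:R / M'%:R) by apply: (rcn_ge0 rcF); rewrite divr_gt0.
have avg0 : 0 <= avg p by rewrite mulr_ge0 ?invr_ge0// sumr_ge0// => j _; exact: cge0.
pose x (i : 'I_M') : R := avg p * (i < p)%N%:R.
pose y (i : 'I_M') : R := F (i.+1%:R / M'%:R) * (i < p)%N%:R.
have y0 i : 0 <= y i by rewrite mulr_ge0.
rewrite -(rin_scale riN)//; last exact: rin_cutoff1_lty.
apply: (@le_trans _ _ (N (step x))).
  apply: (rin_mono riN).
  - apply: measurable_funM => //; apply: measurable_noninc.
    by apply: rc_noninc_cutoff; exact: rc_noninc_cst.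
  - exact: (rin_step_lty riN M'0).
  - move=> s s01; have [i si] := cell_cover M'0 s01; rewrite (step_cell M'0 _ si).
    have /andP[s0 _] := s01; rewrite /cutoff s0/= ger0_norm; last first.
      by rewrite mulr_ge0//; case: ifP.
    apply: le_trans (ler_norm _); rewrite /x; apply: ler_wpM2l => //.
    case: ifPn => // sM; move: si; rewrite /cell/= in_itv/= => /andP[is_ _].
    have := le_lt_trans is_ sM; rewrite -pM ltr_pM2r ?invr_gt0// ltr_nat => ->.
    by [].
apply: (@le_trans _ _ (N (step y))); last first.
  apply: (rin_mono riN); [exact: measurable_step|exact: rin_cutoff_lty|].
  move=> s s01; have [i si] := cell_cover M'0 s01; rewrite (step_cell M'0 _ si).
  have /andP[s0 _] := s01; rewrite ger0_norm//; apply: le_trans (ler_norm _).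
  move: si; rewrite /cell/= in_itv/= => /andP[is_ si].
  rewrite /y; case: ltnP => ip; last by rewrite mulr0 (rcn_ge0 rcc).
  rewrite mulr1 /cutoff s0/= ifT; last first.
    by apply: lt_le_trans si _; rewrite -pM ler_pM2r ?invr_gt0// ler_nat.
  by apply: (rcn_noninc rcF) => //; exact: ltW.
apply: (rin_step_majorization riN M'0) => //.
- by move=> i; rewrite mulr_ge0.
- move=> i j ij; rewrite /x; apply: ler_wpM2l => //; rewrite ler_nat.
  by case: (ltnP j p) => // jp; rewrite (leq_ltn_trans ij jp).
move=> k; rewrite /x -mulr_sumr sum_ord_ltn_minn.
set m := minn _ _; have mp : (m <= p)%N by rewrite geq_minr.
have -> : \sum_(i < M' | (i < k)%N) y i = \sum_(0 <= j < m) F (j.+1%:R / M'%:R).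
  rewrite big_mkcond/= /y.
  rewrite (big_nat_widen _ _ M'); last by rewrite /m; lia.
  rewrite big_mkord [RHS]big_mkcond/=; apply: eq_bigr => i _.
  have iM := ltn_ord i.
  rewrite (_ : (i < m)%N = (i < k)%N && (i < p)%N); last by rewrite /m; lia.
  by case: (i < k)%N; case: (i < p)%N; rewrite /= ?mulr1 ?mulr0.
rewrite /avg -mulrA ler_pdivrMl// mulrC.
apply: sum_noninc_average_le => // i j ij; apply: (rcn_noninc rcF).
  by rewrite divr_gt0.
by rewrite ler_pM2r ?invr_gt0// ler_nat.
Qed.

(** As [F] may be unbounded, the first cell is divided into [p] subcells: the excess above
    [F (1 / (M * p))] tends to 0 with [p], and the rest is at most twice the mean of [p] grid
    values, once for the sum itself and once for the additional term in [excess_mass_grid]. *)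
Lemma rin_excess_mass_le :
  ((M%:R * excess_mass (F M%:R^-1))%:E * N (cutoff M%:R^-1 (cst 1))%R <=
   2%:E * N (cutoff M%:R^-1 F)%R)%E.
Proof.
set phi := N (cutoff M%:R^-1 (cst 1))%R.
have phi0 : (0 <= phi)%E := bfs_ge0 (ri_bfs riN) _.
have phifin : phi \is a fin_num by rewrite ge0_fin_numE//; exact: rin_cutoff1_lty.
have NF0 : (0 <= N (cutoff M%:R^-1 F)%R)%E := bfs_ge0 (ri_bfs riN) _.
have NFfin : N (cutoff M%:R^-1 F)%R \is a fin_num.
  by rewrite ge0_fin_numE//; exact: rin_cutoff_lty.
have key p : (0 < p)%N -> M%:R * excess_mass (F M%:R^-1) <=
    M%:R * excess_mass (F (M%:R^-1 / p%:R)) + 2 * avg p.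
  move=> p0; have p0' : 0 < p%:R :> R by rewrite ltr0n.
  have h0 : 0 < (M * p)%:R^-1 :> R by rewrite invr_gt0 ltr0n muln_gt0 M0.
  have Mp : M%:R * (M * p)%:R^-1 = p%:R^-1 :> R.
    by rewrite natrM invfM mulrA divff ?mul1r// gt_eqF.
  have := @excess_mass_grid (M * p)%:R^-1 p.-1 h0.
  rewrite prednK// (_ : p%:R * (M * p)%:R^-1 = M%:R^-1); last first.
    by rewrite natrM invfM mulrCA divff ?mulr1// gt_eqF.
  rewrite (_ : (M * p)%:R^-1 = M%:R^-1 / p%:R) -?invfM -?natrM//.
  move=> /(ler_wpM2l (ltW M0')) /le_trans; apply.
  rewrite mulrDr lerD2l mulrA Mp /avg mulrCA; apply: ler_wpM2l; first by rewrite invr_ge0.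
  have cge0 j : 0 <= F (j.+1%:R / (M * p)%:R).
    by apply: (rcn_ge0 rcF); rewrite divr_gt0// ltr0n muln_gt0 M0.
  rewrite lerBlDr; apply: (@le_trans _ _ (2 * \sum_(0 <= j < p) F (j.+1%:R / (M * p)%:R))).
    rewrite mulr_natl mulr2n; apply: lerD.
      case: (p) p0 cge0 => // p' _ cge0; rewrite big_nat_recl//= mul1r lerDl.
      by apply: sumr_ge0 => j _; exact: cge0.
    case: (p) p0 cge0 => // p' _ cge0; rewrite [leRHS]big_nat_recr//= lerDl.
    exact: cge0.
  by rewrite lerDl mulr_ge0// (rcn_ge0 rcF)// invr_gt0.
rewrite -(fineK phifin) -(fineK NFfin) -!EFinM lee_fin.
apply/ler_addgt0Pr => e e0.
have phi0' : 0 <= fine phi by exact: fine_ge0.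
pose e' := e / (M%:R * (fine phi + 1)).
have den0 : 0 < M%:R * (fine phi + 1) by rewrite mulr_gt0// ltr_wpDl.
have e'0 : 0 < e' by rewrite divr_gt0.
have iM0 : 0 < M%:R^-1 :> R by rewrite invr_gt0.
have /(@cvge_near_lt _ _ _ e'%:E) := integral_excess_cvg0 mD muD fint iM0.
rewrite lte_fin => /(_ e'0)[p _ /(_ p (leqnn _))/=].
rewrite -excess_massE; last by apply: (rcn_ge0 rcF); rewrite divr_gt0.
rewrite lte_fin => Jp.
have avgp : ((avg p.+1)%:E * phi <= N (cutoff M%:R^-1 F)%R)%E := @rin_avg_le p.+1 isT.
rewrite -(fineK phifin) -(fineK NFfin) -EFinM lee_fin in avgp.
apply: (@le_trans _ _ ((M%:R * e' + 2 * avg p.+1) * fine phi)).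
  apply: ler_wpM2r => //; apply: le_trans (key p.+1 isT) _; rewrite lerD2r.
  by apply: ler_wpM2l; rewrite ltW.
rewrite mulrDl addrC; apply: lerD; first by rewrite -mulrA ler_wpM2l.
rewrite /e' [leLHS](_ : _ = e * ((M%:R * fine phi) / (M%:R * (fine phi + 1)))).
  rewrite ler_piMr ?(ltW e0)// ler_pdivrMr// mul1r ler_pM2l//; lra.
by rewrite mulrCA -[LHS]mulrA; congr (_ * _); rewrite mulrAC.
Qed.

Lemma rin_cutoff1_le :
  ((F M%:R^-1)%:E * N (cutoff M%:R^-1 (cst 1))%R <= N (cutoff M%:R^-1 F)%R)%E.
Proof.
have FM0 : 0 <= F M%:R^-1 by apply: (rcn_ge0 rcF); rewrite invr_gt0.
rewrite -(rin_scale riN)//; last exact: rin_cutoff1_lty.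
apply: (rin_mono riN); last 1 first.
- move=> s /andP[s0 _]; rewrite /cutoff s0/=; case: ifPn => sM; last first.
    by rewrite mulr0.
  rewrite mulr1 !ger0_norm// ?(rcn_ge0 rcF)//.
  by apply: (rcn_noninc rcF) => //; exact: ltW.
- apply: measurable_funM => //; apply: measurable_noninc.
  by apply: rc_noninc_cutoff; exact: rc_noninc_cst.
- exact: rin_cutoff_lty.
Qed.

End averaging.
End grid.

(** * Heads of small norm in separable spaces *)

Section order_continuity.
Variables (R : realType) (N : (R -> R) -> \bar R).
Local Notation lam := (@lebesgue_measure R).
Local Notation I01 := (`]0, 1[%classic : set R).
Hypotheses (riN : ri_space lam I01 N) (alpha_gt0 : 0 < lower_boyd_index N).

Let bfsN : banach_function_space lam I01 N := ri_bfs riN.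

Definition translate (th eta : R) (h : R -> R) (x : R) : R :=
  if th < x < th + eta then h (x - th) else 0.

(** Right continuity makes every superlevel set an interval []0, r[] open on the right, so a head
    and its translate have superlevel sets of the same length. *)
Lemma rc_noninc_threshold (h : R -> R) (eta l : R) : rc_noninc h -> 0 <= eta ->
  0 <= l -> (forall x, eta <= x -> h x = 0) ->
  exists2 r, 0 <= r <= eta & forall x, 0 < x -> (l < h x) = (x < r).
Proof.
move=> rch eta0 l0 heta; pose A := [set x | 0 < x /\ l < h x].
have Aeta x : A x -> x < eta.
  move=> [x0 lx]; rewrite ltNge; apply/negP => /heta hx0.
  by move: lx; rewrite hx0 ltNge l0.
have Aub : ubound A eta by move=> x /Aeta/ltW.
have [[a Aa]|nA] := pselect (exists a, A a); last first.
  exists 0; first by rewrite lexx.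
  move=> x x0; rewrite [RHS]ltNge (ltW x0)/=; apply/negP => lx.
  by apply: nA; exists x.
have supA : has_sup A by split; [exists a|exists eta].
exists (sup A).
  apply/andP; split; last by apply: ge_sup => //; exists a.
  by apply: le_trans (sup_upper_bound supA Aa); rewrite ltW//; case: Aa.
move=> x x0; apply/idP/idP => [lx|xA].
  have [e e0 le] := rcn_right_cont rch x0 l0 lx.
  apply: (@lt_le_trans _ _ (x + e)); first by rewrite ltrDl.
  by apply: (sup_upper_bound supA); split=> //; rewrite addr_gt0.
have [|b [b0 lb] xb] := @sup_adherent _ A (sup A - x) _ supA.
  by rewrite subr_gt0.
apply: lt_le_trans lb _; apply: (rcn_noninc rch) => //; rewrite ltW//.
by move: xb; rewrite subKr.
Qed.

Lemma translate_ge0 th eta (h : R -> R) x : rc_noninc h -> 0 <= translate th eta h x.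
Proof.
move=> rch; rewrite /translate; case: ifP => // /andP[thx _].
by apply: (rcn_ge0 rch); rewrite subr_gt0.
Qed.

Lemma measurable_translate th eta (h : R -> R) : rc_noninc h ->
  measurable_fun I01 (translate th eta h).
Proof.
move=> rch; apply: measurable_quasiconcave; first exact: interval_is_interval.
move=> x y z _ _ xy yz; have [xin|] := boolP (th < x < th + eta); last first.
  by move=> /negbTE xin; rewrite ge_min /translate xin -/(translate th eta h y) translate_ge0.
have [zin|] := boolP (th < z < th + eta); last first.
  by move=> /negbTE zin; rewrite ge_min orbC /translate zin -/(translate th eta h y) translate_ge0.
rewrite ge_min orbC /translate zin ifT; last by move: xin zin; lra.
apply/orP; left; apply: (rcn_noninc rch); first by move: xin; lra.
by move: yz; lra.
Qed.

Lemma rin_translate th eta (h : R -> R) : rc_noninc h -> (N (cutoff eta h) < +oo)%E ->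
  0 <= th -> 0 <= eta -> th + eta <= 1 -> N (translate th eta h) = N (cutoff eta h).
Proof.
move=> rch Nh th0 eta0 th1; apply: (rin_equimeasurable riN) => //.
  exact: measurable_translate.
have rck := rc_noninc_cutoff eta rch.
move=> l l0; have [|r /andP[r0 reta] Hr] := rc_noninc_threshold rck eta0 l0.
  by move=> x etax; rewrite /cutoff; case: ifP => // /andP[_]; rewrite ltNge etax.
have -> : superlevel I01 (cutoff eta h) l = `]0, r[%classic.
  apply/seteqP; split=> x /=; rewrite /superlevel/= !in_itv/=.
    move=> [/andP[x0 x1]]; rewrite ger0_norm ?(rcn_ge0 rck)// Hr// => ->.
    by rewrite x0.
  move=> /andP[x0 xr]; rewrite x0 ger0_norm ?(rcn_ge0 rck)// Hr//; split=> //.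
  by move: xr; lra.
have -> : superlevel I01 (translate th eta h) l = `]th, (th + r)[%classic.
  have tE x : th < x -> translate th eta h x = cutoff eta h (x - th).
    by move=> thx; rewrite /translate /cutoff subr_gt0 thx ltrBlDl.
  apply/seteqP; split=> x /=; rewrite /superlevel/= !in_itv/=.
    move=> [/andP[x0 x1]]; rewrite ger0_norm ?translate_ge0// => lx.
    have thx : th < x.
      rewrite ltNge; apply/negP => xth; move: lx; rewrite /translate.
      by rewrite (ltNge th) xth/= ltNge l0.
    by move: lx; rewrite tE// Hr ?subr_gt0// ltrBlDl thx.
  move=> /andP[thx xr]; rewrite ger0_norm ?translate_ge0// tE// Hr ?subr_gt0//.
  by split; [move: xr; lra|rewrite ltrBlDl].
rewrite !lebesgue_measure_itv/= !lte_fin ltrDl; case: ifP => // _.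
by rewrite oppr0 adde0 EFinD addeAC subee// add0e.
Qed.

Lemma rin_oppr (h : R -> R) : (N h < +oo)%E -> N (fun x => - h x) = N h.
Proof.
move=> Nh; rewrite (_ : (fun x => - h x) = fun x => -1 * h x).
  by rewrite (bfs_scale bfsN)// normrN1 mul1e.
by apply/funext => x; rewrite mulN1r.
Qed.

Lemma rin_sub_sym (h k : R -> R) : (N (h \- k)%R < +oo)%E ->
  N (k \- h)%R = N (h \- k)%R.
Proof.
by move=> Nhk; rewrite -[RHS]rin_oppr//; congr (N _); apply/funext => x /=; rewrite opprB.
Qed.

Lemma rin_sub_lty (h k : R -> R) : (N h < +oo)%E -> (N k < +oo)%E ->
  (N (h \- k)%R < +oo)%E.
Proof.
move=> Nh Nk; apply: (@le_lt_trans _ _ (N h + N (fun x => - k x)%R)%E).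
  by apply: (bfs_triangle bfsN) => //; rewrite /function_space/= rin_oppr.
by apply: lte_add_pinfty => //; rewrite rin_oppr.
Qed.

(* If the norms of the heads of G stay above e, the uncountably many
   translates of G are pairwise e/2-separated. *)
Lemma rin_cutoff_small (G : R -> R) (e : R) : separable_space N -> rc_noninc G ->
  (N G < +oo)%E -> 0 < e ->
  exists2 t : R, 0 < t & forall s, 0 < s <= t -> (N (cutoff s G) < e%:E)%E.
Proof.
move=> [u Nu udense] rcG NG e0.
have cut_lty s : (N (cutoff s G) < +oo)%E.
  have rcs := rc_noninc_cutoff s rcG.
  apply: (le_lt_trans _ NG); apply: (rin_mono riN) => //; first exact: measurable_noninc.
  move=> x /andP[x0 _]; rewrite !ger0_norm ?(rcn_ge0 rcs)// ?(rcn_ge0 rcG)//.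
  by rewrite /cutoff; case: ifP => // _; exact: (rcn_ge0 rcG).
have cut_le s t : s <= t -> (N (cutoff s G) <= N (cutoff t G))%E.
  move=> st; have rcs := rc_noninc_cutoff s rcG; have rct := rc_noninc_cutoff t rcG.
  apply: (rin_mono riN) => //; first exact: measurable_noninc.
  move=> x /andP[x0 _]; rewrite !ger0_norm ?(rcn_ge0 rcs)// ?(rcn_ge0 rct)//.
  rewrite /cutoff x0/=; case: ifPn => [xs|_]; first by rewrite (lt_le_trans xs st).
  by case: ifP => // _; exact: (rcn_ge0 rcG).
apply: contrapT => not_small.
have cut_ge t : 0 < t -> (e%:E <= N (cutoff t G))%E.
  move=> t0; rewrite leNgt; apply/negP => Nt; apply: not_small; exists t => //.
  by move=> s /andP[s0 st]; apply: le_lt_trans Nt; exact: cut_le.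
(* Heads of length 1/4 that start between 1/4 and 1/2 stay inside []0, 1[]. *)
pose g th := translate th 4^-1 G.
have Ng th : 4^-1 < th < 2^-1 -> (N (g th) < +oo)%E.
  by move=> th01; rewrite rin_translate//; move: th01; lra.
have sep th ph : 4^-1 < th < 2^-1 -> 4^-1 < ph < 2^-1 -> th < ph ->
    ((e / 2)%:E <= N (g th \- g ph)%R)%E.
  (* To the right of [ph] the translate by [th] is at most [m], while the one by [ph] is still near
     its singularity. On a stretch of length [eta] so short that [m] times the norm of its indicator
     is below [e / 2], the difference keeps norm at least [e / 2]. *)
  move=> th01 ph01 thph; set m := G (ph - th).
  have m0 : 0 <= m by apply: (rcn_ge0 rcG); rewrite subr_gt0.
  have e'0 : 0 < e / (2 * (m + 1)) by rewrite divr_gt0// mulr_gt0// ltr_wpDl.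
  have [t0 /andP[t00 t01] Ht0] := rin_cutoff1_small riN alpha_gt0 e'0.
  pose eta := Num.min t0 4^-1.
  have eta0 : 0 < eta by rewrite lt_min t00; lra.
  have eta4 : eta <= 4^-1 by rewrite ge_min lexx orbT.
  have etat0 : eta <= t0 by rewrite ge_min lexx.
  have Neta := Ht0 eta; rewrite eta0 etat0 in Neta; have {}Neta := Neta isT.
  have N1 : (N (cutoff eta (cst 1))%R < +oo)%E by exact: lt_trans Neta (ltry _).
  have ph0 : 0 <= ph by move: ph01; lra.
  have eta0' : 0 <= eta by exact: ltW.
  have ph1 : ph + eta <= 1 by move: ph01 eta4; lra.
  have rc1 : rc_noninc (cst 1 : R -> R) by exact: rc_noninc_cst.
  have Nsub : (N (g th \- g ph)%R < +oo)%E by apply: rin_sub_lty; exact: Ng.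
  have N1' : (N (translate ph eta (cst 1))%R < +oo)%E.
    by rewrite rin_translate.
  have Nabs : N (fun x => `|g th x - g ph x|)%R = N (g th \- g ph)%R.
    have mabs : measurable_fun I01 (fun x => `|g th x - g ph x|).
      apply: (measurableT_comp (@normr_measurable _ _)).
      by apply: measurable_funB; exact: measurable_translate.
    have Nle : (N (fun x => `|g th x - g ph x|)%R <= N (g th \- g ph)%R)%E.
      by apply: (rin_mono riN) => // x _; rewrite normr_id.
    apply/eqP; rewrite eq_le Nle/=; apply: (rin_mono riN).
    - by apply: measurable_funB; exact: measurable_translate.
    - exact: le_lt_trans Nle Nsub.
    - by move=> x _; rewrite normr_id.
  have Nabs' : (N (fun x => `|g th x - g ph x|)%R < +oo)%E by rewrite Nabs.
  have : (e%:E <= N (g th \- g ph)%R + (m%:E * N (cutoff eta (cst 1))%R))%E.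
    apply: le_trans (cut_ge _ eta0) _.
    rewrite -(@rin_translate ph eta G)//.
    rewrite -Nabs -[X in (_ * X)%E](@rin_translate ph eta (cst 1))//.
    rewrite -(rin_scale riN)//.
    have Nm : (N (fun x => m * translate ph eta (cst 1) x)%R < +oo)%E.
      exact: (rin_scale_lty riN).
    apply: (le_trans _ (bfs_triangle bfsN Nabs' Nm)).
    apply: (rin_mono riN).
    - exact: measurable_translate.
    - by apply: le_lt_trans (bfs_triangle bfsN Nabs' Nm) _; exact: lte_add_pinfty.
    - move=> x _; rewrite ger0_norm ?translate_ge0//; apply: le_trans (ler_norm _).
      rewrite /= /translate; case: ifPn => [xin|_]; last first.
        by rewrite mulr0 addr0 normr_ge0.
      rewrite mulr1 -lerBlDr; rewrite /g [translate ph _ _ _]/translate ifT; last first.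
        by move: xin eta4; lra.
      apply: (@le_trans _ _ (G (x - ph) - translate th 4^-1 G x)); last first.
        by rewrite distrC ler_norm.
      rewrite lerD2l lerN2 /translate; case: ifP => // xin'.
      by apply: (rcn_noninc rcG); [rewrite subr_gt0|rewrite lerD2r; move: xin; lra].
  have Nfin : N (g th \- g ph)%R \is a fin_num.
    by rewrite ge0_fin_numE//; exact: bfs_ge0 bfsN _.
  have N1fin : N (cutoff eta (cst 1))%R \is a fin_num.
    by rewrite ge0_fin_numE//; exact: bfs_ge0 bfsN _.
  rewrite -(fineK Nfin) -(fineK N1fin) -EFinM -EFinD !lee_fin.
  have arith (a b : R) : 0 <= a -> a * (2 * (m + 1)) < e -> e <= b + m * a -> e / 2 <= b.
    by move=> *; lra.
  apply: arith; first by apply: fine_ge0; exact: bfs_ge0 bfsN _.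
  move: Neta; rewrite -(fineK N1fin) lte_fin ltr_pdivlMr//.
  by rewrite mulr_gt0// ltr_wpDl.
(* Two translates within [e / 4] of the same [u k] would be closer than [e / 2], so a countable
   dense family would inject an interval into the integers. *)
have e40 : 0 < e / 4 by rewrite divr_gt0.
have [k Hk] : exists k : R -> nat, forall th, 4^-1 < th < 2^-1 ->
    (N (g th \- u (k th))%R < (e / 4)%:E)%E.
  suff /choice[k Hk] : forall th, exists k, 4^-1 < th < 2^-1 ->
      (N (g th \- u k)%R < (e / 4)%:E)%E by exists k.
  move=> th; have [th01|] := boolP (4^-1 < th < 2^-1); last by exists 0%N.
  by have [k Hk] := udense (g th) _ (Ng th th01) e40; exists k.
have kinj th ph : 4^-1 < th < 2^-1 -> 4^-1 < ph < 2^-1 -> th < ph -> k th != k ph.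
  move=> th01 ph01 thph; apply/negP => /eqP kk.
  have Nth := Hk _ th01; have Nph := Hk _ ph01; rewrite -kk in Nph.
  have Nu' := Nu (k th).
  have N1 := rin_sub_lty (Ng _ th01) Nu'.
  have N2 := rin_sub_lty (Ng _ ph01) Nu'.
  have := sep th ph th01 ph01 thph; rewrite leNgt => /negP; apply.
  rewrite (_ : (g th \- g ph) = (g th \- u (k th)) \+ (u (k th) \- g ph)); last first.
    by apply/funext => x /=; rewrite addrA subrK.
  apply: le_lt_trans (bfs_triangle bfsN _ _) _ => //.
    by rewrite /function_space/= rin_sub_sym.
  rewrite (rin_sub_sym N2) (_ : e / 2 = e / 4 + e / 4); last by lra.
  by rewrite EFinD; exact: lteD.
have : countable (`]4^-1, 2^-1[%classic : set R).
  apply/countable_injP; exists k => th ph; rewrite !inE/= !in_itv/= => th01 ph01 kk.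
  have [thph|thph|//] := ltgtP th ph.
    by have := kinj _ _ th01 ph01 thph; rewrite kk eqxx.
  by have := kinj _ _ ph01 th01 thph; rewrite kk eqxx.
move=> /countable_lebesgue_measure0; rewrite lebesgue_measure_itv/= lte_fin.
rewrite ifT; last by lra.
by rewrite -EFinB => -[]; lra.
Qed.

End order_continuity.

(** * From the covering property to finiteness of the norm *)

(** After multiplication by [m], the terms in [k * ck] cancel up to [2 * (C - 1) * (k * ck)], which
    the last hypothesis absorbs. *)
Lemma prefix_arith (R : realType) (m e1 ck C k S Sd e' E0 c1 Sg e : R) :
  0 < m -> 1 <= C -> m^-1 * S - e' * Sd <= 2 * (e1 + ck * (C * (k / m))) ->
  m * e1 <= m * E0 + (c1 + Sg - k * ck) -> m * (e' * Sd) <= e -> k * ck <= c1 + Sg ->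
  S <= 2 * (m * E0) + 2 * C * c1 + 2 * C * Sg + e.
Proof.
move=> m0 C1 /(ler_wpM2l (ltW m0)); rewrite mulrBr mulVKf ?gt_eqF//.
have -> : m * (2 * (e1 + ck * (C * (k / m)))) = 2 * (m * e1) + 2 * C * ck * (m * (k / m)).
  by lra.
rewrite [m * (k / m)]mulrCA divff ?gt_eqF// mulr1 => H1 H2 H3 H4.
have : (C - 1) * (k * ck) <= (C - 1) * (c1 + Sg) by apply: ler_wpM2l => //; lra.
by lra.
Qed.

Section oscillation_to_norm.
Context (d : measure_display) (T : measurableType d) (R : realType).
Variables (mu : {measure set T -> \bar R}) (D : set T).
Hypotheses (mD : measurable D) (muD : mu D = 1%E).
Variables f g : T -> R.
Hypotheses (fint : mu.-integrable D (EFin \o f)) (gint : mu.-integrable D (EFin \o g)).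
Variable C : nat.
Hypothesis C0 : (0 < C)%N.
(** All that the geometry of cubes contributes; [covering_superlevel] provides it with
    [C = 2 ^ n.+1]. The slack [e] reflects that the stopping cubes cover only most of the superlevel
    set. *)
Hypothesis covering : forall (l e : R), 0 <= l -> 0 < e ->
  (mu (superlevel D f l) <= (C%:R^-1)%:E)%E ->
  exists U : set T, [/\ measurable U, U `<=` D,
    (mu U <= C%:R%:E * mu (superlevel D f l))%E,
    (mu (superlevel D f l `\` U) <= e%:E)%E &
    (\int[mu]_(x in U) (excess f l x)%:E <= 2%:E * \int[mu]_(x in U) `|g x|%:E)%E].

Local Notation F := (rearrangement mu D f).
Local Notation G := (rearrangement mu D g).

Let mf : measurable_fun D f.
Proof. by apply/measurable_EFinP; case/integrableP : fint. Qed.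
Let mg : measurable_fun D g.
Proof. by apply/measurable_EFinP; case/integrableP : gint. Qed.

Let rcF : rc_noninc F := rc_noninc_rearrangement mD muD mf.
Let rcG : rc_noninc G := rc_noninc_rearrangement mD muD mg.

Section grid.
Variables q L : nat.
Hypotheses (Cq : (C <= q)%N) (L0 : (0 < L)%N).
Let M := (q * L)%N.
Let a (m : nat) : R := F (m%:R / M%:R).
Let c (m : nat) : R := G (m%:R / M%:R).

Let q0 : (0 < q)%N. Proof. exact: leq_trans Cq. Qed.
Let M0 : (0 < M)%N. Proof. by rewrite muln_gt0 q0. Qed.
Let M0' : 0 < M%:R :> R. Proof. by rewrite ltr0n. Qed.
Let frac_gt0 j : 0 < j.+1%:R / M%:R :> R. Proof. by rewrite divr_gt0. Qed.
Let frac_le (i j : nat) : (i <= j)%N -> i%:R / M%:R <= j%:R / M%:R :> R.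
Proof. by move=> ij; rewrite ler_pM2r ?invr_gt0// ler_nat. Qed.
Let a_ge0 j : 0 <= a j.+1. Proof. exact: (rcn_ge0 rcF). Qed.
Let c_ge0 j : 0 <= c j.+1. Proof. exact: (rcn_ge0 rcG). Qed.
Let a_noninc i j : (i <= j)%N -> a j.+1 <= a i.+1.
Proof. by move=> ij; apply: (rcn_noninc rcF) => //; exact: frac_le. Qed.
Let c_noninc i j : (i <= j)%N -> c j.+1 <= c i.+1.
Proof. by move=> ij; apply: (rcn_noninc rcG) => //; exact: frac_le. Qed.

(** Descends through the levels [a i.+1]: the set where [|f| >= a i.+1] has measure at least
    [i.+1 / M], and at most [e] of it lies outside [U]. *)
Let excess_lower (U : set T) (e : R) (k i : nat) :
  measurable U -> U `<=` D -> 0 <= e -> (i <= k)%N ->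
  (mu (superlevel D f (a k.+1) `\` U) <= e%:E)%E ->
  ((\sum_(0 <= j < i) (a j.+1 - a j.+2) * (j.+1%:R / M%:R - e))%:E <=
    \int[mu]_(x in U) (excess f (a i.+1) x)%:E)%E.
Proof.
move=> mU UD e0 + eU; elim: i => [_|i IH ik].
  by rewrite big_nil; apply: integral_ge0 => x _; rewrite lee_fin excess_ge0.
have ai : a i.+2 <= a i.+1 by exact: a_noninc.
apply: le_trans (integral_excess_lower mD fint mU UD ai).
rewrite big_nat_recr//= EFinD; apply: leeD; first exact/IH/ltnW.
(* Equal levels contribute nothing. Otherwise [a i.+1] is positive, as the lower bound on the
   measure requires, and exceeds [a k.+1], which puts its level set inside the superlevel set that
   [U] nearly covers. *)
have [->|ai'] := eqVneq (a i.+1) (a i.+2); first by rewrite subrr mul0r mul0e.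
have {}ai' : a i.+2 < a i.+1 by rewrite lt_neqAle eq_sym ai' ai.
rewrite EFinM; apply: lee_wpmul2l; first by rewrite lee_fin subr_ge0.
set A := D `&` [set x | a i.+1 <= `|f x|].
have mA : measurable A := measurable_superlevel_ge mD mf _.
have muA : ((i.+1%:R / M%:R)%:E <= mu A)%E.
  apply: (mu_superlevel_ge_rearrangement mD muD mf) => //.
  by apply: le_lt_trans ai'; exact: a_ge0.
have UA : U `&` [set x | a i.+1 <= `|f x|] = A `&` U.
  by apply/seteqP; split=> [x [Ux /= lx]|x [[Dx /= lx] Ux]]; do ?split=> //; exact: UD.
rewrite UA EFinB leeBlDr//; apply: le_trans muA _.
rewrite (measureDI mu mA mU) addeC; apply: leeD2l; apply: le_trans eU.
apply: le_measure; rewrite ?inE.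
- exact: measurableD.
- by apply: measurableD => //; exact: measurable_superlevel.
move=> x [[Dx /= fx] nUx]; split=> //; split=> //=.
by apply: lt_le_trans fx; apply: le_lt_trans ai'; exact: a_noninc.
Qed.

Let index_mul_le k : k.+1%:R * c k.+1 <= c 1 + \sum_(0 <= j < k) c j.+1.
Proof.
elim: k => [|k IH]; first by rewrite big_nil mul1r addr0.
rewrite big_nat_recr//= addrA -natr1 mulrDl mul1r; apply: lerD.
  by apply: le_trans IH; apply: ler_wpM2l => //; exact: c_noninc.
exact: c_noninc.
Qed.

(** The covering is used at the level [a k.+1], whose superlevel set has measure at most
    [k.+1 / M <= 1 / q <= 1 / C]. On the side of [g], the integral over [U] is cut at the level
    [c k.+1] and then expanded along the grid. *)
Lemma prefix_sum_le (k : nat) : (k < L)%N ->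
  \sum_(0 <= j < k) j.+1%:R * (a j.+1 - a j.+2) <=
  (2 * (M%:R * excess_mass mu D g (G M%:R^-1)) + 2 * C%:R * G M%:R^-1) +
  2 * C%:R * \sum_(0 <= j < k) c j.+1.
Proof.
move=> kL; apply/ler_addgt0Pr => e e0.
set Sd := \sum_(0 <= j < k) (a j.+1 - a j.+2).
have Sd0 : 0 <= Sd by apply: sumr_ge0 => j _; rewrite subr_ge0 a_noninc.
(* The uncovered parts cost [M * e' * Sd] in total, at most [e]. *)
pose e' := e / (M%:R * (Sd + 1)).
have den0 : 0 < M%:R * (Sd + 1) by rewrite mulr_gt0// ltr_wpDl.
have e'0 : 0 < e' by rewrite divr_gt0.
have mu_k : (mu (superlevel D f (a k.+1)) <= (k.+1%:R / M%:R)%:E)%E.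
  exact: (mu_superlevel_rearrangement mD muD mf).
have [|U [mU UD muU muE JU]] := covering (a_ge0 k) e'0.
  apply: le_trans mu_k _; rewrite lee_fin ler_pdivrMr// ler_pdivlMl ?ltr0n//.
  by rewrite -natrM ler_nat leq_mul.
have low := excess_lower mU UD (ltW e'0) (leqnn k) muE.
have h0 : 0 < M%:R^-1 :> R by rewrite invr_gt0.
have Jk : ((\int[mu]_(x in U) `|g x|%:E) <=
    (excess_mass mu D g (c k.+1) + c k.+1 * (C%:R * (k.+1%:R / M%:R)))%:E)%E.
  apply: le_trans (integral_le_excess mD gint mU UD (c_ge0 k)) _.
  rewrite EFinD; apply: leeD.
    rewrite (excess_massE mD gint (c_ge0 k)); exact: integral_excess_subset.
  rewrite EFinM; apply: lee_wpmul2l; first by rewrite lee_fin.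
  by apply: le_trans muU _; rewrite EFinM; apply: lee_wpmul2l.
have two0 : (0 <= 2%:E :> \bar R)%E by rewrite lee_fin.
have := le_trans low (le_trans JU (lee_wpmul2l two0 Jk)).
rewrite -EFinM lee_fin.
have Jgrid := excess_mass_grid mD muD gint k h0.
have Jgrid' : M%:R * excess_mass mu D g (c k.+1) <=
    M%:R * excess_mass mu D g (G M%:R^-1) +
    (c 1 + \sum_(0 <= j < k) c j.+1 - k.+1%:R * c k.+1).
  have := ler_wpM2l (ltW M0') Jgrid.
  by rewrite mulrDr mulrA divff ?gt_eqF// mul1r /c mul1r.
have -> : \sum_(0 <= j < k) (a j.+1 - a j.+2) * (j.+1%:R / M%:R - e') =
    M%:R^-1 * (\sum_(0 <= j < k) j.+1%:R * (a j.+1 - a j.+2)) - e' * Sd.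
  rewrite /Sd !mulr_sumr -sumrB; apply: eq_bigr => j _.
  rewrite mulrBr; congr (_ - _); last by rewrite mulrC.
  by rewrite mulrC -mulrA mulrCA.
have Me' : M%:R * (e' * Sd) <= e.
  rewrite /e' [leLHS](_ : _ = e * ((M%:R * Sd) / (M%:R * (Sd + 1)))).
    by rewrite ler_piMr ?(ltW e0)// ler_pdivrMr// mul1r ler_pM2l// lerDl.
  by rewrite mulrA mulrCA -[LHS]mulrA; congr (_ * _); rewrite mulrAC.
have C1 : 1 <= C%:R :> R by rewrite ler1n.
have cE : G M%:R^-1 = c 1 by rewrite /c mul1r.
rewrite cE in Jgrid' *; move=> low_up.
exact: (prefix_arith M0' C1 low_up Jgrid' Me' (index_mul_le k)).
Qed.

End grid.
Variable N : (R -> R) -> \bar R.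
Local Notation lam := (@lebesgue_measure R).
Local Notation I01 := (`]0, 1[%classic : set R).
Hypotheses (riN : ri_space lam I01 N) (alpha_gt0 : 0 < lower_boyd_index N).
Hypothesis NG : (N G < +oo)%E.

Let bfsN : banach_function_space lam I01 N := ri_bfs riN.

Let capped (u v : R) (t : R) : R := Num.max 0 (Num.min (F t) (F u) - F v).

Let capped_ge0 u v t : 0 <= capped u v t.
Proof. by rewrite le_max lexx. Qed.

Let capped_homo u u' v t : 0 < u -> u <= u' -> capped u' v t <= capped u v t.
Proof.
move=> u0 uu'; apply: (le_max2 (lexx _)); rewrite lerD2r; apply: (le_min2 (lexx _)).
exact: (rcn_noninc rcF).
Qed.

Let measurable_F : measurable_fun I01 F := measurable_noninc rcF.

Let measurable_capped u v : measurable_fun I01 (capped u v).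
Proof.
apply: measurable_maxr => //; apply: measurable_funB => //.
exact: measurable_minr.
Qed.

Let cutoff_lty s : (N (cutoff s G) < +oo)%E.
Proof. exact: (rin_cutoff_lty mD muD gint riN NG). Qed.

Let cutoff_le s t : s <= t -> (N (cutoff s G) <= N (cutoff t G))%E.
Proof.
move=> st; have rcs := rc_noninc_cutoff s rcG; have rct := rc_noninc_cutoff t rcG.
apply: (rin_mono riN) => //; first exact: measurable_noninc.
move=> x /andP[x0 _]; rewrite !ger0_norm ?(rcn_ge0 rcs)// ?(rcn_ge0 rct)//.
rewrite /cutoff x0/=; case: ifPn => [xs|_]; first by rewrite (lt_le_trans xs st).
by case: ifP => // _; exact: (rcn_ge0 rcG).
Qed.

Let capped_lty u v : 0 < u -> 0 < v -> (N (capped u v) < +oo)%E.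
Proof.
move=> u0 v0; have Fu0 := rcn_ge0 rcF u0; have Fv0 := rcn_ge0 rcF v0.
apply: (@rin_bounded _ _ riN _ (F u)); first exact: measurable_capped.
move=> t /andP[t0 _]; rewrite /capped ger0_norm ?le_max ?lexx// ge_max Fu0/=.
apply: (@le_trans _ _ (F u - F v)); first by rewrite lerD2r ge_min lexx orbT.
by rewrite gerBl.
Qed.

(** A grid with [1 / M <= u] is chosen. The boundary constant [2 * M * E0 + 2 * C * G (1 / M)],
    times the norm of the indicator of []0, 1/M[], is at most [4 + 2 * C] times the norm of the head
    of [G], whatever the grid; hence a constant free of [q] and [u]. *)
Let rin_capped_le_cutoff : exists2 K : R, 0 <= K & forall (q : nat) (u : R),
  (C <= q)%N -> 0 < u ->
  (N (capped u q%:R^-1) <= K%:E * N (cutoff q%:R^-1 G))%E.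
Proof.
have [K1 K10 HK1] := rin_dyadic_sum_le riN alpha_gt0.
exists (2 * (2 * C%:R) * K1 + 2 * (4 + 2 * C%:R)).
  by rewrite addr_ge0// !mulr_ge0// addr_ge0// mulr_ge0.
move=> q u Cq u0.
have q0 : (0 < q)%N by exact: leq_trans Cq.
have q0' : 0 < q%:R :> R by rewrite ltr0n.
have [L L0 Lu] : exists2 L : nat, (0 < L)%N & (q * L)%:R^-1 <= u.
  have [k ku] := ltr_add_invr u0; exists k.+1 => //; apply/ltW/(le_lt_trans _ ku).
  rewrite add0r lef_pV2 ?posrE ?ltr0n ?muln_gt0 ?q0// ler_nat.
  by rewrite leq_pmull.
set M := (q * L)%N in Lu.
have M0 : (0 < M)%N by rewrite muln_gt0 q0.
have M0' : 0 < M%:R :> R by rewrite ltr0n.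
have iM0 : 0 < M%:R^-1 :> R by rewrite invr_gt0.
set E0 := excess_mass mu D g (G M%:R^-1).
have E00 : 0 <= E0 by exact: excess_mass_ge0.
have GM0 : 0 <= G M%:R^-1 by exact: (rcn_ge0 rcG).
pose K := 2 * (M%:R * E0) + 2 * C%:R * G M%:R^-1.
have K0 : 0 <= K by rewrite addr_ge0// mulr_ge0// mulr_ge0.
have C20 : 0 <= 2 * C%:R :> R by rewrite mulr_ge0.
have cut1 t : 1 <= t -> cutoff q%:R^-1 G t = 0.
  move=> t1; rewrite /cutoff; case: ifP => // /andP[_ tq].
  have : q%:R^-1 <= 1 :> R by rewrite invf_le1// ler1n.
  by move=> /(lt_le_trans tq); rewrite ltNge t1.
have := @rin_capped_le R N riN F G q L (2 * C%:R) K rcF rcG NG q0 L0 C20 K0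
  (prefix_sum_le Cq L0) K1 (HK1 _ (rc_noninc_cutoff _ rcG) cut1 (cutoff_lty _)).
have M1 : (N (capped u q%:R^-1) <= N (capped M%:R^-1 q%:R^-1))%E.
  apply: (rin_mono riN); [exact: measurable_capped| |].
    by apply: capped_lty => //; rewrite invr_gt0.
  by move=> t _; rewrite !ger0_norm//; exact: capped_homo.
move=> H; apply: le_trans (le_trans M1 H) _.
have X0 : (0 <= N (cutoff q%:R^-1 G))%E := bfs_ge0 bfsN _.
have P1 : (0 <= (2 * (2 * C%:R) * K1)%:E)%E by rewrite lee_fin !mulr_ge0.
have P2 : (0 <= (2 * (4 + 2 * C%:R) : R)%:E)%E by rewrite lee_fin mulr_ge0// addr_ge0.
rewrite [(_ + 2 * (4 + _))%:E]EFinD (ge0_muleDl _ P1 P2); apply: leeD2l.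
have phi0 : (0 <= N (cutoff M%:R^-1 (cst 1))%R)%E := bfs_ge0 bfsN _.
have X0' : (0 <= N (cutoff M%:R^-1 G))%E := bfs_ge0 bfsN _.
have A1 := rin_excess_mass_le mD muD gint riN NG M0.
have A2 := rin_cutoff1_le mD muD gint riN NG M0.
have A3 : (N (cutoff M%:R^-1 G) <= N (cutoff q%:R^-1 G))%E.
  by apply: cutoff_le; rewrite lef_pV2 ?posrE// ler_nat /M leq_pmulr.
have f1 : N (cutoff M%:R^-1 (cst 1))%R \is a fin_num.
  by rewrite ge0_fin_numE//; exact: (rin_cutoff1_lty riN).
have f2 : N (cutoff M%:R^-1 G) \is a fin_num by rewrite ge0_fin_numE.
have f3 : N (cutoff q%:R^-1 G) \is a fin_num by rewrite ge0_fin_numE.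
move: A1 A2 A3; rewrite -(fineK f1) -(fineK f2) -(fineK f3) -!EFinM !lee_fin /K -/E0.
have arith (c m x p y z : R) : 0 <= c -> m * p <= 2 * y -> x * p <= y -> y <= z ->
    2 * (2 * m + 2 * c * x) * p <= 2 * (4 + 2 * c) * z.
  move=> c0 H1 H2 H3; have := ler_wpM2l c0 (le_trans H2 H3); lra.
exact: arith.
Qed.

Let rin_fatou_lty : fatou_property lam I01 N -> (N F < +oo)%E.
Proof.
move=> fatouN; have [K K0 HK] := rin_capped_le_cutoff.
have C0' : 0 < C%:R^-1 :> R by rewrite invr_gt0 ltr0n.
(* The increasing limit of the truncations. Adding back the constant [F (1 / C)], which has finite
   norm, dominates [F]. *)
pose h t := Num.max 0 (F t - F C%:R^-1).
have mh : measurable_fun I01 h.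
  by apply: measurable_maxr => //; apply: measurable_funB.
have : N (capped k.+1%:R^-1 C%:R^-1) @[k --> \oo] --> N h.
  apply: fatouN => //.
    by move=> k; apply: capped_lty => //; rewrite invr_gt0.
  apply: aeW => t /=; rewrite in_itv/= => /andP[t0 t1]; split.
    move=> k; rewrite capped_ge0/=; apply: capped_homo; first by rewrite invr_gt0.
    by rewrite lef_pV2 ?posrE// ler_nat.
  apply: cvg_near_cst; have [k kt] := ltr_add_invr t0; exists k => // j /= kj.
  rewrite /capped /h min_l//; apply: (rcn_noninc rcF); first by rewrite invr_gt0.
  rewrite add0r in kt; apply: le_trans (ltW kt).
  by rewrite lef_pV2 ?posrE// ler_nat ltnS.
have {}HK k : (N (capped k.+1%:R^-1 C%:R^-1) <= K%:E * N (cutoff C%:R^-1 G))%E.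
  by apply: HK => //; rewrite invr_gt0.
move=> /cvge_to_le/(_ (nearW _ HK)) Nh.
have Nh_lty : (N h < +oo)%E.
  by apply: le_lt_trans Nh _; apply: lte_mul_pinfty.
have FC0 : 0 <= F C%:R^-1 by exact: (rcn_ge0 rcF).
have Nc := rin_scale_lty riN FC0 (bfs_Linfty bfsN).
have Nhc := bfs_triangle bfsN Nh_lty Nc.
have Nhc_lty := le_lt_trans Nhc (lte_add_pinfty Nh_lty Nc).
apply: (le_lt_trans _ Nhc_lty); apply: (rin_mono riN) => //.
move=> t /andP[t0 t1]; rewrite ger0_norm ?(rcn_ge0 rcF)//.
apply: le_trans (ler_norm _); rewrite /= mulr1 -lerBlDr /h le_max lexx orbT//.
Qed.

Let rin_separable_lty : separable_space N -> (N F < +oo)%E.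
Proof.
move=> sepN; have [K K0 HK] := rin_capped_le_cutoff.
have inv0 k : 0 < k.+1%:R^-1 :> R by rewrite invr_gt0.
pose w (k : nat) t := Num.min (F t) (F k.+1%:R^-1).
have mw k : measurable_fun I01 (w k) by exact: measurable_minr.
have Nw k : (N (w k) < +oo)%E.
  apply: (@rin_bounded _ _ riN _ (F k.+1%:R^-1)) => // t /andP[t0 _].
  rewrite /w ger0_norm; first by rewrite ge_min lexx orbT.
  by rewrite le_min !(rcn_ge0 rcF).
have Finv i j : (i <= j)%N -> F i.+1%:R^-1 <= F j.+1%:R^-1.
  by move=> ij; apply: (rcn_noninc rcF) => //; rewrite lef_pV2 ?posrE// ler_nat.
have wB i j : (i <= j)%N -> w j \- w i = capped j.+1%:R^-1 i.+1%:R^-1.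
  move=> ij; apply/funext => t; rewrite /w /capped /=.
  have := Finv _ _ ij; set x := F t; set y := F _; set z := F _ => zy.
  (* Successive truncations differ by a capped function, whose norm the head of [G] controls. *)
  by case: (leP x y); case: (leP x z); case: (leP 0 _); lra.
have cauchy (e : R) : 0 < e -> exists n0 : nat, forall i j : nat,
    (n0 <= i)%N -> (n0 <= j)%N -> (N (w i \- w j)%R < e%:E)%E.
  move=> e0; have e'0 : 0 < e / (K + 1) by rewrite divr_gt0// ltr_wpDl.
  have [t t0 Ht] := rin_cutoff_small riN alpha_gt0 sepN rcG NG e'0.
  have [k kt] := ltr_add_invr t0; rewrite add0r in kt.
  have main i j : (maxn k C <= i)%N -> (i <= j)%N -> (N (w j \- w i)%R < e%:E)%E.
    rewrite geq_max => /andP[ki Ci] ij; rewrite wB//.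
    apply: le_lt_trans (HK i.+1 _ (leqW Ci) (inv0 j)) _.
    have Ncut := Ht i.+1%:R^-1; rewrite inv0/= in Ncut.
    have {}Ncut : (N (cutoff i.+1%:R^-1 G) < (e / (K + 1))%:E)%E.
      apply: Ncut; apply: le_trans (ltW kt).
      by rewrite lef_pV2 ?posrE// ler_nat ltnS.
    have cfin : N (cutoff i.+1%:R^-1 G) \is a fin_num.
      by rewrite ge0_fin_numE//; exact: bfs_ge0 bfsN _.
    move: Ncut; rewrite -(fineK cfin) -EFinM !lte_fin ltr_pdivlMr ?ltr_wpDl//.
    have : 0 <= fine (N (cutoff i.+1%:R^-1 G)) by apply: fine_ge0; exact: bfs_ge0 bfsN _.
    by set b := fine _ => b0; rewrite mulrDr mulr1 mulrC => ?; lra.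
  exists (maxn k C) => i j ki kj; have [ij|/ltnW ji] := leqP i j; last exact: main.
  by rewrite (rin_sub_sym riN) ?main// (lt_trans (main _ _ ki ij))// ltry.
have [h Nh wh] := bfs_complete bfsN Nw cauchy.
have mh := bfs_measurable bfsN Nh.
(* On [[1/(m+1), 1[] the truncations of index at least [m] coincide with [F], so their limit [h]
   agrees with [F] there almost everywhere; countably many [m] exhaust []0, 1[]. *)
have Fh m : {ae lam, forall x, I01 x ->
    (F x - h x) * \1_(`[m.+1%:R^-1, +oo[%classic) x = 0}.
  apply: (bfs_eq0 bfsN); apply/eqP; rewrite eq_le (bfs_ge0 bfsN) andbT.
  apply: (cvge_to_ge (cvg_comp _ _ (cvg_addnl m) wh)); apply: nearW => k /=.
  apply: (rin_mono riN).
  - apply: measurable_funM; first exact: measurable_funB.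
    apply: measurable_indic; exact: measurable_itv.
  - exact: (rin_sub_lty riN).
  move=> x /andP[x0 x1]; rewrite indicE; case: (boolP (x \in _)); last first.
    by rewrite mulr0 normr0.
  rewrite inE/= in_itv/= andbT => mx; rewrite mulr1 /w min_l//.
  apply: (rcn_noninc rcF) => //; apply: le_trans mx.
  by rewrite lef_pV2 ?posrE// ler_nat ltnS leq_addr.
apply: (@le_lt_trans _ _ (N h)) => //; apply: (bfs_lattice bfsN) => //.
have := ae_foralln Fh; apply: filterS => x Fx Ix.
have x0 : 0 < x by move: Ix; rewrite /= in_itv/= => /andP[].
have [m mx] := ltr_add_invr x0; rewrite add0r in mx.
have := Fx m Ix; rewrite indicE mem_set/= ?in_itv/= ?andbT ?(ltW mx)//.
by rewrite mulr1 => /eqP; rewrite subr_eq0 => /eqP ->.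
Qed.

Lemma rin_rearrangement_lty : (N F < +oo)%E.
Proof. by have [] := ri_separable_or_fatou riN. Qed.

End oscillation_to_norm.

(** * Dyadic cubes and stopping times *)

Section integral_monotone.
Context (d : measure_display) (T : measurableType d) (R : realType).
Variable mu : {measure set T -> \bar R}.
Local Open Scope ereal_scope.

(** The integral of a nonnegative function is a supremum over simple functions below it, hence
    monotone without measurability. This serves for the inner integral of the mean oscillation as a
    function of [x]. *)
Lemma ge0_le_integral_subset (A B : set T) (f g : T -> \bar R) :
  A `<=` B -> (forall x, A x -> 0 <= f x) -> (forall x, B x -> 0 <= g x) ->
  (forall x, A x -> f x <= g x) ->
  \int[mu]_(x in A) f x <= \int[mu]_(x in B) g x.
Proof.
move=> AB f0 g0 fg; rewrite !ge0_integralE//; apply: le_ereal_sup.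
move=> _ [h hf <-]; exists h => // x; apply: le_trans (hf x) _; rewrite /patch.
case: ifPn => [xA|_]; last by case: ifPn => // xB; apply: g0; exact: set_mem.
have Ax := set_mem xA.
by rewrite ifT ?inE//; [exact: fg|exact: AB].
Qed.

End integral_monotone.

(** Adds up an inequality over the pieces found in the children of a cube; [P] is a class on which
    both set functions are additive. *)
Lemma fin_additive_le (T : Type) (R : realType) (P : set (set T))
    (m1 m2 : set T -> \bar R) (B : finType) (A : B -> set T) :
  m1 set0 = 0%E -> m2 set0 = 0%E ->
  P set0 -> (forall X Y, P X -> P Y -> P (X `|` Y)) ->
  (forall X Y, P X -> P Y -> X `&` Y = set0 -> m1 (X `|` Y) = m1 X + m1 Y)%E ->
  (forall X Y, P X -> P Y -> X `&` Y = set0 -> m2 (X `|` Y) = m2 X + m2 Y)%E ->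
  (forall b, P (A b)) -> trivIset setT A ->
  (forall b, m1 (A b) <= m2 (A b))%E ->
  (m1 (\bigcup_b A b) <= m2 (\bigcup_b A b))%E.
Proof.
move=> m10 m20 P0 PU m1D m2D PA tA m12.
have -> : \bigcup_b A b = \big[setU/set0]_(b <- enum B) A b.
  rewrite -bigcup_seq; apply/seteqP; split=> x [b _ Abx]; exists b => //=.
  by rewrite mem_enum.
have : uniq (enum B) by exact: enum_uniq.
suff H (s : seq B) : uniq s -> P (\big[setU/set0]_(b <- s) A b) /\
    (m1 (\big[setU/set0]_(b <- s) A b) <= m2 (\big[setU/set0]_(b <- s) A b))%E.
  by move=> /H[].
elim: s => [|b s IH] /=; first by rewrite big_nil m10 m20.
move=> /andP[bs /IH[Ps les]]; rewrite big_cons.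
have dis : A b `&` \big[setU/set0]_(j <- s) A j = set0.
  rewrite -bigcup_seq -subset0 => x [Abx [j /= js Ajx]].
  have bj : b = j by apply: (tA b j) => //; exists x.
  by move: bs; rewrite bj js.
split; first exact: PU.
by rewrite m1D// m2D//; exact: leeD.
Qed.

Section half_open_cubes.
Variables (R : realType) (n : nat).
Local Notation mu := (lebesgue_tuple n : {sigma_finite_measure set (n.-tuple R) -> \bar R}).

Lemma measurable_box (A : 'I_n -> set R) : (forall i, measurable (A i)) ->
  measurable [set x : n.-tuple R | forall i, A i (tnth x i)].
Proof.
move=> mA; rewrite (_ : [set x | _] =
    \bigcap_(i in [set: 'I_n]) ((@tnth n R ^~ i) @^-1` A i)).
  apply: fin_bigcap_measurable => // i _.
  by rewrite -[X in measurable X]setTI; exact: measurable_tnth.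
by apply/seteqP; split=> [x Ax i _|x Ax i]; [exact: Ax|exact: (Ax i)].
Qed.

End half_open_cubes.

Lemma lebesgue_tuple_box (R : realType) (n : nat) (A : 'I_n -> set R) (v : R) :
  (forall i, measurable (A i)) -> (forall i, lebesgue_measure (A i) = v%:E) ->
  lebesgue_tuple n [set x | forall i, A i (tnth x i)] = (v ^+ n)%:E.
Proof.
elim: n A => [|n IH] A mA Av.
  by rewrite expr0 /= diracE mem_set// => -[].
rewrite (_ : [set x | _] = [set x : n.+1.-tuple R | A ord0 (thead x) /\
    [set y : n.-tuple R | forall i, A (lift ord0 i) (tnth y i)] [tuple of behead x]]).
  rewrite [LHS]lebesgue_consE//; last first.
    by apply: (measurable_box (A := fun i => A (lift ord0 i))) => i; exact: mA.
  rewrite exprS EFinM Av; congr (_ * _)%E.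
  by apply: (IH (fun i => A (lift ord0 i))) => i; [exact: mA|exact: Av].
have liftE (i : 'I_n) : inord i.+1 = lift ord0 i :> 'I_n.+1.
  by apply/val_inj; rewrite /= inordK// ltnS.
apply/seteqP; split=> x /=.
  move=> Ax; split; first exact: Ax.
  by move=> i; rewrite tnth_behead liftE; exact: Ax.
move=> [x0 Ax] i; case: (unliftP ord0 i) => [j ->|->]; last exact: x0.
by have := Ax j; rewrite tnth_behead liftE.
Qed.

Section dyadic_cubes.
Variables (R : realType) (n : nat).
Local Notation Rn := (n.-tuple R).
Local Notation mu := (lebesgue_tuple n : {sigma_finite_measure set Rn -> \bar R}).
Implicit Types (c : Rn) (l : R) (D E : set Rn).

(** Half-open, so that the children partition their parent exactly; the closed cubes of the
    oscillation condition differ from these by null sets. *)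
Definition hcube c l : set Rn :=
  [set x | forall i, `[tnth c i, tnth c i + l[%classic (tnth x i)].

Definition child c l (b : {ffun 'I_n -> bool}) : Rn :=
  [tuple tnth c i + (if b i then l / 2 else 0) | i < n].

Lemma hcubeP c l x :
  hcube c l x <-> (forall i, tnth c i <= tnth x i < tnth c i + l).
Proof. by split=> + i => /(_ i); rewrite /= in_itv. Qed.

Lemma measurable_hcube c l : measurable (hcube c l).
Proof. apply: (measurable_box (A := fun i => `[tnth c i, tnth c i + l[%classic)) => i.
exact: measurable_itv. Qed.

Lemma mu_hcube c l : 0 < l -> mu (hcube c l) = (l ^+ n)%:E.
Proof.
move=> l0.
apply: (lebesgue_tuple_box (A := fun i => `[tnth c i, tnth c i + l[%classic)) => i.
  exact: measurable_itv.
rewrite lebesgue_measure_itv/= lte_fin ltrDl l0 EFinD addeAC subee//.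
by rewrite add0e.
Qed.

Lemma hcube_subset_cube c l (l0 : 0 < l) : hcube c l `<=` cube_set (Cube c l0).
Proof. by move=> x /hcubeP cx i; have /andP[-> /ltW ->] := cx i. Qed.

Lemma mu_cubeDhcube c l (l0 : 0 < l) : mu (cube_set (Cube c l0) `\` hcube c l) = 0%E.
Proof.
rewrite measureD; first last.
- by rewrite [X in (X < _)%E](lebesgue_tuple_cube (Cube c l0)) ltry.
- exact: measurable_hcube.
- exact: measurable_cube_set.
rewrite setIidr; last exact: hcube_subset_cube.
by rewrite [X in (X - _)%E](lebesgue_tuple_cube (Cube c l0)) [X in (_ - X)%E]mu_hcube// subee.
Qed.

Lemma child_subset c l b : 0 < l -> hcube (child c l b) (l / 2) `<=` hcube c l.
Proof.
move=> l0 x /hcubeP bx; apply/hcubeP => i; have := bx i; rewrite tnth_mktuple.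
by case: (b i); lra.
Qed.

Lemma child_cube_subset c l b (l0 : 0 < l) (l20 : 0 < l / 2) :
  cube_set (Cube (child c l b) l20) `<=` cube_set (Cube c l0).
Proof.
move=> x bx i; have := bx i; rewrite /= tnth_mktuple.
by case: (b i); move: l0; lra.
Qed.

Lemma hcube_children c l : 0 < l ->
  hcube c l = \bigcup_b hcube (child c l b) (l / 2).
Proof.
move=> l0; apply/seteqP; split=> [x /hcubeP cx|x [b _]]; last exact: child_subset.
exists [ffun i => tnth c i + l / 2 <= tnth x i] => //; apply/hcubeP => i.
rewrite tnth_mktuple ffunE; have := cx i.
by case: (leP (tnth c i + l / 2)); lra.
Qed.

Lemma trivIset_children c l : trivIset setT (fun b => hcube (child c l b) (l / 2)).
Proof.
move=> b b' _ _ [x [/hcubeP bx /hcubeP b'x]]; apply/ffunP => i.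
have := bx i; have := b'x i; rewrite !tnth_mktuple.
by case: (b i) (b' i) => -[]//; lra.
Qed.

(* D is, inside the cube with corner c and side l, a union of its dyadic
   subcubes of generation J. *)
Fixpoint dyadic (J : nat) D c l : Prop :=
  if J is J'.+1 then forall b, dyadic J' D (child c l b) (l / 2)
  else hcube c l `<=` D \/ hcube c l `&` D = set0.

Lemma dyadicS J D c l : 0 < l -> dyadic J D c l -> dyadic J.+1 D c l.
Proof.
elim: J c l => [|J IH] c l l0 HD b; last first.
  by apply: IH; [lra|exact: HD].
case: HD => [cD|cD]; [left|right].
  by apply: subset_trans cD; exact: child_subset.
by rewrite -subset0 -cD => x [bx Dx]; split=> //; move: bx; exact: child_subset.
Qed.

Lemma dyadic_leq J J' D c l : (J <= J')%N -> 0 < l -> dyadic J D c l -> dyadic J' D c l.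
Proof.
move=> JJ' l0; rewrite -(subnKC JJ'); elim: (J' - J)%N => [|k IH]; first by rewrite addn0.
by move=> /IH; rewrite addnS; exact: dyadicS.
Qed.

Lemma dyadicC J D c l : dyadic J D c l -> dyadic J (~` D) c l.
Proof.
elim: J c l => [|J IH] c l /= HD; last by move=> b; apply: IH; exact: HD.
case: HD => cD; [right|left].
  by rewrite -subset0 => x [/cD].
by move=> x cx Dx; have : (hcube c l `&` D) x by []; rewrite cD.
Qed.

Lemma dyadicU J D D' c l : dyadic J D c l -> dyadic J D' c l -> dyadic J (D `|` D') c l.
Proof.
elim: J c l => [|J IH] c l /= HD HD'; last by move=> b; exact: IH.
case: HD => [cD|cD]; first by left => x cx; left; exact: cD.
case: HD' => [cD'|cD']; first by left => x cx; right; exact: cD'.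
by right; rewrite setIUr cD cD' setU0.
Qed.

(** [m] ranges over all integers so that the induction can pass to children that the hyperplane
    misses. *)
Lemma dyadic_ray J c l (i : 'I_n) (m : int) : 0 < l ->
  dyadic J [set x | tnth x i < tnth c i + l * (m%:~R / 2 ^+ J)] c l.
Proof.
elim: J c l m => [|J IH] c l m l0 /=.
  have [m0|m0] := leP m 0.
    right; rewrite -subset0 => x [/hcubeP /(_ i)/andP[cx _]] /=.
    rewrite ltNge => /negP; apply; apply: le_trans cx.
    by rewrite gerDl expr0 divr1 mulr_ge0_le0 ?(ltW l0)// lerz0.
  left => x /hcubeP /(_ i)/andP[_ cx] /=; apply: lt_le_trans cx _.
  by rewrite lerD2l expr0 divr1 ler_peMr ?(ltW l0)// -[1]/(1%:~R) ler_int.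
(* Seen from the right half of the edge, the same hyperplane has index [m - 2 ^ J]. *)
move=> b; pose m' : int := if b i then m - 2 ^+ J else m.
have l20 : 0 < l / 2 by lra.
have -> : tnth c i + l * (m%:~R / 2 ^+ J.+1) =
    tnth (child c l b) i + l / 2 * (m'%:~R / 2 ^+ J).
  have J0 : 2 ^+ J != 0 :> R by rewrite expf_neq0.
  rewrite tnth_mktuple /m' exprS invfM; case: (b i); last by rewrite addr0; lra.
  by rewrite rmorphB rmorphXn/= mulrBl divff//; lra.
exact: IH.
Qed.

End dyadic_cubes.

(** * Approximation in measure by dyadic sets *)

Section dyadic_approximation.
Variables (R : realType) (n : nat) (c : n.-tuple R) (l : R).
Hypothesis l0 : 0 < l.
Local Notation Rn := (n.-tuple R).
Local Notation mu := (lebesgue_tuple n : {sigma_finite_measure set Rn -> \bar R}).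
Local Notation H := (hcube c l).
Implicit Types D E : set Rn.

Let mH : measurable H := measurable_hcube c l.

Definition dyadic_approx E : Prop := measurable E /\ forall e : R, 0 < e ->
  exists J D, [/\ measurable D, dyadic J D c l & (mu (H `&` (E `+` D)) < e%:E)%E].

Let measurable_sdiff D E : measurable D -> measurable E -> measurable (H `&` (D `+` E)).
Proof.
by move=> mD mE; apply: measurableI => //; apply: measurableU; exact: measurableD.
Qed.

Let sdiff_le3 A A1 A2 B1 B2 : measurable A -> measurable A1 -> measurable A2 ->
  measurable B1 -> measurable B2 -> A `<=` (A1 `+` B1) `|` (A2 `+` B2) ->
  (mu (H `&` A) <= mu (H `&` (A1 `+` B1)) + mu (H `&` (A2 `+` B2)))%E.
Proof.
move=> mA mA1 mA2 mB1 mB2 AB.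
apply: le_trans (measureU2 _ (measurable_sdiff mA1 mB1) (measurable_sdiff mA2 mB2)).
apply: le_measure; rewrite ?inE; [exact: measurableI| |].
  by apply: measurableU; exact: measurable_sdiff.
by move=> x [Hx /AB[]]; [left|right].
Qed.

Lemma dyadic_approx0 : dyadic_approx set0.
Proof.
split=> // e e0; exists 0%N, set0; split=> //; first by right; rewrite setI0.
by rewrite /setY !set0D setU0 setI0 measure0 lte_fin.
Qed.

Lemma dyadic_approxC E : dyadic_approx E -> dyadic_approx (~` E).
Proof.
move=> [mE HE]; split; first exact: measurableC.
move=> e e0; have [J [D [mD HD muD]]] := HE e e0; exists J, (~` D); split.
- exact: measurableC.
- exact: dyadicC.
- rewrite (_ : ~` E `+` ~` D = E `+` D)// /setY !setDE !setCK setUC.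
  by rewrite [E `&` _]setIC [D `&` _]setIC.
Qed.

Lemma dyadic_approxU E E' : dyadic_approx E -> dyadic_approx E' -> dyadic_approx (E `|` E').
Proof.
move=> [mE HE] [mE' HE']; split; first exact: measurableU.
move=> e e0; have e20 : 0 < e / 2 by lra.
have [J [D [mD HD muD]]] := HE _ e20; have [J' [D' [mD' HD' muD']]] := HE' _ e20.
exists (maxn J J'), (D `|` D'); split; first exact: measurableU.
  by apply: dyadicU; [apply: dyadic_leq HD|apply: dyadic_leq HD'];
    rewrite ?leq_maxl ?leq_maxr.
rewrite (_ : e = e / 2 + e / 2); last by lra.
rewrite EFinD; apply: le_lt_trans (lteD muD muD').
apply: sdiff_le3 => //.
  by apply: measurableU; apply: measurableD => //; exact: measurableU.
by move=> x [[[Ex|Ex] /not_orP[nD nD']]|[[Dx|Dx] /not_orP[nE nE']]];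
  [left; left|right; left|left; right|right; right].
Qed.

(** Finite unions come within [e / 2] of the countable one, by continuity from above inside a cube
    of finite measure. *)
Lemma dyadic_approx_bigcup (E : nat -> set Rn) : (forall k, dyadic_approx (E k)) ->
  dyadic_approx (\bigcup_k E k).
Proof.
move=> HE; have mE k : measurable (E k) by case: (HE k).
have mUE : measurable (\bigcup_k E k) by exact: bigcup_measurable.
split=> // e e0; have e20 : 0 < e / 2 by lra.
pose S m := \big[setU/set0]_(k < m) E k.
have HS m : dyadic_approx (S m).
  rewrite /S; elim: m => [|m IH]; first by rewrite big_ord0; exact: dyadic_approx0.
  by rewrite big_ord_recr/=; exact: dyadic_approxU.
have mS m : measurable (S m) by case: (HS m).
have : mu (H `&` ((\bigcup_k E k) `\` S m)) @[m --> \oo] -->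
    mu (\bigcap_m (H `&` ((\bigcup_k E k) `\` S m))).
  apply: nonincreasing_cvg_mu.
  - apply: (@le_lt_trans _ _ (mu H)); last first.
      by rewrite [X in (X < _)%E](mu_hcube c l0) ltry.
    apply: le_measure; rewrite ?inE; [|exact: mH|exact: subIsetl].
    by apply: measurableI => //; exact: (measurableD mUE (mS _)).
  - by move=> m; apply: measurableI => //; exact: (measurableD mUE (mS _)).
  - apply: bigcap_measurable => // m _; apply: measurableI => //.
    exact: (measurableD mUE (mS _)).
  - move=> i j ij; apply/subsetPset => x [Hx [Ex nSx]]; split=> //; split=> // Sx.
    apply: nSx; move: Sx; rewrite /S -!bigcup_mkord => -[k /= ki Ekx].
    by exists k => //=; exact: leq_trans ij.
rewrite (_ : \bigcap_m _ = set0) ?measure0; last first.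
  rewrite -subset0 => x Hx; have [_ [[k _ Ekx] _]] := Hx 0%N Logic.I.
  have [_ [_ []]] := Hx k.+1 Logic.I.
  by rewrite /S -bigcup_mkord; exists k => //=.
move=> /(@cvge_near_lt _ _ _ (e / 2)%:E); rewrite lte_fin => /(_ e20)[m _ /(_ m (leqnn _)) /= mum].
have [J [D [mD HD muD]]] := (HS m).2 _ e20; exists J, D; split=> //.
rewrite (_ : e = e / 2 + e / 2); last by lra.
rewrite EFinD; apply: le_lt_trans (lteD mum muD).
have -> : \bigcup_k E k `\` S m = \bigcup_k E k `+` S m.
  apply/seteqP; split=> x; first by left.
  move=> [//|[Sx []]]; move: Sx; rewrite /S -bigcup_mkord => -[k _ Ekx].
  by exists k.
apply: sdiff_le3 => //.
  by apply: measurableU; exact: measurableD.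
move=> x; have [Sx|nSx] := pselect (S m x).
  by move=> [[Ex nDx]|[Dx nEx]]; [right; left|left; right].
by move=> [[Ex nDx]|[Dx nEx]]; [left; left|right; right].
Qed.

Let coord_approx (i : 'I_n) (B : set R) : measurable B ->
  dyadic_approx ((fun x : Rn => tnth x i) @^-1` B).
Proof.
pose X := [set B : set R | dyadic_approx ((fun x : Rn => tnth x i) @^-1` B)].
suff XB : (measurable : set (set R)) `<=` X by exact: XB.
rewrite [X in X `<=` _](RGenInftyO.measurableE R); apply: smallest_sub.
  split; rewrite /X/=.
  - by rewrite preimage_set0; exact: dyadic_approx0.
  - by move=> A HA; rewrite setTD preimage_setC; exact: dyadic_approxC.
  - by move=> A HA; rewrite preimage_bigcup; exact: dyadic_approx_bigcup.
move=> _ [r ->]; rewrite /X/=.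
(* [q J] is the largest dyadic position of generation [J] not beyond [r]; these positions approach
   [r] from below, so the open ray is the union of the rays they bound. *)
pose m J : int := Num.floor (2 ^+ J * ((r - tnth c i) / l)).
pose q J : R := tnth c i + l * ((m J)%:~R / 2 ^+ J).
have J0 (J : nat) : 0 < 2 ^+ J :> R by exact: exprn_gt0.
have q_le J : q J <= r.
  rewrite -lerBrDl mulrC -ler_pdivlMr// ler_pdivrMr// mulrC.
  exact: ge_floor.
have q_gt J : r - l / 2 ^+ J < q J.
  have rE : r - tnth c i = l * ((r - tnth c i) / l) by rewrite mulrC divfK ?gt_eqF.
  have : 2 ^+ J * ((r - tnth c i) / l) < (m J + 1)%:~R by exact: floorD1_gt.
  rewrite -ltr_pdivlMl// -(ltr_pM2l l0) -rE intrD mulrDr mulrDr mulr1.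
  by rewrite /q [_^-1 * _%:~R]mulrC; lra.
rewrite (_ : _ @^-1` _ = \bigcup_J [set x : Rn | tnth x i < q J]); last first.
  apply/seteqP; split=> x /=; rewrite in_itv/=; last first.
    by move=> [J _ /= xq]; exact: lt_le_trans (q_le J).
  rewrite -subr_gt0 => xr.
  have xrl : 0 < (r - tnth x i) / l by rewrite divr_gt0.
  have [J HJ] := ltr_add_invr xrl; rewrite add0r in HJ.
  exists J => //=; apply: le_lt_trans (q_gt J); rewrite lerBrDr -lerBrDl.
  rewrite mulrC -ler_pdivlMr//; apply/ltW/(le_lt_trans _ HJ).
  by rewrite lef_pV2 ?posrE// -natrX ler_nat ltn_expl.
apply: dyadic_approx_bigcup => J; split.
  rewrite (_ : [set x | _] = (fun x : Rn => tnth x i) @^-1` `]-oo, (q J)[).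
    by rewrite -[X in measurable X]setTI; apply: measurable_tnth => //; exact: measurable_itv.
  by apply/seteqP; split=> x /=; rewrite in_itv.
move=> e e0; exists J, [set x | tnth x i < q J]; split.
- rewrite (_ : [set x | _] = (fun x : Rn => tnth x i) @^-1` `]-oo, (q J)[).
    by rewrite -[X in measurable X]setTI; apply: measurable_tnth => //; exact: measurable_itv.
  by apply/seteqP; split=> x /=; rewrite in_itv.
- exact: dyadic_ray.
- by rewrite /setY !setDv setU0 setI0 measure0 lte_fin.
Qed.

(** The approximable sets form a sigma-algebra containing the preimages of measurable sets under the
    coordinates, which generate the measurable sets of tuples. *)
Lemma measurable_dyadic_approx E : measurable E -> dyadic_approx E.
Proof.
move=> mE; suff : measurable `<=` dyadic_approx by exact.
apply: smallest_sub.
  split; first exact: dyadic_approx0.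
  - by move=> A HA; rewrite setTD; exact: dyadic_approxC.
  - exact: dyadic_approx_bigcup.
move=> A; rewrite -bigcup_seq => -[i _ [B mB <-]]; rewrite setTI.
exact: coord_approx.
Qed.

End dyadic_approximation.

(** * Stopping cubes for a superlevel set *)

Section calderon_zygmund.
Variables (R : realType) (n : nat) (Q0 : cube R n).
Local Notation Rn := (n.-tuple R).
Local Notation mu := (lebesgue_tuple n : {sigma_finite_measure set Rn -> \bar R}).
Local Notation D0 := (cube_set Q0).
Hypothesis volume_Q0 : mu D0 = 1%E.
Variables f g : Rn -> R.
Hypotheses (fint : mu.-integrable D0 (EFin \o f)) (gint : mu.-integrable D0 (EFin \o g)).
Hypothesis osc_le : forall Q : cube R n, cube_set Q `<=` D0 ->
  (mean_oscillation f Q <= \int[mu]_(x in cube_set Q) (g x)%:E)%E.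

Let mD0 : measurable D0 := measurable_cube_set Q0.
Let mf : measurable_fun D0 f.
Proof. by apply/measurable_EFinP; case/integrableP : fint. Qed.
Let mg : measurable_fun D0 g.
Proof. by apply/measurable_EFinP; case/integrableP : gint. Qed.

Section level.
Variable lev : R.
Hypothesis lev0 : 0 <= lev.
Local Notation E := (superlevel D0 f lev).

Let mE : measurable E := measurable_superlevel mD0 mf lev.

Let mexcess A : A `<=` D0 -> measurable_fun A (fun x => (excess f lev x)%:E).
Proof.
move=> AD; apply/measurable_EFinP; apply: measurable_funS mD0 AD _.
exact: (measurable_excess fint).
Qed.

Let mabsg A : A `<=` D0 -> measurable_fun A (fun x => `|g x|%:E).
Proof.
move=> AD; apply/measurable_EFinP; apply: (measurableT_comp (@normr_measurable _ _)).
exact: measurable_funS mD0 AD mg.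
Qed.

Let excess_le_dist x y : ~ E y -> D0 y -> excess f lev x <= `|f x - f y|.
Proof.
move=> nEy Dy; rewrite /excess ge_max normr_ge0 andbT.
have fy : `|f y| <= lev by rewrite leNgt; apply/negP => ?; apply: nEy.
have := lerB_dist (f x) (f y); lra.
Qed.

(** At least half of the cube consists of points [y] outside [E], for which [|f x - f y|] is at
    least the excess at [x]. Averaging over [y] bounds the mean oscillation below by half the
    integral of the excess. *)
Lemma integral_excess_hcube c l (l0 : 0 < l) : cube_set (Cube c l0) `<=` D0 ->
  (mu (E `&` hcube c l) <= (l ^+ n / 2)%:E)%E ->
  (\int[mu]_(x in hcube c l) (excess f lev x)%:E <=
   2%:E * \int[mu]_(x in hcube c l) `|g x|%:E)%E.
Proof.
set Q := Cube c l0; set H := hcube c l => QD EH.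
have HQ : H `<=` cube_set Q := @hcube_subset_cube _ _ _ _ l0.
have HD := subset_trans HQ QD.
have mH : measurable H := measurable_hcube c l.
have mQ : measurable (cube_set Q) := measurable_cube_set Q.
have v0 : 0 < l ^+ n by exact: exprn_gt0.
have muH : mu H = (l ^+ n)%:E := mu_hcube c l0.
have muHE : ((l ^+ n / 2)%:E <= mu (H `\` E))%E.
  have muHE : mu H = (mu (H `\` E) + mu (H `&` E))%E := measureDI mu mH mE.
  rewrite muH in muHE.
  have fin2 : mu (H `&` E) \is a fin_num.
    rewrite ge0_fin_numE//; apply: le_lt_trans (ltry (l ^+ n / 2)).
    by rewrite setIC.
  have -> : mu (H `\` E) = ((l ^+ n)%:E - mu (H `&` E))%E by rewrite muHE addeK.
  rewrite leeBrDr//; apply: le_trans (leeD2l _ (_ : _ <= (l ^+ n / 2)%:E)%E) _.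
    by rewrite setIC.
  by rewrite -EFinD lee_fin; lra.
have inner x : ((l ^+ n / 2 * excess f lev x)%:E <=
    \int[mu]_(y in cube_set Q) `|f x - f y|%:E)%E.
  apply: (@le_trans _ _ (\int[mu]_(y in H `\` E) (excess f lev x)%:E)%E).
    rewrite integral_cst; last exact: measurableD.
    rewrite EFinM muleC; apply: lee_wpmul2l => //; rewrite lee_fin; exact: excess_ge0.
  apply: ge0_le_integral_subset.
  - by move=> y [Hy _]; exact: HQ.
  - by move=> y _; rewrite lee_fin excess_ge0.
  - by move=> y _; rewrite lee_fin.
  - by move=> y [Hy nEy]; rewrite lee_fin; apply: excess_le_dist => //; exact: HD.
have intE : (\int[mu]_(x in H) (excess f lev x)%:E =
    \int[mu]_(x in cube_set Q) (excess f lev x)%:E)%E.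
  rewrite [RHS](@ge0_negligible_integral _ _ _ mu _ (cube_set Q `\` H))//.
  - congr integral; rewrite setDD setIidr//.
  - exact: measurableD.
  - exact: mexcess.
  - by move=> x _; rewrite lee_fin excess_ge0.
  - exact: mu_cubeDhcube.
have intg : (\int[mu]_(x in H) `|g x|%:E = \int[mu]_(x in cube_set Q) `|g x|%:E)%E.
  rewrite [RHS](@ge0_negligible_integral _ _ _ mu _ (cube_set Q `\` H))//.
  - congr integral; rewrite setDD setIidr//.
  - exact: measurableD.
  - exact: mabsg.
  - exact: mu_cubeDhcube.
have half_osc : ((2^-1)%:E * \int[mu]_(x in H) (excess f lev x)%:E <= mean_oscillation f Q)%E.
  rewrite /mean_oscillation [X in (fine X)^-1%:E]lebesgue_tuple_cube /= intE.
  rewrite [leLHS](_ : _ = ((l ^+ n)^-1)%:E * ((l ^+ n / 2)%:E *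
      \int[mu]_(x in cube_set Q) (excess f lev x)%:E))%E; last first.
    by rewrite muleA -EFinM mulrA mulVf ?mul1r// gt_eqF.
  apply: lee_wpmul2l; first by rewrite lee_fin invr_ge0 ltW.
  rewrite -ge0_integralZl_EFin//; last 3 first.
  - by move=> x _; rewrite lee_fin excess_ge0.
  - exact: mexcess.
  - by rewrite divr_ge0// ltW.
  apply: ge0_le_integral_subset => //.
  - by move=> x _; rewrite -EFinM lee_fin mulr_ge0 ?excess_ge0// divr_ge0// ltW.
  - by move=> x _; apply: integral_ge0 => y _; rewrite lee_fin.
  - by move=> x _; rewrite -EFinM; exact: inner.
have oscg : (mean_oscillation f Q <= \int[mu]_(x in H) `|g x|%:E)%E.
  apply: le_trans (osc_le QD) _; rewrite intg.
  apply: le_trans (lee_abs _) _; apply: le_abse_integral => //.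
  by apply/measurable_EFinP; exact: measurable_funS mD0 QD mg.
have := lee_wpmul2l (_ : 0 <= 2%:E)%E (le_trans half_osc oscg).
by rewrite muleA -EFinM mulfV// mul1e; apply; rewrite lee_fin.
Qed.

Let C : R := 2 ^+ n.+1.
Let C0 : 0 < C. Proof. exact: exprn_gt0. Qed.

Let P : set (set Rn) := [set A | measurable A /\ A `<=` D0].

Let P0 : P set0. Proof. by split. Qed.
Let PU X Y : P X -> P Y -> P (X `|` Y).
Proof. by move=> [mX XD] [mY YD]; split; [exact: measurableU|rewrite subUset]. Qed.

(* Descend at most J generations below a cube where E has density at most
   2^-(n+1), and stop at the first subcubes of higher density: there the
   density is still at most 1/2. Subcubes of generation J that are never
   reached by the stopping rule meet E in at most half of their volume, hence
   contribute at most the measure of the symmetric difference with D. *)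
Lemma stopping_cubes J D c l (l0 : 0 < l) : measurable D ->
  cube_set (Cube c l0) `<=` D0 -> dyadic J D c l ->
  (mu (E `&` hcube c l) <= (l ^+ n / C)%:E)%E ->
  exists U : set Rn, [/\ measurable U, U `<=` hcube c l,
    (mu U <= C%:E * mu (E `&` U))%E,
    (mu (E `&` (hcube c l `\` U)) <= mu ((E `+` D) `&` (hcube c l `\` U)))%E &
    (\int[mu]_(x in U) (excess f lev x)%:E <= 2%:E * \int[mu]_(x in U) `|g x|%:E)%E].
Proof.
move=> mD; have mED : measurable (E `+` D) by apply: measurableU; exact: measurableD.
have C2 : 2 <= C by rewrite /C exprS ler_peMr// exprn_ege1// ler1n.
elim: J c l l0 => [|J IH] c l l0 QD HD EH.
  exists set0; rewrite setD0 !setI0 !integral_set0 !measure0 !mule0; split=> //.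
  have mH := measurable_hcube c l.
  (* If [D] misses the cube, all of [E] there lies in the symmetric difference; if [D] contains it,
     the complement of [E] does, and it outweighs [E] since [1 / C <= 1 / 2]. *)
  case: HD => [HD|HD]; last first.
    apply: le_measure; rewrite ?inE; [exact: measurableI|exact: measurableI|].
    move=> x [Ex Hx]; split=> //; left; split=> // Dx.
    by have : (hcube c l `&` D) x by []; rewrite HD.
  apply: (@le_trans _ _ (mu (hcube c l `\` E))); last first.
    apply: le_measure; rewrite ?inE; [exact: measurableD|exact: measurableI|].
    by move=> x [Hx nEx]; split=> //; right; split=> //; exact: HD.
  have muHE : mu (hcube c l) = (mu (hcube c l `\` E) + mu (hcube c l `&` E))%E :=
    measureDI mu mH mE.
  have muH : mu (hcube c l) = (l ^+ n)%:E := mu_hcube c l0.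
  have fin2 : mu (hcube c l `&` E) \is a fin_num.
    by rewrite ge0_fin_numE// setIC; apply: le_lt_trans EH (ltry _).
  have -> : mu (hcube c l `\` E) = ((l ^+ n)%:E - mu (hcube c l `&` E))%E.
    by rewrite -muH muHE addeK.
  rewrite [hcube c l `&` E]setIC in fin2 *.
  rewrite -(fineK fin2) -EFinB lee_fin; move: EH; rewrite -(fineK fin2) lee_fin.
  have vC : l ^+ n / C <= l ^+ n / 2.
    by apply: ler_wpM2l; [exact/ltW/exprn_gt0|rewrite lef_pV2 ?posrE].
  have arith (a v w : R) : w <= v / 2 -> a <= w -> a <= v - a by move=> *; lra.
  exact: arith vC.
have l20 : 0 < l / 2 by lra.
pose Hb b := hcube (child c l b) (l / 2).
have QbD b : cube_set (Cube (child c l b) l20) `<=` D0.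
  by apply: subset_trans QD; exact: child_cube_subset.
have HbD b : Hb b `<=` D0 by apply: subset_trans (QbD b); exact: hcube_subset_cube.
have mHb b : measurable (Hb b) := measurable_hcube _ _.
have pieces b : exists U : set Rn, [/\ measurable U, U `<=` Hb b,
    (mu U <= C%:E * mu (E `&` U))%E,
    (mu (E `&` (Hb b `\` U)) <= mu ((E `+` D) `&` (Hb b `\` U)))%E &
    (\int[mu]_(x in U) (excess f lev x)%:E <= 2%:E * \int[mu]_(x in U) `|g x|%:E)%E].
  have [low|high] := leP (mu (E `&` Hb b)) ((l / 2) ^+ n / C)%:E.
    by apply: (IH _ _ l20) => //; exact: HD.
  exists (Hb b); rewrite setDv !setI0 measure0; split=> //.
    rewrite [X in (X <= _)%E](mu_hcube _ l20).
    move/ltW/(lee_wpmul2l (_ : 0 <= C%:E)%E) : high; rewrite -EFinM.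
    rewrite mulrC divfK ?gt_eqF//; apply; rewrite lee_fin; exact: ltW.
  apply: (integral_excess_hcube (l0 := l20)) => //.
  apply: (@le_trans _ _ (mu (E `&` hcube c l))).
    apply: le_measure; rewrite ?inE; [exact: (measurableI _ _ mE (mHb b))| |].
      by apply: measurableI => //; exact: measurable_hcube.
    by apply: setIS; exact: child_subset.
  apply: le_trans EH _; rewrite lee_fin /C exprMn exprVn exprS invfM.
  by rewrite [_^-1 * _]mulrC mulrA.
have [U HU] := choice pieces.
have mU b : measurable (U b) by case: (HU b).
have UH b : U b `<=` Hb b by case: (HU b).
have UD b : U b `<=` D0 by exact: subset_trans (HbD b).
have tH : trivIset setT Hb by exact: trivIset_children.
have tU : trivIset setT U.
  by move=> b b' _ _ [x [Ux U'x]]; apply: tH => //; exists x; split; apply: UH.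
exists (\bigcup_b U b); split.
- by apply: fin_bigcup_measurable => //; exact: finite_finset.
- rewrite hcube_children// => x [b _ Ux]; exists b => //; exact: UH.
- apply: (fin_additive_le (P := P) (m1 := mu) (m2 := fun A => (C%:E * mu (E `&` A))%E)) => //.
  + by rewrite setI0 measure0 mule0.
  + by move=> X Y [mX _] [mY _] XY; rewrite measureU.
  + move=> X Y [mX _] [mY _] XY; rewrite setIUr measureU; first by rewrite ge0_muleDr.
    * exact: measurableI.
    * exact: measurableI.
    * by rewrite setIACA setIid XY setI0.
  + by move=> b; case: (HU b).
- have -> : hcube c l `\` \bigcup_b U b = \bigcup_b (Hb b `\` U b).
    rewrite hcube_children//; apply/seteqP; split=> x.
      move=> [[b _ Hx] nUx]; exists b => //; split=> // Ux.
      by apply: nUx; exists b.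
    move=> [b _ [Hx nUx]]; split; first by exists b.
    move=> [b' _ U'x]; have bb' : b = b'.
      by apply: (tH b b') => //; exists x; split=> //; exact: UH.
    by apply: nUx; rewrite bb'.
  have add (A : set Rn) X Y : measurable A -> P X -> P Y -> X `&` Y = set0 ->
      mu (A `&` (X `|` Y)) = (mu (A `&` X) + mu (A `&` Y))%E.
    move=> mA [mX _] [mY _] XY; rewrite setIUr measureU//.
    * exact: measurableI.
    * exact: measurableI.
    * by rewrite setIACA setIid XY setI0.
  apply: (fin_additive_le (P := P) (m1 := fun A => mu (E `&` A))
    (m2 := fun A => mu ((E `+` D) `&` A))) => //.
  + by rewrite setI0 measure0.
  + by rewrite setI0 measure0.
  + by move=> X Y; exact: add.
  + by move=> X Y; exact: add.
  + move=> b; split; first exact: measurableD.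
    by move=> x [Hx _]; exact: HbD Hx.
  + move=> b b' _ _ [x [[Hx _] [H'x _]]]; apply: tH => //; by exists x.
  + by move=> b; case: (HU b).
- apply: (fin_additive_le (P := P)
    (m1 := fun A => (\int[mu]_(x in A) (excess f lev x)%:E)%E)
    (m2 := fun A => (2%:E * \int[mu]_(x in A) `|g x|%:E)%E)) => //.
  + by rewrite integral_set0.
  + by rewrite integral_set0 mule0.
  + move=> X Y [mX XD] [mY YD] XY; rewrite ge0_integral_setU//.
    * by apply: mexcess; rewrite subUset.
    * by move=> x _; rewrite lee_fin excess_ge0.
    * by apply/disj_set2P.
  + move=> X Y [mX XD] [mY YD] XY; rewrite ge0_integral_setU//.
    * by rewrite ge0_muleDr//; apply: integral_ge0.
    * by apply: mabsg; rewrite subUset.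
    * by apply/disj_set2P.
  + by move=> b; case: (HU b).
Qed.

(** The descent starts at [Q0], whose unit volume turns the bound on [mu E] into a density. What
    escapes [U] is bounded by the symmetric difference with the approximating dyadic set, up to the
    null boundary part that the half-open cube omits. *)
Lemma covering_superlevel (e : R) : 0 < e -> (mu E <= (C^-1)%:E)%E ->
  exists U : set Rn, [/\ measurable U, U `<=` D0,
    (mu U <= C%:E * mu E)%E, (mu (E `\` U) <= e%:E)%E &
    (\int[mu]_(x in U) (excess f lev x)%:E <= 2%:E * \int[mu]_(x in U) `|g x|%:E)%E].
Proof.
move=> e0 muE; set c := corner Q0; set l := side Q0.
have l0 : 0 < l := side_gt0 Q0.
have QE : cube_set (Cube c l0) = D0 by [].
have ln1 : l ^+ n = 1.
  by have := lebesgue_tuple_cube Q0; rewrite volume_Q0 => -[].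
have HD : hcube c l `<=` D0 by rewrite -QE; exact: hcube_subset_cube.
have mH := measurable_hcube c l.
have [J [D [mD HJ muD]]] := (measurable_dyadic_approx c l0 mE).2 e e0.
have [||U [mU UH muU muEU intU]] := stopping_cubes (l0 := l0) mD _ HJ.
- by rewrite QE.
- rewrite ln1 mul1r; apply: le_trans muE.
  by apply: le_measure; rewrite ?inE//; exact: measurableI.
exists U; split=> //.
- exact: subset_trans HD.
- apply: le_trans muU _; apply: lee_wpmul2l; first by rewrite lee_fin ltW.
  by apply: le_measure; rewrite ?inE//; exact: measurableI.
- have mHU : measurable (hcube c l `\` U) by exact: measurableD.
  have mDH : measurable (D0 `\` hcube c l) by exact: measurableD.
  apply: (@le_trans _ _ (mu ((E `&` (hcube c l `\` U)) `|` (D0 `\` hcube c l)))).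
    apply: le_measure; rewrite ?inE; first exact: measurableD.
      by apply: measurableU => //; exact: measurableI.
    move=> x [Ex nUx]; have [Hx|nHx] := pselect (hcube c l x); first by left.
    by right; split=> //; case: Ex.
  apply: le_trans (measureU2 _ (measurableI _ _ mE mHU) mDH) _.
  have DH0 : mu (D0 `\` hcube c l) = 0%E by rewrite -QE mu_cubeDhcube.
  rewrite [X in (_ + X)%E]DH0 adde0; apply: le_trans muEU _; apply: le_trans (ltW muD).
  have mED : measurable (E `+` D) by apply: measurableU; exact: measurableD.
  apply: le_measure; rewrite ?inE; [exact: measurableI|exact: measurableI|].
  by move=> x [EDx [Hx _]].
Qed.

End level.
End calderon_zygmund.

(** * Garsia-Rodemich spaces *)

Section garsia_rodemich_space.
Variables (R : realType) (n : nat) (Q0 : cube R n).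
Local Notation Rn := (n.-tuple R).
Local Notation mu := (lebesgue_tuple n : {sigma_finite_measure set Rn -> \bar R}).
Local Notation D0 := (cube_set Q0).

Lemma eseries_set1 (a : nat -> \bar R) (k : nat) :
  (\sum_(i <oo | i \in [set k]) a i = a k)%E.
Proof.
apply: lim_near_cst => //; exists k.+1 => // m /= km.
rewrite big_mkcond (bigD1_seq k)/= ?iota_uniq ?mem_index_iota//= mem_set//.
rewrite big1 ?adde0// => i ik; rewrite memNset// => /= ik'.
by rewrite ik' eqxx in ik.
Qed.

(** The defining inequality for the family consisting of [Q] alone. *)
Lemma garo_class_oscillation (f g : Rn -> R) (Q : cube R n) :
  garo_class Q0 f g -> cube_set Q `<=` D0 ->
  (mean_oscillation f Q <= \int[mu]_(x in cube_set Q) (g x)%:E)%E.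
Proof.
move=> [_ /(_ [set 0%N] (fun=> Q))] H QD; move: H; rewrite !eseries_set1; apply.
by split=> // i j -> ->.
Qed.

(** In [|f x - f y| <= |f x| + |f y|] either term, integrated over both variables, gives the volume
    of [Q] times the integral of [|f|]; hence the factor 2. *)
Lemma mean_oscillation_le (f : Rn -> R) (Q : cube R n) :
  measurable_fun D0 f -> cube_set Q `<=` D0 ->
  (mean_oscillation f Q <= \int[mu]_(x in cube_set Q) (2 * `|f x|)%:E)%E.
Proof.
move=> mf0 QD; set v := side Q ^+ n.
have mQ : measurable (cube_set Q) := measurable_cube_set Q.
have muQ : mu (cube_set Q) = v%:E := lebesgue_tuple_cube Q.
have v0 : 0 < v by apply: exprn_gt0; exact: side_gt0.
have mf : measurable_fun (cube_set Q) (fun x => `|f x|%:E).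
  apply/measurable_EFinP; apply: (measurableT_comp (@normr_measurable _ _)).
  exact: measurable_funS (measurable_cube_set Q0) QD mf0.
set I := (\int[mu]_(x in cube_set Q) `|f x|%:E)%E.
have I0 : (0 <= I)%E by apply: integral_ge0 => x _; rewrite lee_fin.
have inner x : (\int[mu]_(y in cube_set Q) `|f x - f y|%:E <= v%:E * `|f x|%:E + I)%E.
  apply: (@le_trans _ _ (\int[mu]_(y in cube_set Q) (`|f x|%:E + `|f y|%:E))%E).
    apply: ge0_le_integral_subset; first by [].
    - by move=> y _; rewrite lee_fin.
    - by move=> y _; rewrite -EFinD lee_fin addr_ge0.
    - by move=> y _; rewrite -EFinD lee_fin ler_normB.
  rewrite ge0_integralD//; apply: leeD => //.
  by rewrite integral_cst// [X in (_ * X)%E]muQ muleC.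
rewrite /mean_oscillation [X in (fine X)^-1%:E]muQ /=.
apply: (@le_trans _ _ (v^-1%:E * (v%:E * I + I * v%:E))%E).
  apply: lee_wpmul2l; first by rewrite lee_fin invr_ge0 ltW.
  apply: (@le_trans _ _ (\int[mu]_(x in cube_set Q) (v%:E * `|f x|%:E + I))%E).
    apply: ge0_le_integral_subset; first by [].
    - by move=> x _; apply: integral_ge0 => y _; rewrite lee_fin.
    - by move=> x _; rewrite adde_ge0// mule_ge0// lee_fin// ltW.
    - by move=> x _; exact: inner.
  rewrite ge0_integralD//; last 2 first.
  - by move=> x _; rewrite mule_ge0// lee_fin// ltW.
  - exact: measurable_funeM.
  rewrite ge0_integralZl_EFin ?(ltW v0)//; apply: leeD2l.
  by rewrite (integral_cst mu mQ I) [X in (_ * X)%E]muQ.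
under [leRHS]eq_integral do rewrite EFinM.
rewrite ge0_integralZl_EFin// -/I [(I * _)%E]muleC -ge0_muleDl ?lee_fin ?(ltW v0)//.
rewrite muleA -EFinD -EFinM mulrDr mulVf ?gt_eqF//.
Qed.

Lemma function_space_garo (X : (Rn -> R) -> \bar R) : cube_ri_space Q0 X ->
  function_space X `<=` garo_space Q0 X.
Proof.
move=> [bfsX _ _] f Xf.
have mD0 : measurable D0 := measurable_cube_set Q0.
have mf := bfs_measurable bfsX Xf.
have mabs : measurable_fun D0 (fun x => `|f x|).
  exact: (measurableT_comp (@normr_measurable _ _)).
have m2 : measurable_fun D0 (fun x => 2 * `|f x|) by exact: measurable_funM.
have fint : mu.-integrable D0 (EFin \o f).
  apply/integrableP; split; first exact/measurable_EFinP.
  have [c Hc] := bfs_L1 bfsX; apply: le_lt_trans (Hc f Xf) _.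
  have Xfin : X f \is a fin_num by rewrite ge0_fin_numE//; exact: (bfs_ge0 bfsX).
  by rewrite -(fineK Xfin) -EFinM ltry.
split=> //; have Xabs : (X (fun x => `|f x|)%R < +oo)%E.
  apply: (le_lt_trans _ Xf); apply: (bfs_lattice bfsX) => //.
  by apply: aeW => x _; rewrite normr_id.
apply: (@le_lt_trans _ _ (X (fun x => 2 * `|f x|)%R)); last first.
  by rewrite (bfs_scale bfsX)// lte_mul_pinfty.
apply: ereal_inf_lbound; exists (fun x => 2 * `|f x|) => //; split.
  have := integrableZl mD0 2 (integrable_abse fint).
  by apply: eq_integrable => // x _; rewrite /= EFinM.
move=> I Q [QD _]; apply: lee_nneseries => i.
  rewrite inE => Ii _; rewrite /mean_oscillation mule_ge0//.
    by rewrite lee_fin invr_ge0 fine_ge0.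
  by apply: integral_ge0 => x _; apply: integral_ge0 => y _; rewrite lee_fin.
rewrite inE => Ii; apply: mean_oscillation_le => //; exact: QD.
Qed.

End garsia_rodemich_space.

Theorem theorem2 (R : realType) (n : nat) (n_gt0 : (0 < n)%N)
    (Q0 : cube R n) (volume_Q0 : lebesgue_tuple n (cube_set Q0) = 1%E)
    (X : (n.-tuple R -> R) -> \bar R) (riX : cube_ri_space Q0 X)
    (Xbar : (R -> R) -> \bar R) (reprX : representation_space Q0 X Xbar)
    (alphaX_gt0 : 0 < lower_boyd_index Xbar) :
  garo_space Q0 X = function_space X.
Proof.
apply/seteqP; split; last exact: function_space_garo.
move=> f [fint /ereal_inf_lt[_ [g gP <-] Xg]].
have [riXbar XE] := reprX; have gint := gP.1.
have mf : measurable_fun (cube_set Q0) f.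
  by apply/measurable_EFinP; case/integrableP : fint.
have mg : measurable_fun (cube_set Q0) g.
  by apply/measurable_EFinP; case/integrableP : gint.
rewrite /function_space/= XE//.
apply: (@rin_rearrangement_lty _ _ _ (lebesgue_tuple n) (cube_set Q0)
  (measurable_cube_set Q0) volume_Q0 f g fint gint (2 ^ n.+1)) => //.
- by rewrite expn_gt0.
- move=> l e l0 e0; rewrite natrX => El.
  apply: (covering_superlevel volume_Q0 fint gint) => //.
  by move=> Q QD; exact: garo_class_oscillation gP QD.
- by rewrite -XE.
Qed.
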